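(* Let $\Omega\subset\mathbb{R}^2$ be a domain of finite measure. Let $f\in W^{2,1}(\Omega,\mathbb{R}^2)$ be a homeomorphism (onto its image) such that $J_f>0$ a.e. in $\Omega$. Then for every $\nu>0$ there are squares $\{Q_i\}_{i=1}^{\infty}$ which are locally finite (i.e. each compact set $K\subset\Omega$ intersects only finitely many of them) with $$\mathcal{L}_2\Bigl(\bigcup_{i=1}^{\infty}Q_i\Bigr)<\nu ,$$ and there is a $C^{\infty}$ diffeomorphism (onto its image) $g:\Omega\setminus\bigcup_{i=1}^{\infty}Q_i\to\mathbb{R}^2$ such that $$\|f-g\|_{W^{2,1}(\Omega\setminus\bigcup_{i=1}^{\infty}Q_i,\,\mathbb{R}^2)}<\nu .$$
   Context: $\mathcal{L}_2$ denotes the two-dimensional Lebesgue measure and $J_f=\det Df$ is the Jacobian determinant. $W^{2,1}$ is the usual Sobolev space of mappings whose distributional derivatives up to order two are integrable. *)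

(* Defs.v *)
From HB Require Import structures.
From mathcomp Require Import all_boot all_order all_algebra.
From mathcomp Require Import all_classical all_reals all_analysis.

Set Implicit Arguments.
Unset Strict Implicit.
Unset Printing Implicit Defensive.

Import Order.TTheory GRing.Theory Num.Theory.
Import numFieldNormedType.Exports.

Local Open Scope classical_set_scope.
Local Open Scope ring_scope.

(* The measurable sets are those of the product of the Borel sigma-algebras;
   this is enough, since almost everywhere statements refer to subsets of null
   sets and every Lebesgue measurable function is a.e. equal to a Borel one. *)
Definition leb2 (R : realType) :
    {measure set (measurableTypeR R * measurableTypeR R) -> \bar R} :=
  (lebesgue_measure \x lebesgue_measure)%E.

Definition domain (R : realType) (U : set (R * R)) : Prop :=
  [/\ open U, connected U & U !=set0].

Definition coordinate (R : realType) (i : 'I_2) (x : R * R) : R :=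
  if i == 0 then x.1 else x.2.

Definition slice (R : realType) (i : 'I_2) (u : R * R -> R) (x : R * R) :
    R -> R :=
  if i == 0 then fun t => u (t, x.2) else fun t => u (x.1, t).

Definition partial (R : realType) (i : 'I_2) (u : R * R -> R) : R * R -> R :=
  fun x => 'D_1 (slice i u x) (coordinate i x).

(* The word w = [:: i_1; ...; i_k] stands for d_(i_1) ... d_(i_k). *)
Definition partials (R : realType) (w : seq 'I_2) (u : R * R -> R) :
    R * R -> R :=
  foldr (@partial R) u w.

(* Meant for open U: C^oo as the existence and continuity in U of all iterated
   partial derivatives. *)
Definition smooth_on (R : realType) (U : set (R * R)) (u : R * R -> R) : Prop :=
  forall (w : seq 'I_2) (x : R * R), U x ->
    {for x, continuous (partials w u)} /\
    (forall i : 'I_2, derivable (slice i (partials w u) x) (coordinate i x) 1).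

Definition smooth_map_on (R : realType) (U : set (R * R))
    (g : R * R -> R * R) : Prop :=
  forall i : 'I_2, smooth_on U (fun x => coordinate i (g x)).

Definition homeomorphism_onto_image (R : realType) (U : set (R * R))
    (f : R * R -> R * R) : Prop :=
  {within U, continuous f} /\
  exists h : R * R -> R * R,
    (forall x, U x -> h (f x) = x) /\ {within f @` U, continuous h}.

Definition diffeomorphism_onto_image (R : realType) (U : set (R * R))
    (g : R * R -> R * R) : Prop :=
  [/\ smooth_map_on U g, open (g @` U) &
      exists h : R * R -> R * R,
        (forall x, U x -> h (g x) = x) /\ smooth_map_on (g @` U) h].

Definition test_function (R : realType) (U : set (R * R))
    (phi : R * R -> R) : Prop :=
  [/\ smooth_on setT phi, compact (closure [set x | phi x != 0]) &
      closure [set x | phi x != 0] `<=` U].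

Definition loc_integrable (R : realType) (U : set (R * R))
    (u : R * R -> R) : Prop :=
  forall K : set (R * R), compact K -> K `<=` U ->
    (leb2 R).-integrable K (EFin \o u).

Definition is_weak_partial (R : realType) (U : set (R * R)) (w : seq 'I_2)
    (u v : R * R -> R) : Prop :=
  [/\ loc_integrable U u, loc_integrable U v &
      forall phi, test_function U phi ->
        \int[leb2 R]_(x in U) (u x * partials w phi x) =
        (-1) ^+ size w * \int[leb2 R]_(x in U) (v x * phi x)].

(* A representative of the weak derivative, which is unique up to a.e.
   equality in U; an arbitrary function if there is no weak derivative. *)
Definition weak_partial (R : realType) (U : set (R * R)) (w : seq 'I_2)
    (u : R * R -> R) : R * R -> R :=
  get [set v | is_weak_partial U w u v].

(* W^{k,1}(U) *)
Definition sobolev1 (R : realType) (k : nat) (U : set (R * R))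
    (u : R * R -> R) : Prop :=
  forall w : seq 'I_2, (size w <= k)%N ->
    (exists v, is_weak_partial U w u v) /\
    (leb2 R).-integrable U (EFin \o weak_partial U w u).

Definition sobolev1_map (R : realType) (k : nat) (U : set (R * R))
    (f : R * R -> R * R) : Prop :=
  forall i : 'I_2, sobolev1 k U (fun x => coordinate i (f x)).

(* The sum over j <= k of the L^1 norm of D^j f, where the tensor D^j f is
   measured by the sum of the absolute values of its entries. *)
Definition sobolev1_norm (R : realType) (k : nat) (U : set (R * R))
    (f : R * R -> R * R) : \bar R :=
  (\sum_(i < 2) \sum_(j < k.+1) \sum_(w : j.-tuple 'I_2)
     \int[leb2 R]_(x in U)
       `|weak_partial U w (fun y => coordinate i (f y)) x|%:E)%E.

(* det Df, with Df the weak differential on U *)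
Definition weak_jacobian (R : realType) (U : set (R * R)) (f : R * R -> R * R)
    (x : R * R) : R :=
  \det (\matrix_(i < 2, j < 2)
          weak_partial U [:: j] (fun y => coordinate i (f y)) x).

(* The closed square with centre c, arbitrary orientation, and half-edges
   (a, b) and (-b, a). *)
Definition is_square (R : realType) (Q : set (R * R)) : Prop :=
  exists (c : R * R) (a b : R), (a, b) != (0, 0) /\
    Q = [set x : R * R | exists s t : R, [/\ `|s| <= 1, `|t| <= 1 &
           x = (c.1 + s * a - t * b, c.2 + s * b + t * a)]].

Definition locally_finite_in (R : realType) (U : set (R * R))
    (Q : nat -> set (R * R)) : Prop :=
  forall K : set (R * R), compact K -> K `<=` U ->
    finite_set [set i | K `&` Q i !=set0].

(* Main.v *)
Require Import Defs.
From mathcomp Require Import all_boot all_order all_algebra.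
From mathcomp Require Import all_classical all_reals all_analysis.
From mathcomp Require Import measurable_realfun zify ring lra.

(* On each cell of a fine dyadic grid replace f by the quadratic map g with the
   value of f at the centre and the cell averages of the first and second weak
   partials of f as coefficients. Averages over dyadic cells converge in L^1, so
   f - g is small in W^{2,1}. By Markov's inequality, outside few cells the
   averages are bounded, the partials oscillate little and the determinant of
   the average of Df is bounded below; these exceptional cells, the cells near
   the boundary and a thin frame of every cell are covered by small grid squares
   and removed. On a remaining cell of side r the mixed second partial controls
   the supremum, so |f - g| is a small multiple of r. As Dg is almost constant
   there and not degenerate, g is injective in the cell, and by the
   Poincare-Miranda theorem every value of g off the frame is a value of f in
   the same cell. The images of different cells are therefore disjoint because
   f is injective, and g is a smooth diffeomorphism of the remaining set. *)

Set Implicit Arguments.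
Unset Strict Implicit.
Unset Printing Implicit Defensive.

Import Order.TTheory GRing.Theory Num.Theory.
Import HBSimple.
Import numFieldNormedType.Exports.

Local Open Scope classical_set_scope.
Local Open Scope ring_scope.

(** * Dyadic cells *)

Section Dyadic.
Context {R : realType}.
Local Notation T2 := (measurableTypeR R * measurableTypeR R)%type.

(** The obstacle is that Df need be neither bounded nor continuous, so g is not close to f in C^1
    and cannot inherit injectivity as a small perturbation. What survives is a uniform bound at the
    right scale: on a cell of side r, |f - g| is at most a constant times r^2 mean|d12 (f - g)| + r
    mean|D(f - g)|, and these means are controlled on all but few cells. If |f - g| <= eta r there
    and the determinant is bounded below, solving f(z) = g(x) moves x by a small multiple of r only.
    The frame therefore has width r [mesh n] for a fixed n, and eta has to be small against
    [mesh n]. Across cells g is discontinuous, which is harmless because the frames separate the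
    cells. The constants are fixed in the order d (lower bound of the Jacobian), C (size of the
    means), n (frame), e (oscillation), m (level of the grid), each depending on the previous ones;
    only e and m have to beat the others. Near the boundary of the domain one grid size would
    destroy local finiteness or leave a gap, so there the removed cells shrink with the distance to
    the boundary. *)

Definition mesh (m : nat) : R := (2 ^+ m)^-1.

Lemma mesh_gt0 m : 0 < mesh m.
Proof. by rewrite invr_gt0 exprn_gt0. Qed.

Lemma mesh_neq0 m : mesh m != 0.
Proof. by rewrite gt_eqF// mesh_gt0. Qed.

Lemma meshD m k : mesh (m + k) = mesh m * mesh k.
Proof. by rewrite /mesh exprD invfM. Qed.

Lemma mesh_cvg0 : mesh m @[m --> \oo] --> (0 : R).
Proof.
have -> : mesh = geometric 1 (2^-1 : R).
  by apply/funext => m; rewrite /geometric /= mul1r /mesh exprVn.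
by apply: cvg_geometric; rewrite ger0_norm// invf_lt1// ltr1n.
Qed.

Definition didx (m : nat) (x : R) : int := Num.floor (x / mesh m).

Definition cidx (m : nat) (x : R * R) : int * int := (didx m x.1, didx m x.2).

Lemma didxP m x (i : int) :
  (didx m x == i) = (i%:~R * mesh m <= x < (i + 1)%:~R * mesh m).
Proof.
rewrite /didx floor_eq.
by rewrite ler_pdivlMr ?mesh_gt0// ltr_pdivrMr ?mesh_gt0.
Qed.

(** Half-open in both coordinates, so that the cells of one level partition the plane and integrals
    split over them. The closed version [ccell] is compact and is what gets removed. *)
Definition cell (m : nat) (c : int * int) : set (R * R) := [set x | cidx m x = c].

Definition ccell (m : nat) (c : int * int) : set (R * R) :=
  [set x | c.1%:~R * mesh m <= x.1 <= (c.1 + 1)%:~R * mesh m /\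
           c.2%:~R * mesh m <= x.2 <= (c.2 + 1)%:~R * mesh m].

Lemma cellE m c : cell m c =
  (`[c.1%:~R * mesh m, (c.1 + 1)%:~R * mesh m[%classic `*`
   `[c.2%:~R * mesh m, (c.2 + 1)%:~R * mesh m[%classic).
Proof.
case: c => i j; apply/seteqP; split => -[x y]; rewrite /cell /cidx /=.
  by case=> /eqP hx /eqP hy; split; rewrite /= in_itv/= -didxP.
by case; rewrite /= !in_itv/= -!didxP => /eqP -> /eqP ->.
Qed.

Lemma ccellE m c : ccell m c =
  (`[c.1%:~R * mesh m, (c.1 + 1)%:~R * mesh m]%classic `*`
   `[c.2%:~R * mesh m, (c.2 + 1)%:~R * mesh m]%classic).
Proof.
by apply/seteqP; split => -[x y] /=; rewrite /ccell/= !in_itv/=.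
Qed.

Lemma cell_sub_ccell m c : cell m c `<=` ccell m c.
Proof.
move=> x; rewrite cellE => -[/=]; rewrite !in_itv/= => /andP[a /ltW b] /andP[d /ltW e].
by split; apply/andP.
Qed.

Lemma measurable_itv2 (I J : interval R) :
  measurable ([set` I] `*` [set` J] : set T2).
Proof. by apply: measurableX; exact: measurable_itv. Qed.

Lemma measurable_cell m c : measurable (cell m c : set T2).
Proof. by rewrite cellE; exact: measurable_itv2. Qed.

Lemma measurable_ccell m c : measurable (ccell m c : set T2).
Proof. by rewrite ccellE; exact: measurable_itv2. Qed.

Lemma lebesgue_measure_itv_le (a b : R) (x y : bool) : a <= b ->
  lebesgue_measure ([set` Interval (BSide x a) (BSide y b)] : set R) = (b - a)%:E.
Proof.
move=> ab; rewrite lebesgue_measure_itv/= lte_fin; case: ltP => // ba.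
by rewrite (le_anti (introT andP (conj ab ba))) subrr.
Qed.

Lemma leb2_itv2 (a b c d : R) (x y z t : bool) : a <= b -> c <= d ->
  leb2 R ([set` Interval (BSide x a) (BSide y b)] `*`
          [set` Interval (BSide z c) (BSide t d)]) = ((b - a) * (d - c))%:E.
Proof.
move=> ab cd; apply: etrans.
  by apply: product_measure1E; exact: measurable_itv.
by rewrite EFinM; congr (_ * _)%E; exact: lebesgue_measure_itv_le.
Qed.

Lemma cell_side m (i : int) : (i + 1)%:~R * mesh m - i%:~R * mesh m = mesh m.
Proof. by rewrite -mulrBl intrD addrAC subrr add0r mul1r. Qed.

Lemma cell_side_le m (i : int) : i%:~R * mesh m <= (i + 1)%:~R * mesh m.
Proof. by rewrite -subr_ge0 cell_side ltW// mesh_gt0. Qed.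

Lemma leb2_cell m c : leb2 R (cell m c) = (mesh m ^+ 2)%:E.
Proof. by rewrite cellE leb2_itv2 ?cell_side_le// !cell_side expr2. Qed.

Lemma leb2_ccell m c : leb2 R (ccell m c) = (mesh m ^+ 2)%:E.
Proof. by rewrite ccellE leb2_itv2 ?cell_side_le// !cell_side expr2. Qed.

(** An enumeration of the cells by natural numbers. Several codes may unpickle to the same cell; the
    test [pickle c == n] keeps one of them, which makes the family disjoint. *)
Definition icell (m n : nat) : set (R * R) :=
  if (unpickle n : option (int * int)) is Some c then
    if pickle c == n then cell m c else set0 else set0.

Lemma icell_pickle m c : icell m (pickle c) = cell m c.
Proof. by rewrite /icell pickleK eqxx. Qed.

Lemma measurable_icell m n : measurable (icell m n : set T2).
Proof.
by rewrite /icell; case: unpickle => // c; case: eqP => // _; exact: measurable_cell.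
Qed.

Lemma trivIset_icell m : trivIset setT (icell m).
Proof.
move=> i j _ _ [x []]; rewrite /icell.
case: unpickle => // c; case: eqP => // <-; rewrite /cell/= => <-.
by case: unpickle => // d; case: eqP => // <- <-.
Qed.

Lemma bigcup_icell m : \bigcup_n icell m n = setT.
Proof.
rewrite -subTset => x _; exists (pickle (cidx m x)); first exact: Logic.I.
by rewrite icell_pickle.
Qed.

Lemma measurable_dyadic m (I : set (int * int)) :
  measurable ([set x | I (cidx m x)] : set T2).
Proof.
have -> : [set x | I (cidx m x)] =
    \bigcup_n (if (unpickle n : option (int * int)) is Some c then
       if `[< I c >] then cell m c else set0 else set0).
  apply/seteqP; split => [x Ix|x [n _]].
    exists (pickle (cidx m x)); first exact: Logic.I.
    by rewrite pickleK asboolT.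
  by case: unpickle => // c; case: asboolP => //= Ic xc; rewrite xc.
apply: bigcupT_measurable => n; case: unpickle => // c.
by case: asboolP => // _; exact: measurable_cell.
Qed.

Lemma measurable_fun_dyadic d (T : measurableType d) m (a : int * int -> T) :
  measurable_fun (setT : set T2) (fun x => a (cidx m x)).
Proof. by move=> _ Y mY; rewrite setTI; exact: (@measurable_dyadic m (a @^-1` Y)). Qed.

Lemma ge0_integral_cells m (F : T2 -> \bar R) : measurable_fun (setT : set T2) F ->
  (forall x, 0 <= F x)%E ->
  (\int[leb2 R]_x F x = \sum_(0 <= n <oo) \int[leb2 R]_(x in icell m n) F x)%E.
Proof.
move=> mF F0; rewrite -(bigcup_icell m) ge0_integral_bigcup//.
- exact: measurable_icell.
- by rewrite bigcup_icell.
- exact: trivIset_icell.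
Qed.

Lemma le_integral_cells m (F G : T2 -> \bar R) :
  measurable_fun (setT : set T2) F -> measurable_fun (setT : set T2) G ->
  (forall x, 0 <= F x)%E -> (forall x, 0 <= G x)%E ->
  (forall c, \int[leb2 R]_(x in cell m c) F x <= \int[leb2 R]_(x in cell m c) G x)%E ->
  (\int[leb2 R]_x F x <= \int[leb2 R]_x G x)%E.
Proof.
move=> mF mG F0 G0 h; rewrite !(ge0_integral_cells m)//.
apply: lee_nneseries => n _; first by move=> *; apply: integral_ge0.
rewrite /icell; case: unpickle => [c|]; last by rewrite !integral_set0.
by case: eqP => // _; rewrite !integral_set0.
Qed.

End Dyadic.

Lemma nonincreasing_measure_lt {d} {T : measurableType d} {R : realType}
    (mu : {measure set T -> \bar R}) (F : (set T)^nat) (e : R) :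
  (mu (F 0%N) < +oo)%E -> (forall n, measurable (F n)) ->
  (forall n, F n.+1 `<=` F n) -> mu (\bigcap_n F n) = 0%E -> 0 < e ->
  exists n0, forall n, (n0 <= n)%N -> (mu (F n) < e%:E)%E.
Proof.
move=> F0 mF dF capF e0.
have ndF : {homo F : n m / (n <= m)%N >-> (m <= n)%O}.
  apply/nonincreasing_seqP => n; apply/subsetPset; exact: dF.
have := @nonincreasing_cvg_mu _ _ _ mu F F0 mF (bigcapT_measurable mF) ndF.
rewrite capF => /(_ [set x | (x < e%:E)%E]) [].
  by apply: open_nbhs_nbhs; split; [exact: lray_open|rewrite /= lte_fin].
by move=> n0 _ h; exists n0 => n /h.
Qed.

(** * Approximation of measurable sets by unions of dyadic cells *)

Section DyadicSets.
Context {R : realType}.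
Local Notation T2 := (measurableTypeR R * measurableTypeR R)%type.

(** A multiple of [mesh m] is a multiple of [mesh (m + k)], so the floor at level [m] is a
    nondecreasing function of the floor at level [m + k]. Antisymmetry then gives [cidx_coarse]. *)
Lemma didx_le m k (x y : R) : (didx (m + k) x <= didx (m + k) y)%R ->
  (didx m x <= didx m y)%R.
Proof.
rewrite /didx meshD => h.
rewrite Num.Theory.floor_ge_int; set n := Num.floor _.
have nx : n%:~R * (mesh k)^-1 <= x / (mesh m * mesh k).
  by rewrite invfM mulrA ler_pM2r ?invr_gt0 ?mesh_gt0// Num.Theory.floor_le.
have E : (n * 2 ^+ k)%:~R = n%:~R * (mesh k)^-1 :> R.
  by rewrite /mesh invrK intrM rmorphXn.
have : n * 2 ^+ k <= Num.floor (y / (mesh m * mesh k)).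
  by apply: le_trans h; rewrite Num.Theory.floor_ge_int E.
rewrite Num.Theory.floor_ge_int E invfM mulrA.
by rewrite ler_pM2r// invr_gt0 mesh_gt0.
Qed.

Lemma cidx_coarse m k (x y : R * R) : cidx (m + k) x = cidx (m + k) y ->
  cidx m x = cidx m y.
Proof.
move=> h; have h1 : didx (m + k) x.1 = didx (m + k) y.1 := congr1 fst h.
have h2 : didx (m + k) x.2 = didx (m + k) y.2 := congr1 snd h.
rewrite /cidx; congr (_, _); apply: le_anti; apply/andP; split;
  by apply: (@didx_le _ k); rewrite ?h1 ?h2.
Qed.

(** A union of cells of level [m], put as invariance under the relation of lying in the same cell;
    stability under Boolean operations and under refinement is then immediate. *)
Definition dyadic (m : nat) (D : set (R * R)) :=
  forall x y, cidx m x = cidx m y -> D x -> D y.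

Lemma dyadicW m n D : (m <= n)%N -> dyadic m D -> dyadic n D.
Proof. by move=> /subnKC <- h x y /cidx_coarse; exact: h. Qed.

Lemma dyadic_measurable m D : dyadic m D -> measurable (D : set T2).
Proof.
move=> h; have -> : D = [set x | [set c | exists2 y, D y & cidx m y = c] (cidx m x)].
  by apply/seteqP; split => [x Dx|x [y Dy] /h]; [exists x|exact].
exact: measurable_dyadic.
Qed.

Lemma dyadicC m D : dyadic m D -> dyadic m (~` D).
Proof. by move=> h x y e Dx Dy; apply: Dx; apply: h Dy. Qed.

Lemma dyadicU m D E : dyadic m D -> dyadic m E -> dyadic m (D `|` E).
Proof. by move=> h k x y e [/(h _ _ e)|/(k _ _ e)]; [left|right]. Qed.

Lemma dyadicI m D E : dyadic m D -> dyadic m E -> dyadic m (D `&` E).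
Proof. by move=> h k x y e [/(h _ _ e) ? /(k _ _ e)]; split. Qed.

Definition sdiff (A D : set T2) : set T2 := (A `\` D) `|` (D `\` A).

Lemma measurable_sdiff A D : measurable A -> measurable D -> measurable (sdiff A D).
Proof. by move=> mA mD; apply: measurableU; exact: measurableD. Qed.

Variable mu : {measure set T2 -> \bar R}.
Hypothesis mufin : (mu setT < +oo)%E.

(** The good-sets principle: this class is a sigma-algebra and contains the coordinate half-planes,
    which generate the product sigma-algebra. *)
Let approx (A : set T2) := measurable A /\ forall e : R, 0 < e ->
  exists m D, dyadic m D /\ (mu (sdiff A D) < e%:E)%E.

Let approxC A : approx A -> approx (~` A).
Proof.
move=> [mA h]; split; first exact: measurableC.
move=> e /h[m [D [dD lte]]]; exists m, (~` D); split; first exact: dyadicC.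
rewrite (_ : sdiff _ _ = sdiff A D)//.
rewrite /sdiff; apply/seteqP; split => x /=.
  by move=> [[? /contrapT ?]|[? /contrapT ?]]; tauto.
by move=> [[? ?]|[? ?]]; [right|left]; split => //; exact.
Qed.

Let approxU A B : approx A -> approx B -> approx (A `|` B).
Proof.
move=> [mA hA] [mB hB]; split; first exact: measurableU.
move=> e e0; have e20 : 0 < e / 2 by rewrite divr_gt0.
have [m [D [dD Dlt]]] := hA _ e20; have [n [E [dE Elt]]] := hB _ e20.
have dD' := dyadicW (leq_maxl m n) dD; have dE' := dyadicW (leq_maxr m n) dE.
exists (maxn m n), (D `|` E); split; first exact: dyadicU.
have mD := dyadic_measurable dD; have mE := dyadic_measurable dE.
apply: (@le_lt_trans _ _ (mu (sdiff A D `|` sdiff B E))).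
  apply: le_measure; rewrite ?inE.
  - by apply: measurable_sdiff; exact: measurableU.
  - by apply: measurableU; exact: measurable_sdiff.
  - by rewrite /sdiff => x /=; tauto.
apply: (@le_lt_trans _ _ (mu (sdiff A D) + mu (sdiff B E))%E).
  by apply: measureU2; exact: measurable_sdiff.
by rewrite [e in e%:E]splitr EFinD lteD.
Qed.

(** Since the measure is finite, the tails decreasing to the empty set have measure tending to 0, so
    one [F n0] stands for the union up to e / 2. *)
Let approx_incr (F : (set T2)^nat) : (forall n, approx (F n)) ->
  (forall n, F n `<=` F n.+1) -> approx (\bigcup_n F n).
Proof.
move=> aF iF; have mF : measurable (\bigcup_n F n).
  by apply: bigcupT_measurable => n; have [] := aF n.
split => // e e0; have e20 : 0 < e / 2 by rewrite divr_gt0.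
have [n0 /(_ n0 (leqnn _)) hn0] := @nonincreasing_measure_lt _ _ _ mu
  (fun n => (\bigcup_n F n) `\` F n) (e / 2)
  ltac:(apply: le_lt_trans mufin; apply: le_measure; rewrite ?inE//;
        apply: measurableD => //; have [] := aF 0%N; done)
  ltac:(move=> n; apply: measurableD => //; have [] := aF n; done)
  ltac:(move=> n x [? h]; split => // /iF; done)
  ltac:(rewrite (_ : \bigcap_n _ = set0) ?measure0//;
        rewrite -subset0 => x h; have [[k _ Fk] _] := h 0%N Logic.I;
        have [_] := h k Logic.I; exact) e20.
have [mFn /(_ _ e20) [m [D [dD Dlt]]]] := aF n0.
exists m, D; split => //; have mD := dyadic_measurable dD.
apply: (@le_lt_trans _ _ (mu ((\bigcup_n F n `\` F n0) `|` sdiff (F n0) D))).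
  apply: le_measure; rewrite ?inE.
  - exact: measurable_sdiff.
  - by apply: measurableU; [exact: measurableD|exact: measurable_sdiff].
  - move=> x /= [[Fx nDx]|[Dx nFx]].
      by have [Fn0|] := pselect (F n0 x); [right; left|left].
    by right; right; split => // Fx; apply: nFx; exists n0.
apply: le_lt_trans.
  by apply: measureU2; [exact: measurableD|exact: measurable_sdiff].
by rewrite [e in e%:E]splitr EFinD lteD.
Qed.

Let approx0 : approx set0.
Proof.
split => // e e0; exists 0%N, set0; split => //.
by rewrite /sdiff setD0 setU0 measure0 lte_fin.
Qed.

Let approx_bigcup (F : (set T2)^nat) : (forall n, approx (F n)) ->
  approx (\bigcup_n F n).
Proof.
move=> aF; pose G n := \big[setU/set0]_(i < n) F i.
rewrite (_ : \bigcup_n F n = \bigcup_n G n); last first.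
  apply/seteqP; split => x [n _]; last first.
    by rewrite /G -bigcup_mkord => -[k _ Fk]; exists k.
  by move=> Fn; exists n.+1 => //; rewrite /G -bigcup_mkord; exists n => /=.
apply: approx_incr => n.
  by rewrite /G; elim/big_ind : _ => //; exact: approxU.
by rewrite /G big_ord_recr/=; exact: subsetUl.
Qed.

Let approx_sigma : sigma_algebra setT approx.
Proof.
split; [exact: approx0| |exact: approx_bigcup].
by move=> A aA; rewrite setTD; exact: approxC.
Qed.

Let approx_ray (p : R * R -> R) (a : R) :
  (p = fst \/ p = snd) -> approx [set x | a < p x].
Proof.
move=> hp.
(* The cells strictly beyond the cell of [a]. They exhaust the half-plane, because a point at
   distance more than [mesh m] from its edge lies in a later cell. *)
pose F m : set T2 := [set x | (didx m a < didx m (p x))%R].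
have -> : [set x | a < p x] = \bigcup_m F m.
  apply/seteqP; split => x /=.
    move=> ax; have [m _ /(_ m (leqnn _)) hm] := @cvgr_lt _ _ _ _ mesh _ (@mesh_cvg0 R) (p x - a)
       ltac:(rewrite subr_gt0; done).
    exists m => //; rewrite /F/= /didx -lezD1 Num.Theory.floor_ge_int intrD.
    have := Num.Theory.floor_le (a / mesh m); rewrite -(lerD2r 1) => /le_trans; apply.
    rewrite -[1](divff (mesh_neq0 m)) -mulrDl ler_pM2r ?invr_gt0 ?mesh_gt0//.
    by move: hm => /=; lra.
  move=> [m _]; rewrite /F /= ltNge => /negP h; rewrite ltNge; apply/negP => ax.
  by apply: h; rewrite /didx Num.Theory.le_floor// ler_pM2r// invr_gt0 mesh_gt0.
apply: approx_incr => n.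
  have dF : dyadic n (F n).
    by move=> x y [e1 e2]; rewrite /F /=; case: hp => ->; rewrite ?e1 ?e2.
  split; first exact: dyadic_measurable dF.
  by move=> e e0; exists n, (F n); split => //; rewrite /sdiff setDv setU0 measure0 lte_fin.
move=> x; rewrite /F/= !ltNge => /negP h; apply/negP => h'.
by apply: h; apply: (@didx_le n 1); rewrite addn1.
Qed.

Lemma measurable_approx_dyadic (A : set T2) (e : R) : measurable A -> 0 < e ->
  exists m D, dyadic m D /\ (mu (sdiff A D) < e%:E)%E.
Proof.
move=> mA; suff [_] : approx A by exact.
have [_ aC aU] := approx_sigma.
have proj (p : T2 -> measurableTypeR R) (B : set (measurableTypeR R)) :
    p = fst \/ p = snd -> measurable B -> approx (p @^-1` B).
  move=> hp; suff : (<<s R.-ocitv.-measurable >>) `<=` [set B | approx (p @^-1` B)].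
    exact.
  apply: smallest_sub.
    split => [|C aB|F aF] /=; first by rewrite preimage_set0.
      by rewrite setTD preimage_setC; exact: approxC.
    by rewrite preimage_bigcup; exact: approx_bigcup.
  move=> _ [[a b] _ <-] /=.
  have -> : p @^-1` `]a, b]%classic =
     ~` ((~` [set x | a < p x]) `|` [set x | b < p x]).
    apply/seteqP; split => x /=; rewrite in_itv/=.
      by move=> /andP[ax]; rewrite leNgt => /negP xb [].
    move=> h; apply/andP; split.
      by apply: contrapT => h'; apply: h; left.
    by rewrite leNgt; apply/negP => h'; apply: h; right.
  by apply: approxC; apply: approxU; [apply: approxC|]; exact: approx_ray.
suff : measurable `<=` approx by exact.
apply: smallest_sub; first exact: approx_sigma.
move=> _ [] [B mB <-]; rewrite setTI; apply: proj => //; [by left|by right].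
Qed.

End DyadicSets.

(** * Convergence in the mean of averages over dyadic cells *)

Section DyadicMean.
Context {R : realType}.
Local Notation T2 := (measurableTypeR R * measurableTypeR R)%type.
Local Notation mu := (leb2 R).
Implicit Types w v : T2 -> R.

Definition dmean (m : nat) (w : T2 -> R) (c : int * int) : R :=
  (mesh m ^+ 2)^-1 * \int[mu]_(x in cell m c) w x.

(** The conditional expectation of [w] with respect to the sigma-algebra generated by the cells of
    level [m]. *)
Definition dproj (m : nat) (w : T2 -> R) (x : R * R) : R := dmean m w (cidx m x).

Definition L1 w := mu.-integrable (setT : set T2) (EFin \o w).

Lemma L1_cell w m c : L1 w -> mu.-integrable (cell m c : set T2) (EFin \o w).
Proof. by apply: integrableS => //; exact: measurable_cell. Qed.

Lemma L1_measurable w : L1 w -> measurable_fun (setT : set T2) w.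
Proof. by move=> /measurable_int /measurable_EFinP. Qed.

Lemma measurable_dproj m w : measurable_fun (setT : set T2) (dproj m w).
Proof. exact: (@measurable_fun_dyadic _ _ _ m (dmean m w)). Qed.

Lemma dmeanB m w v c : L1 w -> L1 v ->
  dmean m (fun x => w x - v x) c = dmean m w c - dmean m v c.
Proof.
move=> /L1_cell iw /L1_cell iv; rewrite /dmean -mulrBr; congr (_ * _).
by rewrite RintegralB//; exact: measurable_cell.
Qed.

Lemma dmeanD m w v c : L1 w -> L1 v ->
  dmean m (fun x => w x + v x) c = dmean m w c + dmean m v c.
Proof.
move=> /L1_cell iw /L1_cell iv; rewrite /dmean -mulrDr; congr (_ * _).
by rewrite RintegralD//; exact: measurable_cell.
Qed.

Lemma dmeanZ m k w c : L1 w -> dmean m (fun x => k * w x) c = k * dmean m w c.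
Proof.
move=> /L1_cell iw; rewrite /dmean mulrCA; congr (_ * _).
by rewrite RintegralZl//; exact: measurable_cell.
Qed.

Lemma integral_dproj_norm m w c : 
  (\int[mu]_(x in cell m c) `|dproj m w x|%:E = `|\int[mu]_(x in cell m c) w x|%:E)%E.
Proof.
transitivity (\int[mu]_(x in cell m c) (`|dmean m w c|%:E))%E.
  by apply: eq_integral => x; rewrite inE /dproj => ->.
rewrite integral_cst; last exact: measurable_cell.
apply: etrans (congr1 _ (leb2_cell m c)) _; rewrite -EFinM; congr EFin.
rewrite /dmean normrM ger0_norm ?invr_ge0 ?exprn_ge0 ?(ltW (mesh_gt0 _))//.
by rewrite mulrAC mulVf ?mul1r// expf_neq0// mesh_neq0.
Qed.

(** Averaging contracts the L^1 norm on every cell. This bound, uniform in [m], is what carries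
    convergence from a dense class to all integrable functions. *)
Lemma le_integral_dproj m w : L1 w ->
  (\int[mu]_x `|dproj m w x|%:E <= \int[mu]_x `|w x|%:E)%E.
Proof.
move=> iw; have mw := L1_measurable iw.
apply: (@le_integral_cells _ m) => //.
- by apply/measurable_EFinP; apply: measurableT_comp => //; exact: measurable_dproj.
- by apply/measurable_EFinP; apply: measurableT_comp.
move=> c; rewrite integral_dproj_norm.
have mc := @measurable_cell R m c; have iwc := L1_cell m c iw.
apply: (@le_trans _ _ (\int[mu]_(x in cell m c) `|w x|)%:E).
  by rewrite lee_fin; exact: le_normr_Rintegral.
rewrite /Rintegral fineK//; apply: integrable_fin_num => //.
exact: (integrable_norm iwc).
Qed.

Lemma L1_dproj m w : L1 w -> L1 (dproj m w).
Proof.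
move=> iw; apply/integrableP; split.
  by apply/measurable_EFinP; exact: measurable_dproj.
apply: le_lt_trans (le_integral_dproj m iw) _.
by move/integrableP : iw => [].
Qed.

Lemma L1D w v : L1 w -> L1 v -> L1 (fun x => w x + v x).
Proof. by move=> iw iv; exact: (integrableD _ iw iv). Qed.

Lemma L1B w v : L1 w -> L1 v -> L1 (fun x => w x - v x).
Proof. by move=> iw iv; exact: (integrableB _ iw iv). Qed.

Lemma L1Z k w : L1 w -> L1 (fun x => k * w x).
Proof. by move=> iw; exact: (integrableZl _ k iw). Qed.

Lemma L1_norm w : L1 w -> L1 (fun x => `|w x|).
Proof. by move=> iw; exact: (integrable_norm iw). Qed.

Lemma L1_fin w : L1 w -> (\int[mu]_x `|w x|%:E < +oo)%E.
Proof. by move=> /integrableP[]. Qed.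

Definition dyadic_cvg w := L1 w /\ forall e : R, 0 < e ->
  exists m0, forall m, (m0 <= m)%N -> (\int[mu]_x `|w x - dproj m w x|%:E < e%:E)%E.

Lemma measurable_normE w : measurable_fun (setT : set T2) w ->
  measurable_fun (setT : set T2) (fun x => `|w x|%:E).
Proof. by move=> mw; apply/measurable_EFinP; apply: measurableT_comp. Qed.

Lemma integral_normD w v : L1 w -> L1 v ->
  (\int[mu]_x `|w x + v x|%:E <= \int[mu]_x `|w x|%:E + \int[mu]_x `|v x|%:E)%E.
Proof.
move=> iw iv; have mw := L1_measurable iw; have mv := L1_measurable iv.
rewrite -ge0_integralD//; try exact: measurable_normE.
apply: ge0_le_integral => //; try by move=> x _; rewrite adde_ge0.
- by apply: measurable_normE; exact: measurable_funD.
- by apply: emeasurable_funD; exact: measurable_normE.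
- by move=> x _; rewrite -EFinD lee_fin ler_normD.
Qed.

(** With P the averaging operator, w - Pw = (w - v) + (v - Pv) + P(v - w); the last term is
    controlled by the first because P is a contraction. *)
Lemma dyadic_cvg_closed w : L1 w ->
  (forall e : R, 0 < e -> exists v, dyadic_cvg v /\
     (\int[mu]_x `|w x - v x|%:E < e%:E)%E) -> dyadic_cvg w.
Proof.
move=> iw h; split => // e e0.
have e40 : 0 < e / 4 by rewrite divr_gt0.
have [v [[iv /(_ _ e40) [m0 hv]] wv]] := h _ e40.
exists m0 => m /hv {}hv.
have iwv := L1B iw iv; have ivw := L1_dproj m iwv; have ivE := L1B iv (L1_dproj m iv).
have -> : (fun x => `|w x - dproj m w x|%:E) =
  (fun x => `|(w x - v x) + (v x - dproj m v x) + (-1 * dproj m (fun x => w x - v x) x)|%:E).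
  apply/funext => x; congr (`| _ |%:E); rewrite /dproj dmeanB//; ring.
apply: le_lt_trans.
  by apply: integral_normD; [exact: L1D|exact: L1Z].
have -> : (fun x => `|-1 * dproj m (fun x => w x - v x) x|%:E) =
    (fun x => `|dproj m (fun x => w x - v x) x|%:E).
  by apply/funext => x; rewrite mulN1r normrN.
have h1 := integral_normD iwv ivE; have h2 := le_integral_dproj m iwv.
apply: le_lt_trans (leeD h1 h2) _.
apply: (@lt_le_trans _ _ ((e / 4)%:E + (e / 4)%:E + (e / 4)%:E)%E).
  by rewrite !lteD.
by rewrite -!EFinD lee_fin; lra.
Qed.

Lemma dyadic_cvgD w v : dyadic_cvg w -> dyadic_cvg v -> dyadic_cvg (fun x => w x + v x).
Proof.
move=> [iw hw] [iv hv]; split; first exact: L1D.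
move=> e e0; have e20 : 0 < e / 2 by rewrite divr_gt0.
have [m {}hw] := hw _ e20; have [n {}hv] := hv _ e20.
exists (maxn m n) => k; rewrite geq_max => /andP[/hw {}hw /hv {}hv].
have -> : (fun x => `|w x + v x - dproj k (fun x => w x + v x) x|%:E) =
   (fun x => `|(w x - dproj k w x) + (v x - dproj k v x)|%:E).
  apply/funext => x; congr (`| _ |%:E); rewrite /dproj dmeanD//; ring.
apply: le_lt_trans (integral_normD _ _) _.
- by apply: L1B => //; exact: L1_dproj.
- by apply: L1B => //; exact: L1_dproj.
by rewrite [X in (_ < X%:E)%E]splitr EFinD; exact: lteD hw hv.
Qed.

Lemma dyadic_cvg0 : dyadic_cvg (fun=> 0).
Proof.
split; first exact: integrable0.
move=> e e0; exists 0%N => m _; rewrite [X in (X < _)%E](_ : _ = 0%E) ?lte_fin//.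
apply: integral0_eq => x _; rewrite /dproj /dmean /Rintegral integral0_eq//.
by rewrite mulr0 subrr normr0.
Qed.

Lemma dyadic_cvgZ k w : dyadic_cvg w -> dyadic_cvg (fun x => k * w x).
Proof.
move=> [iw hw]; split; first exact: L1Z.
move=> e e0; have e20 : 0 < e / (`|k| + 1) by rewrite divr_gt0// ltr_wpDl.
have [m {}hw] := hw _ e20; exists m => n /hw {}hw.
have -> : (fun x => `|k * w x - dproj n (fun x => k * w x) x|%:E) =
   (fun x => (`|k|%:E * `|(w x - dproj n w x)|%:E)%E).
  by apply/funext => x; rewrite -EFinM -normrM mulrBr /dproj dmeanZ.
have iE := L1B iw (L1_dproj n iw).
rewrite ge0_integralZl//; last by apply: measurable_normE; exact: L1_measurable.
have := integrable_fin_num measurableT (L1_norm iE) => /= fn.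
move: hw; rewrite -(fineK fn) -EFinM !lte_fin.
have := @integral_ge0 _ _ _ mu setT (fun x => `|w x - dproj n w x|%:E)
  ltac:(done); rewrite -(fineK fn) lee_fin.
move: (fine _) => J J0; rewrite ltr_pdivlMr ?ltr_wpDl// => Je.
by apply: le_lt_trans Je; rewrite mulrC ler_wpM2l// lerDl.
Qed.

Lemma L1_indic (A : set T2) : measurable A -> (mu A < +oo)%E -> L1 (\1_A).
Proof.
move=> mA fA; apply/integrableP; split.
  by apply/measurable_EFinP; exact: measurable_indic.
rewrite (_ : (fun x => _) = (fun x => (\1_A x)%:E)); last first.
  by apply/funext => x /=; rewrite ger0_norm.
by rewrite integral_indic// setIT.
Qed.

Lemma integral_indicB (A B : set T2) : measurable A -> measurable B ->
  (\int[mu]_x `|(\1_A x : R) - \1_B x|%:E = mu (sdiff A B))%E.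
Proof.
move=> mA mB; rewrite (_ : (fun x => _) = (fun x => (\1_(sdiff A B) x)%:E)).
  by rewrite integral_indic ?setIT//; exact: measurable_sdiff.
apply/funext => x; rewrite !indicE; congr EFin.
have [xA|xA] := boolP (x \in A); have [xB|xB] := boolP (x \in B);
  have [xS|xS] := boolP (x \in sdiff A B); rewrite ?subrr ?normr0 ?subr0 ?sub0r ?normrN ?normr1//.
all: exfalso; move: xA xB xS; rewrite /sdiff ?inE ?notin_setE/=; tauto.
Qed.

(** From level [m] on the indicator is constant on every cell, so averaging reproduces it and the
    error is exactly 0. *)
Lemma dyadic_cvg_dyadic m (D : set T2) : dyadic m D -> (mu D < +oo)%E ->
  dyadic_cvg (\1_D).
Proof.
move=> dD fD; have mD := dyadic_measurable dD; split; first exact: L1_indic.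
move=> e e0; exists m => n mn; have dDn := dyadicW mn dD.
rewrite [X in (X < _)%E](_ : _ = 0%E) ?lte_fin//.
apply: integral0_eq => x _; rewrite /dproj /dmean /Rintegral.
rewrite (_ : (\int[mu]_(y in _) _)%E = (\int[mu]_(y in cell n (cidx n x)) (\1_D x)%:E)%E).
  rewrite integral_cst; last exact: measurable_cell.
  rewrite (_ : mu _ = (mesh n ^+ 2)%:E); last exact: leb2_cell.
  rewrite -EFinM /= mulrC mulfK ?subrr ?normr0//.
  by rewrite expf_neq0// mesh_neq0.
apply: eq_integral => y; rewrite inE /cell/= => h; congr EFin; rewrite !indicE.
have [Dx|Dx] := boolP (x \in D); have [Dy|Dy] := boolP (y \in D) => //; exfalso.
- by move: Dx Dy; rewrite inE notin_setE => Dx; apply; apply: dDn Dx.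
- by move: Dx Dy; rewrite inE notin_setE => Dx Dy; apply: Dx; apply: dDn Dy.
Qed.

Definition box (N : nat) : set T2 := `[- N%:R, N%:R[%classic `*` `[- N%:R, N%:R[%classic.

Lemma measurable_box N : measurable (box N).
Proof. exact: measurable_itv2. Qed.

Lemma dyadic_box N : dyadic 0 (box N).
Proof.
move=> x y [e1 e2]; rewrite /box /= !in_itv/=.
have H (z : R) : (- N%:R <= z < N%:R) = (- N%:Z <= didx 0 z < N%:Z).
  rewrite /didx /mesh expr0 invr1 divr1 Num.Theory.floor_ge_int.
  by rewrite Num.Theory.floor_lt_int mulrNz.
by rewrite !H e1 e2.
Qed.

Lemma leb2_box_fin N : (mu (box N) < +oo)%E.
Proof. by rewrite leb2_itv2 ?ltry// ge0_cp. Qed.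

Lemma bigcup_box : \bigcup_N box N = setT.
Proof.
rewrite -subTset => -[x y] _.
have [N hN] : exists N : nat, `|x| + `|y| < N%:R.
  exists (Num.trunc (`|x| + `|y|)).+1; exact: Num.Theory.truncnS_gt.
exists N => //; rewrite /box /=; split; rewrite /= in_itv/=; apply/andP; split.
- by rewrite lerNl; apply: ltW; apply: le_lt_trans hN; rewrite (le_trans (ler_norm _))// normrN lerDl.
- by apply: le_lt_trans hN; rewrite (le_trans (ler_norm _))// lerDl.
- by rewrite lerNl; apply: ltW; apply: le_lt_trans hN; rewrite (le_trans (ler_norm _))// normrN lerDr.
- by apply: le_lt_trans hN; rewrite (le_trans (ler_norm _))// lerDr.
Qed.

Lemma box_incr N : box N `<=` box N.+1.
Proof.
move=> [x y] [/=]; rewrite !in_itv/= => /andP[a b] /andP[c d].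
by rewrite /box; split; rewrite /= in_itv/= -natr1; lra.
Qed.

Lemma dyadic_cvg_indic (A : set T2) : measurable A -> (mu A < +oo)%E ->
  dyadic_cvg (\1_A).
Proof.
move=> mA fA; apply: dyadic_cvg_closed; first exact: L1_indic.
move=> e e0; have e20 : 0 < e / 2 by rewrite divr_gt0.
have [N /(_ N (leqnn _)) hN] := @nonincreasing_measure_lt _ _ _ mu (fun N => A `\` box N) (e / 2)
  ltac:(apply: le_lt_trans fA; apply: le_measure; rewrite ?inE//; apply: measurableD => //; exact: measurable_box)
  ltac:(move=> n; apply: measurableD => //; exact: measurable_box)
  ltac:(move=> n x [Ax h]; split => // /box_incr; done)
  ltac:(rewrite (_ : \bigcap_n _ = set0) ?measure0//; rewrite -subset0 => x h;
        have : setT x by []; rewrite -bigcup_box => -[n _ bn]; have [_] := h n Logic.I; exact) e20.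
(* Approximation by dyadic sets holds for finite measures, so the measure is restricted to a box
   outside of which [A] has measure less than e / 2. *)
pose nu := mrestr mu (measurable_box N).
have nufin : (nu setT < +oo)%E by rewrite /nu/= /mrestr setTI leb2_box_fin.
have [m [D [dD Dlt]]] := measurable_approx_dyadic nufin mA e20.
have mD := dyadic_measurable dD.
have dDB : dyadic m (D `&` box N) := dyadicI dD (dyadicW (leq0n m) (@dyadic_box N)).
have mDB := dyadic_measurable dDB.
exists (\1_(D `&` box N)); split.
  apply: dyadic_cvg_dyadic dDB _; apply: le_lt_trans (leb2_box_fin N).
  by apply: le_measure; rewrite ?inE//; exact: measurable_box.
rewrite integral_indicB//.
have mAB := measurableD mA (measurable_box N).
have mS := measurableI _ _ (measurable_sdiff mA mD) (measurable_box N).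
apply: (@le_lt_trans _ _ (mu ((A `\` box N) `|` (sdiff A D `&` box N)))).
  apply: le_measure; rewrite ?inE; [exact: measurable_sdiff|exact: measurableU|].
  rewrite /sdiff => x /=; have [] := pselect (box N x); tauto.
apply: le_lt_trans; first exact: measureU2.
by rewrite [X in (_ < X%:E)%E]splitr EFinD lteD.
Qed.

Theorem dproj_cvg w : L1 w -> forall e : R, 0 < e ->
  exists m0, forall m, (m0 <= m)%N -> (\int[mu]_x `|w x - dproj m w x|%:E < e%:E)%E.
Proof.
move=> iw; suff [_] : dyadic_cvg w by [].
apply: dyadic_cvg_closed => // e e0.
have [g [ig _ gw]] := approximation_sfun_integrable measurableT iw.
have := gw [set x | (x < e%:E)%E]; case.
  by apply: open_nbhs_nbhs; split; [exact: lray_open|rewrite /= lte_fin].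
move=> n _ /(_ n (leqnn _)) /= hn.
exists (g n); split; last exact: hn.
have [s ->] : exists s : seq R, (g n : T2 -> R) =
    (fun x => \sum_(y <- s) (y * \1_(g n @^-1` [set y]) x)).
  by eexists; apply/funext => x; rewrite [LHS]fimfunE fsbig_finite.
elim: s => [|y s ih].
  by rewrite (_ : (fun x => _) = (fun=> 0))//; [exact: dyadic_cvg0|apply/funext => x; rewrite big_nil].
rewrite (_ : (fun x => _) = (fun x => y * \1_(g n @^-1` [set y]) x +
  \sum_(y <- s) y * \1_(g n @^-1` [set y]) x)); last first.
  by apply/funext => x; rewrite big_cons.
apply: dyadic_cvgD; last exact: ih.
have [->|y0] := eqVneq y 0.
  rewrite (_ : (fun x => _) = (fun=> 0)); first exact: dyadic_cvg0.
  by apply/funext => x; rewrite mul0r.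
apply: dyadic_cvgZ; apply: dyadic_cvg_indic => //.
have my : measurable (g n @^-1` [set y]) by [].
(* A level set of a nonzero value [y] has finite measure: on it |g n| = |y|, so infinite measure
   would make the integral of |g n| infinite. *)
have := L1_fin (ig n); apply: contraTT; rewrite -!leNgt !leye_eq => /eqP Hoo.
have : (\int[mu]_x (`|y|%:E * (\1_(g n @^-1` [set y]) x)%:E) <= \int[mu]_x `|g n x|%:E)%E.
  apply: ge0_le_integral => //.
  - by apply: emeasurable_funM => //; apply/measurable_EFinP; exact: measurable_indic.
  - by apply: measurable_normE.
  move=> x _; rewrite -EFinM lee_fin indicE.
  have [|] := boolP (x \in _); last by rewrite mulr0.
  by rewrite inE/= => ->; rewrite mulr1.
rewrite ge0_integralZl//; last by apply/measurable_EFinP; exact: measurable_indic.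
by rewrite integral_indic// setIT Hoo mulry gtr0_sg ?normr_gt0// mul1e leye_eq.
Qed.

End DyadicMean.

(** * Smooth functions on the line and the plane *)

(** Caratheodory's form of differentiability. It is used wherever the increment factors explicitly
    as h G(h): at the flat point of exp(-1/x), for quadratic polynomials and for the inverse of a
    quadratic map. *)
Lemma is_derive_slope {R : realType} (f G : R -> R) (x d : R) :
  (\forall h \near 0, f (x + h) - f x = h * G h) -> G h @[h --> 0] --> d ->
  is_derive x 1 f d.
Proof.
move=> fG Gd.
have H : (h^-1 *: ((f \o shift x) (h *: 1) - f x)) @[h --> 0^'] --> d.
  have Gd' : G h @[h --> 0^'] --> d.
    by apply: cvg_trans Gd; apply: cvg_app; exact: cvg_within.
  apply: cvg_trans Gd'; apply: near_eq_cvg; near=> h.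
  have h0 : h != 0 by near: h; exact: nbhs_dnbhs_neq.
  have fGh : f (x + h) - f x = h * G h by near: h; apply: nbhs_dnbhs.
  rewrite /= -[X in f X]/(h *: 1 + x) [h *: 1]mulr1 [h + x]addrC fGh.
  by rewrite /GRing.scale/= mulrA mulVf ?mul1r.
apply: DeriveDef; first by apply/cvg_ex; exists d.
exact: cvg_lim H.
Unshelve. all: by end_near. Qed.

Lemma is_derive_exprn {R : realType} n (x : R) :
  is_derive x 1 (fun y => y ^+ n) (n%:R * x ^+ n.-1).
Proof.
have -> : (fun y : R => y ^+ n) = (id : R -> R) ^+ n by apply/funext => y; rewrite exprfctE.
by apply: (is_derive_eq (@is_deriveX _ _ id n x 1 1 _)); rewrite /GRing.scale/= mulr1.
Qed.

Lemma is_derive_mul {R : realType} (f g : R -> R) (x a b : R) :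
  is_derive x 1 f a -> is_derive x 1 g b ->
  is_derive x 1 (fun y => f y * g y) (a * g x + f x * b).
Proof.
by move=> fa gb; apply: (is_derive_eq (is_deriveM fa gb)); rewrite /GRing.scale/= addrC mulrC.
Qed.

(** * Smooth steps built from exp(-1/x) *)

Section FlatStep.
Context {R : realType}.
Implicit Types (x y : R) (n : nat).

(** The classical flat function exp(-1/x) together with its multiples by x^-n: with all exponents
    [n] at hand, the derivative of a member is a combination of two others. *)
Definition flat n x : R := if 0 < x then x ^- n * expR (- x^-1) else 0.

Lemma flat_gt0 n x : 0 < x -> 0 < flat n x.
Proof. by move=> x0; rewrite /flat x0 mulr_gt0 ?invr_gt0 ?exprn_gt0 ?expR_gt0. Qed.

Lemma flat_le0 n x : x <= 0 -> flat n x = 0.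
Proof. by move=> x0; rewrite /flat ltNge x0. Qed.

Lemma flat_ge0 n x : 0 <= flat n x.
Proof. by have [/flat_le0 ->|/flat_gt0/ltW] := leP x 0. Qed.

(** From exp(t) >= t^(n+2) / (n+2)! at t = 1/x. The quadratic decay shows that the slope [flat n.+1]
    of [flat n] at the origin tends to 0. *)
Lemma flat_bound n x : flat n x <= n.+2`!%:R * x ^+ 2.
Proof.
have [x0|x0] := leP x 0; first by rewrite flat_le0// mulr_ge0// sqr_ge0.
rewrite /flat x0 expRN ler_pdivrMl ?exprn_gt0//.
have : (x^-1) ^+ n.+2 / n.+2`!%:R <= expR x^-1.
  by apply: le_trans (expR_ge1Dxn n.+1 _); rewrite ?lerDr ?invr_ge0 ?(ltW x0).
rewrite ler_pdivrMr ?ltr0n ?fact_gt0// => h.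
rewrite -[leLHS]mul1r ler_pdivrMr ?expR_gt0//.
rewrite (_ : x ^+ n * _ * _ = x ^+ n.+2 * (expR x^-1 * n.+2`!%:R)); last first.
  by rewrite -addn2 exprD; ring.
rewrite exprVn in h; rewrite mulrC -ler_pdivrMr ?exprn_gt0//.
by rewrite mul1r.
Qed.

Lemma is_derive_flat n x :
  is_derive x 1 (flat n) (flat n.+2 x - n%:R * flat n.+1 x).
Proof.
have [x0|x0|->] := ltgtP x 0.
- rewrite !flat_le0 ?ltW// mulr0 subr0.
  apply: (@near_eq_is_derive _ _ _ (cst 0)) => //.
  by near=> y; rewrite /cst/= flat_le0// ltW//; near: y; exact: lt_nbhsl.
- have xn0 : x != 0 by rewrite gt_eqF.
  apply: (@near_eq_is_derive _ _ _ (fun x => x ^- n * expR (- x^-1))).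
    by near=> y; rewrite /flat ifT//; near: y; exact: lt_nbhsr.
  have xV : is_derive x 1 (fun y => y^-1) (- x ^- 2).
    by apply: (is_derive_eq (@is_deriveV R id x 1 1 xn0 _)); rewrite /GRing.scale/= mulr1.
  apply: (@near_eq_is_derive _ _ _ ((fun y => y ^+ n * expR (- y)) \o (fun y => y^-1))).
    by near=> y; rewrite /= exprVn.
  have dE : is_derive x^-1 1 (fun y => expR (- y)) (- expR (- x^-1)).
    apply: (is_derive_eq (@is_derive1_comp _ expR -%R _ (expR (- x^-1)) (-1) _ _)); first by rewrite mulrN1.
  apply: (is_derive_eq (is_derive1_comp (is_derive_mul (is_derive_exprn n x^-1) dE) xV)).
  rewrite /flat x0 !exprSr; case: (n) => [|k]; rewrite ?mul0r ?exprSr ?expr0 /= ?exprVn; field; rewrite ?xn0 ?expf_neq0//.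
- rewrite !flat_le0// mulr0 subr0.
  apply: (@is_derive_slope _ _ (flat n.+1)).
    near=> h; rewrite add0r (flat_le0 _ (lexx 0)) subr0 /flat; case: ifP => [h0|]; last by rewrite mulr0.
    by rewrite exprS invfM !mulrA mulfV ?mul1r// gt_eqF.
  apply: (@squeeze_cvgr _ _ _ _ (cst 0) (fun h => n.+3`!%:R * h ^+ 2)).
  + by near=> h; rewrite flat_ge0 flat_bound.
  + exact: cvg_cst.
  + have : (n.+3`!%:R * h ^+ 2) @[h --> (0 : R)] --> n.+3`!%:R * (0 : R) ^+ 2.
      by apply: cvgMr; exact: exprn_continuous.
    by rewrite expr0n mulr0.
Unshelve. all: by end_near. Qed.

Lemma is_derive_affine (p q x : R) : is_derive x 1 (fun y => p * y + q) p.
Proof.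
have h := is_derive_mul (@is_derive_cst _ _ _ p x 1) (@is_derive_id _ _ x 1).
apply: (is_derive_eq (is_deriveD h (@is_derive_cst _ _ _ q x 1))).
by rewrite /cst/= mul0r add0r mulr1 addr0.
Qed.

Definition flat_sum x : R := flat 0 x + flat 0 (1 - x).

Lemma flat_sum_gt0 x : 0 < flat_sum x.
Proof.
rewrite /flat_sum; have [x0|x0] := leP x 0.
  by rewrite ltr_wpDl ?flat_ge0// flat_gt0// subr_gt0 (le_lt_trans x0).
by rewrite ltr_pwDl ?flat_ge0// flat_gt0.
Qed.

(** A syntactic class closed under differentiation, so that its members are smooth without an
    induction on the order. Affine arguments make room for rescaled steps, and the reciprocals of
    [flat_sum] for the quotient that defines a step. *)
Inductive flat_gen : (R -> R) -> Prop :=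
| FlatCst k : flat_gen (fun=> k)
| FlatBase n p q : flat_gen (fun x => flat n (p * x + q))
| FlatInv p q : flat_gen (fun x => (flat_sum (p * x + q))^-1)
| FlatAdd f g : flat_gen f -> flat_gen g -> flat_gen (fun x => f x + g x)
| FlatMul f g : flat_gen f -> flat_gen g -> flat_gen (fun x => f x * g x).

Lemma is_derive_flat_affine n p q x : is_derive x 1 (fun x => flat n (p * x + q))
  ((flat n.+2 (p * x + q) - n%:R * flat n.+1 (p * x + q)) * p).
Proof. exact: (is_derive1_comp (is_derive_flat n _) (is_derive_affine p q x)). Qed.

Lemma flat_gen_derive f : flat_gen f ->
  exists2 f', flat_gen f' & forall x, is_derive x 1 f (f' x).
Proof.
elim=> [k|n p q|p q|g h _ [g' gg' dg] _ [h' hh' dh]|g h gg [g' gg' dg] hh [h' hh' dh]].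
- by exists (fun=> 0); [exact: FlatCst|move=> x; exact: is_derive_cst].
- exists (fun x => (flat n.+2 (p * x + q) + - n%:R * flat n.+1 (p * x + q)) * p).
    do !(apply: FlatMul || apply: FlatAdd || apply: FlatBase || apply: FlatCst).
  by move=> x; rewrite mulNr; exact: is_derive_flat_affine.
(* [r x] is 1 - l x in the affine form that [FlatBase] asks for. The derivative of [flat 0] is
   [flat 2] alone, its other term having coefficient 0. *)
- pose l x := p * x + q; pose r x := - p * x + (1 - q).
  exists (fun x => (-1) * ((flat_sum (l x))^-1 * (flat_sum (l x))^-1) *
     ((flat 2 (l x)) * p + (flat 2 (r x) * - p))).
    by repeat first [apply: FlatInv|apply: FlatBase|apply: FlatCst|apply: FlatMul|apply: FlatAdd].
  move=> x; have d1 : is_derive x 1 (fun x => flat_sum (l x))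
     (flat 2 (l x) * p + flat 2 (r x) * - p).
    have -> : (fun x => flat_sum (l x)) = (fun x => flat 0 (l x)) \+ (fun x => flat 0 (r x)).
      by apply/funext => y; rewrite /flat_sum /l /r /=; congr (_ + flat 0 _); ring.
    apply: (is_derive_eq (is_deriveD (is_derive_flat_affine 0 p q x) (is_derive_flat_affine 0 (- p) (1 - q) x))).
    by rewrite !mul0r !subr0.
  apply: (is_derive_eq (is_deriveV _ d1)); first by rewrite gt_eqF// flat_sum_gt0.
  by rewrite /GRing.scale/= mulN1r expr2 invfM.
- exists (fun x => g' x + h' x); first exact: FlatAdd.
  by move=> x; exact: is_deriveD.
- exists (fun x => g' x * h x + g x * h' x).
    by apply: FlatAdd; apply: FlatMul.
  by move=> x; exact: is_derive_mul.
Qed.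

Definition step x : R := flat 0 x * (flat_sum x)^-1.

Lemma step_le0 x : x <= 0 -> step x = 0.
Proof. by move=> x0; rewrite /step flat_le0// mul0r. Qed.

Lemma step_ge1 x : 1 <= x -> step x = 1.
Proof.
move=> x1; rewrite /step /flat_sum (flat_le0 _ (_ : 1 - x <= 0)) ?subr_le0// addr0.
by rewrite mulfV// gt_eqF// flat_gt0// (lt_le_trans _ x1).
Qed.

Lemma step_ge0 x : 0 <= step x.
Proof. by rewrite mulr_ge0 ?flat_ge0// invr_ge0 ltW// flat_sum_gt0. Qed.

Lemma step_le1 x : step x <= 1.
Proof. by rewrite ler_pdivrMr ?flat_sum_gt0// mul1r lerDl flat_ge0. Qed.

Definition stepi (p q x : R) : R := step ((x - p) / (q - p)).

Lemma flat_gen_stepi p q : flat_gen (stepi p q).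
Proof.
have -> : stepi p q = (fun x => flat 0 ((q - p)^-1 * x + - (p / (q - p))) *
    (flat_sum ((q - p)^-1 * x + - (p / (q - p))))^-1).
  by apply/funext => x; rewrite /stepi /step mulrBl [x / _]mulrC.
by apply: FlatMul; [exact: FlatBase|exact: FlatInv].
Qed.

Lemma stepi_le p q x : p < q -> x <= p -> stepi p q x = 0.
Proof.
by move=> pq xp; rewrite /stepi step_le0// mulr_le0_ge0 ?subr_le0// invr_ge0 subr_ge0 ltW.
Qed.

Lemma stepi_ge p q x : p < q -> q <= x -> stepi p q x = 1.
Proof.
by move=> pq xp; rewrite /stepi step_ge1// ler_pdivlMr ?subr_gt0// mul1r lerD2r.
Qed.

Lemma step_derive : exists (ds : R -> R) (M : R), [/\ flat_gen ds, 0 < M,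
  forall x, is_derive x 1 step (ds x), forall x, `|ds x| <= M &
  forall x, (x <= 0) || (1 <= x) -> ds x = 0].
Proof.
have stepE : stepi 0 1 = step.
  by apply/funext => x; rewrite /stepi !subr0 divr1.
have [ds gds hds] := flat_gen_derive (flat_gen_stepi 0 1).
rewrite stepE in hds.
have z1 x : x < 0 -> ds x = 0.
  move=> x0; have d0 : is_derive x 1 step 0.
    apply: (@near_eq_is_derive _ _ _ (cst 0)).
    by near=> y; rewrite /cst/= step_le0// ltW//; near: y; exact: lt_nbhsl.
  by have := hds x => -[_ <-]; have [] := d0.
have z2 x : 1 < x -> ds x = 0.
  move=> x0; have d0 : is_derive x 1 step 0.
    have d1 : is_derive x 1 (fun=> (1 : R)) (0 : R) := is_derive_cst _ _ _.
    apply: near_eq_is_derive d1.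
    by near=> y; rewrite step_ge1// ltW//; near: y; exact: lt_nbhsr.
  by have := hds x => -[_ <-]; have [] := d0.
have cds : continuous ds.
  have [dds _ h] := flat_gen_derive gds.
  by move=> x; apply/differentiable_continuous/derivable1_diffP; have [] := h x.
(* At 0 and 1 the step is not locally constant; there the value 0 of [ds] is the one-sided limit
   from outside the unit interval. *)
have z01 (a : R) : (\forall x \near a^'-, ds x = 0) \/ (\forall x \near a^'+, ds x = 0) -> ds a = 0.
  move=> [] h.
    apply: (@cvg_unique _ _ (ds x @[x --> a^'-])) => //.
      by apply: cvg_at_left_filter; exact: cds.
    exact: cvg_near_cst.
  apply: (@cvg_unique _ _ (ds x @[x --> a^'+])) => //.
    by apply: cvg_at_right_filter; exact: cds.
  exact: cvg_near_cst.
have z x : (x <= 0) || (1 <= x) -> ds x = 0.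
  rewrite !le_eqVlt => /orP[/orP[/eqP ->|/z1//]|/orP[/eqP <-|/z2//]].
    by apply: z01; left; near=> y; apply: z1; near: y; exact: nbhs_left_lt.
  by apply: z01; right; near=> y; apply: z2; near: y; exact: nbhs_right_gt.
have [c c01 hc] := @EVT_max R (fun x => `|ds x|) 0 1 ler01
  (continuous_subspaceT (fun x => continuous_comp (cds x) (@norm_continuous _ _ _))).
exists ds, (`|ds c| + 1); split; [exact: gds|by rewrite ltr_wpDl|exact: hds| |exact: z].
move=> x; have [x01|] := boolP ((x <= 0) || (1 <= x)).
  by rewrite z// normr0 addr_ge0.
rewrite negb_or -!ltNge => /andP[x0 x1].
by apply: le_trans (hc x _) _; rewrite ?lerDl// in_itv/= !ltW.
Unshelve. all: by end_near. Qed.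

End FlatStep.

(** * Algebras of smooth functions of two variables *)

Section Plane.
Context {R : realType}.
Implicit Types (U W : set (R * R)) (u v : R * R -> R).

Lemma nbhs2P (x : R * R) (A : set (R * R)) : nbhs x A <->
  exists2 e : R, 0 < e & forall y, `|y.1 - x.1| < e -> `|y.2 - x.2| < e -> A y.
Proof.
split=> [/nbhs_ballP[e e0 h]|[e e0 h]].
  by exists e => // y h1 h2; apply: h; split; rewrite /= /ball/= distrC.
apply/nbhs_ballP; exists e => // y [h1 h2]; apply: h; rewrite distrC; [exact: h1|exact: h2].
Qed.

Lemma open2P U : open U <-> forall x, U x ->
  exists2 e : R, 0 < e & forall y, `|y.1 - x.1| < e -> `|y.2 - x.2| < e -> U y.
Proof.
rewrite openE; split=> [h x /h|h x /h]; rewrite /interior; first by move/nbhs2P.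
by move=> ?; apply/nbhs2P.
Qed.

Lemma ord2P (i : 'I_2) : i = 0 \/ i = 1.
Proof. by case: i => -[|[|//]] h; [left|right]; apply/val_inj. Qed.

Definition insert (i : 'I_2) (x : R * R) (t : R) : R * R :=
  if i == 0 then (t, x.2) else (x.1, t).

Lemma sliceE i u x : slice i u x = u \o insert i x.
Proof. by rewrite /slice /insert; case: (i == 0). Qed.

Lemma insert_coordinate i x : insert i x (coordinate i x) = x.
Proof. by rewrite /insert /coordinate; case: (i == 0); case: x. Qed.

Lemma near_insert i x (A : set (R * R)) : nbhs x A ->
  \forall t \near coordinate i x, A (insert i x t).
Proof.
move=> /nbhs2P[e e0 h]; near=> t.
have : `|coordinate i x - t| < e by near: t; exact: nbhsx_ballx.
rewrite distrC /coordinate /insert; case: ifP => _ ht; apply: h; rewrite /= ?subrr ?normr0//.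
Unshelve. all: by end_near. Qed.

Lemma partial_near i u v x : (\forall y \near x, u y = v y) ->
  partial i u x = partial i v x.
Proof.
move=> h; rewrite /partial; apply: near_eq_derive; rewrite !sliceE.
exact: (near_insert i h).
Qed.

Lemma derivable_slice_near i u v x : (\forall y \near x, u y = v y) ->
  derivable (slice i u x) (coordinate i x) 1 ->
  derivable (slice i v x) (coordinate i x) 1.
Proof.
move=> h; apply: near_eq_derivable; rewrite !sliceE.
exact: (near_insert i h).
Qed.

Lemma continuous_near u v x : (\forall y \near x, u y = v y) ->
  {for x, continuous u} -> {for x, continuous v}.
Proof.
move=> h; rewrite /prop_for /continuous_at => cu.
by rewrite -(nbhs_singleton h); apply: cvg_trans cu; exact: near_eq_cvg.
Qed.

Lemma open_near U (P : R * R -> Prop) x : open U -> U x -> (forall y, U y -> P y) ->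
  \forall y \near x, P y.
Proof. by move=> oU Ux h; apply: filterS h _; exact: open_nbhs_nbhs. Qed.

Definition regular_on W u := forall x, W x -> {for x, continuous u} /\
  forall i, derivable (slice i u x) (coordinate i x) 1.

(** Every iterated partial of a member agrees on [W] with a member, hence is regular there.
    Agreement on [W] suffices, since [W] is open and partials depend on local values only. *)
Lemma smooth_on_coind W (F : set (R * R -> R)) : open W ->
  (forall u, F u -> regular_on W u) ->
  (forall u i, F u -> exists2 v, F v & forall x, W x -> partial i u x = v x) ->
  forall u, F u -> smooth_on W u.
Proof.
move=> oW Fr Fp u Fu w.
have [v Fv uv] : exists2 v, F v & forall x, W x -> partials w u x = v x.
  elim: w => [|i w [v Fv uv]]; first by exists u.
  have [v' Fv' vv'] := Fp v i Fv; exists v' => // x Wx.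
  by rewrite -vv'//=; apply: partial_near; exact: open_near uv.
move=> x Wx; have [cv dv] := Fr _ Fv _ Wx.
have vu : \forall y \near x, v y = partials w u y.
  by apply: open_near Wx _ => // y /uv ->.
by split => [|i]; [exact: continuous_near vu cv|exact: derivable_slice_near vu (dv i)].
Qed.

(** The algebra generated by [B] and the constants. By the Leibniz rule, stability under partial
    derivatives has to be checked on the generators only. *)
Inductive gen (B : set (R * R -> R)) : (R * R -> R) -> Prop :=
| GenCst k : gen B (fun=> k)
| GenBase b : B b -> gen B b
| GenAdd u v : gen B u -> gen B v -> gen B (fun x => u x + v x)
| GenMul u v : gen B u -> gen B v -> gen B (fun x => u x * v x).

Lemma partial_is_derive i u x d : is_derive (coordinate i x) 1 (slice i u x) d ->
  partial i u x = d.
Proof. by move=> []. Qed.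

Lemma slice_add i u v x : slice i (fun x => u x + v x) x = slice i u x \+ slice i v x.
Proof. by rewrite !sliceE. Qed.

Lemma slice_mul i u v x : slice i (fun x => u x * v x) x =
  (fun t => slice i u x t * slice i v x t).
Proof. by rewrite !sliceE. Qed.

Lemma slice_coordinate i u x : slice i u x (coordinate i x) = u x.
Proof. by rewrite sliceE /= insert_coordinate. Qed.

Lemma is_derive_slice i u x : derivable (slice i u x) (coordinate i x) 1 ->
  is_derive (coordinate i x) 1 (slice i u x) (partial i u x).
Proof. by move=> h; apply: DeriveDef. Qed.

Lemma is_derive_slice_mul i u v x :
  derivable (slice i u x) (coordinate i x) 1 ->
  derivable (slice i v x) (coordinate i x) 1 ->
  is_derive (coordinate i x) 1 (slice i (fun x => u x * v x) x)
   (partial i u x * v x + u x * partial i v x).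
Proof.
move=> /is_derive_slice du /is_derive_slice dv; rewrite slice_mul.
by have := is_derive_mul du dv; rewrite !slice_coordinate.
Qed.

Lemma regularD W u v : regular_on W u -> regular_on W v ->
  regular_on W (fun x => u x + v x).
Proof.
move=> ru rv x Wx; have [cu du] := ru _ Wx; have [cv dv] := rv _ Wx.
split; first exact: (continuousD cu cv).
by move=> i; rewrite slice_add; exact: derivableD.
Qed.

Lemma regularM W u v : regular_on W u -> regular_on W v ->
  regular_on W (fun x => u x * v x).
Proof.
move=> ru rv x Wx; have [cu du] := ru _ Wx; have [cv dv] := rv _ Wx.
split; first exact: (continuousM cu cv).
by move=> i; have [] := is_derive_slice_mul (du i) (dv i).
Qed.

Lemma is_derive_slice_cst i x (k : R) :
  is_derive (coordinate i x) 1 (slice i (fun=> k) x) 0.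
Proof. by rewrite sliceE; exact: is_derive_cst. Qed.

Lemma regular_cst W k : regular_on W (fun=> k).
Proof.
by move=> x _; split=> [|i]; [exact: cst_continuous|have [] := is_derive_slice_cst i x k].
Qed.

Lemma gen_regular W (B : set (R * R -> R)) : (forall b, B b -> regular_on W b) ->
  forall u, gen B u -> regular_on W u.
Proof.
move=> Br u; elim=> [k|b /Br//|u' v' _ ? _ ?|u' v' _ ? _ ?];
  [exact: regular_cst|exact: regularD|exact: regularM].
Qed.

(** There are two sets of generators because of the inverse map: [C] will hold its components, whose
    partials involve the reciprocal Jacobian found in [B], and the partials of that reciprocal are
    known only once those of the algebra of [C] are. *)
Lemma gen_partial W (B C : set (R * R -> R)) : C `<=` B ->
  (forall b, C b -> regular_on W b) ->
  (forall b i, C b -> exists2 v, gen B v & forall x, W x -> partial i b x = v x) ->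
  forall u i, gen C u -> exists2 v, gen B v & forall x, W x -> partial i u x = v x.
Proof.
move=> CB Br Bp; have Gr := gen_regular Br.
have GCB u : gen C u -> gen B u.
  by elim=> *; [exact: GenCst|apply: GenBase; exact: CB|exact: GenAdd|exact: GenMul].
move=> u i; elim=> {u} [k|b /Bp//|u v gu [u' gu' uu'] gv [v' gv' vv']|u v gu [u' gu' uu'] gv [v' gv' vv']].
- exists (fun=> 0); first exact: GenCst.
  by move=> x _; apply: partial_is_derive; exact: is_derive_slice_cst.
- exists (fun x => u' x + v' x); first exact: GenAdd.
  move=> x Wx; rewrite -uu'// -vv'//.
  apply: partial_is_derive; rewrite slice_add.
  by apply: is_deriveD; apply: is_derive_slice; [have [] := Gr _ gu _ Wx|have [] := Gr _ gv _ Wx].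
- exists (fun x => u' x * v x + u x * v' x).
    by apply: GenAdd; apply: GenMul => //; exact: GCB.
  move=> x Wx; rewrite -uu'// -vv'//.
  by apply: partial_is_derive; apply: is_derive_slice_mul; [have [] := Gr _ gu _ Wx|have [] := Gr _ gv _ Wx].
Qed.

Lemma gen_smooth W (B : set (R * R -> R)) : open W ->
  (forall b, B b -> regular_on W b) ->
  (forall b i, B b -> exists2 v, gen B v & forall x, W x -> partial i b x = v x) ->
  forall u, gen B u -> smooth_on W u.
Proof.
move=> oW Br Bp; apply: smooth_on_coind => //; first exact: gen_regular.
exact: gen_partial.
Qed.

Lemma smooth_on_regular W u : smooth_on W u -> regular_on W u.
Proof. by move=> h x Wx; have := h [::] x Wx. Qed.

Lemma smooth_on_partial W u i : smooth_on W u -> smooth_on W (partial i u).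
Proof.
(* [partials] folds from the right, so the last letter of a word acts first. *)
move=> h w x Wx; have := h (rcons w i) x Wx.
by rewrite /partials foldr_rcons.
Qed.

Lemma smooth_onW W W' u : W' `<=` W -> smooth_on W u -> smooth_on W' u.
Proof. by move=> s h w x /s /(h w). Qed.

Lemma partials_near w u v (x : R * R) : (\forall y \near x, u y = v y) ->
  \forall y \near x, partials w u y = partials w v y.
Proof.
elim: w u v x => [//|i w ih] u v x h /=.
have := near_join h => /filterS; apply => y hy.
by apply: partial_near; exact: ih.
Qed.

Lemma smooth_on_local W u : (forall x, W x -> exists W' v,
  [/\ open W', W' x, smooth_on W' v & forall y, W' y -> u y = v y]) -> smooth_on W u.
Proof.
move=> h w x /h[W' [v [oW' W'x sv uv]]]; have [cv dv] := sv w x W'x.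
have vu : \forall y \near x, v y = u y by apply: open_near W'x _ => // y /uv ->.
have vu' := partials_near w vu.
by split => [|i]; [exact: continuous_near vu' cv|exact: derivable_slice_near vu' (dv i)].
Qed.

Definition tens (a b : R -> R) (x : R * R) : R := a x.1 * b x.2.

Lemma flat_gen_continuous (a : R -> R) : flat_gen a -> continuous a.
Proof.
move=> /flat_gen_derive[a' _ h] x.
by apply/differentiable_continuous/derivable1_diffP; have [] := h x.
Qed.

Lemma continuous_tens (a b : R -> R) : continuous a -> continuous b -> continuous (tens a b).
Proof.
move=> ca cb x; apply: (@continuousM _ _ (a \o fst) (b \o snd)).
  by apply: continuous_comp; [exact: cvg_fst|exact: ca].
by apply: continuous_comp; [exact: cvg_snd|exact: cb].
Qed.

Lemma is_derive_tens0 (a b : R -> R) (a' : R) (x : R * R) : is_derive x.1 1 a a' ->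
  is_derive (coordinate 0 x) 1 (slice 0 (tens a b) x) (a' * b x.2).
Proof.
move=> da; rewrite /coordinate /slice /= /tens/=.
have := is_derive_mul da (@is_derive_cst _ _ _ (b x.2) x.1 1).
by rewrite /cst mulr0 addr0.
Qed.

Lemma is_derive_tens1 (a b : R -> R) (b' : R) (x : R * R) : is_derive x.2 1 b b' ->
  is_derive (coordinate 1 x) 1 (slice 1 (tens a b) x) (a x.1 * b').
Proof.
move=> da; rewrite /coordinate /slice /= /tens/=.
have := is_derive_mul (@is_derive_cst _ _ _ (a x.1) x.2 1) da.
by rewrite /cst mul0r add0r.
Qed.

Lemma smooth_tens (a b : R -> R) : flat_gen a -> flat_gen b -> smooth_on setT (tens a b).
Proof.
move=> ga gb.
apply: (@smooth_on_coind _ [set u | exists a b, [/\ flat_gen a, flat_gen b & u = tens a b]]).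
- exact: openT.
- move=> _ [{}a [{}b [/[dup] {}ga /flat_gen_derive[a' _ da] /[dup] {}gb /flat_gen_derive[b' _ db] ->]]] x _.
  split; first by apply: continuous_tens; exact: flat_gen_continuous.
  by move=> i; case: (ord2P i) => ->; [have [] := is_derive_tens0 b (da x.1)|have [] := is_derive_tens1 a (db x.2)].
- move=> _ i [{}a [{}b [/[dup] {}ga /flat_gen_derive[a' ga' da] /[dup] {}gb /flat_gen_derive[b' gb' db] ->]]].
  case: (ord2P i) => ->.
    exists (tens a' b); first by exists a', b.
    by move=> x _; apply: partial_is_derive; exact: is_derive_tens0.
  exists (tens a b'); first by exists a, b'.
  by move=> x _; apply: partial_is_derive; exact: is_derive_tens1.
- by exists a, b.
Qed.

Definition crect (a1 b1 a2 b2 : R) : set (R * R) := `[a1, b1]%classic `*` `[a2, b2]%classic.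

Lemma compact_crect a1 b1 a2 b2 : compact (crect a1 b1 a2 b2).
Proof. by apply: compact_setX; exact: segment_compact. Qed.

Lemma closed_crect a1 b1 a2 b2 : closed (crect a1 b1 a2 b2).
Proof. by apply: compact_closed; [exact: norm_hausdorff|exact: compact_crect]. Qed.

Lemma test_tens U (a b : R -> R) a1 b1 a2 b2 : crect a1 b1 a2 b2 `<=` U ->
  flat_gen a -> flat_gen b ->
  (forall x, (x <= a1) || (b1 <= x) -> a x = 0) ->
  (forall x, (x <= a2) || (b2 <= x) -> b x = 0) ->
  test_function U (tens a b).
Proof.
move=> sU ga gb a0 b0.
have sub : closure [set x | tens a b x != 0] `<=` crect a1 b1 a2 b2.
  rewrite closureE => x; apply; split; first exact: closed_crect.
  move=> {}x; rewrite /tens /= mulf_eq0 negb_or => /andP[ax bx].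
  split; rewrite /= in_itv/=; apply/andP; split; rewrite leNgt; apply/negP => h.
  - by move: ax; rewrite a0 ?eqxx// (ltW h).
  - by move: ax; rewrite a0 ?eqxx// (ltW h) orbT.
  - by move: bx; rewrite b0 ?eqxx// (ltW h).
  - by move: bx; rewrite b0 ?eqxx// (ltW h) orbT.
split; [exact: smooth_tens| |exact: subset_trans sU].
apply: subclosed_compact sub; first exact: closed_closure.
exact: compact_crect.
Qed.

End Plane.

(** * Images of almost affine maps *)

(* Parity: on a cell where p or q is constant the number of edges with p true at
   both ends along which q changes is even, so all columns carry the same parity
   of such edges; it is 0 on the left side and 1 on the right one. *)
Lemma grid_parity (n : nat) (p q : nat -> nat -> bool) :
  (forall j, (j <= n)%N -> p 0%N j = false) -> (forall j, (j <= n)%N -> p n j = true) ->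
  (forall i, (i <= n)%N -> q i 0%N = false) -> (forall i, (i <= n)%N -> q i n = true) ->
  exists i j, [/\ (i < n)%N, (j < n)%N,
    ~~ [&& p i j == p i.+1 j, p i j == p i j.+1 & p i j == p i.+1 j.+1] &
    ~~ [&& q i j == q i.+1 j, q i j == q i j.+1 & q i j == q i.+1 j.+1]].
Proof.
move=> p0 pn q0 qn; apply: contrapT => nex.
pose d i j i' j' := [&& p i j, p i' j' & (q i j (+) q i' j')].
pose S i k := \big[addb/false]_(j < k) d i j i j.+1.
have cellE i j : (i < n)%N -> (j < n)%N ->
    d i j i j.+1 (+) d i.+1 j i.+1 j.+1 (+) (d i j i.+1 j (+) d i j.+1 i.+1 j.+1) = false.
  move=> ni nj; have : [&& p i j == p i.+1 j, p i j == p i j.+1 & p i j == p i.+1 j.+1] ||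
    [&& q i j == q i.+1 j, q i j == q i j.+1 & q i j == q i.+1 j.+1].
    by apply: contrapT => /negP; rewrite negb_or => /andP[h1 h2]; apply: nex; exists i, j.
  rewrite /d; move: (p i j) (p i.+1 j) (p i j.+1) (p i.+1 j.+1).
  by move: (q i j) (q i.+1 j) (q i j.+1) (q i.+1 j.+1) => [] [] [] [] [] [] [] [].
have SE i k : (i < n)%N -> (k <= n)%N -> S i k (+) S i.+1 k = d i 0%N i.+1 0%N (+) d i k i.+1 k.
  move=> ni; elim: k => [_|k ih kn]; first by rewrite /S !big_ord0 !addbb.
  rewrite /S !big_ord_recr/= addbACA -!/(S _ _) ih 1?ltnW//.
  have := cellE i k ni kn.
  move: (d i 0%N _ _) (d i k i.+1 k) (d i k.+1 _ _) (d i k i k.+1) (d i.+1 k _ _).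
  by move=> [] [] [] [] [].
have Sc i : (i <= n)%N -> S i n = false.
  elim: i => [_|i ih ni]; first by rewrite /S big1// => j _; rewrite /d p0// ltnW.
  have := SE i n ni (leqnn _); rewrite ih 1?ltnW// /d !q0 ?(ltnW ni)// !qn ?(ltnW ni)//.
  by rewrite !andbF.
have Sn k : (k <= n)%N -> S n k = q n k.
  elim: k => [_|k ih kn]; first by rewrite /S big_ord0 q0.
  rewrite /S big_ord_recr/= -/(S n k) ih 1?ltnW// /d !pn ?(ltnW kn)//=.
  by rewrite addbA addbb.
by have := Sn n (leqnn _); rewrite Sc// qn.
Qed.

Section Miranda.
Context {R : realType}.

Definition sq (x0 : R * R) (s : R) : set (R * R) :=
  [set x | `|x.1 - x0.1| <= s /\ `|x.2 - x0.2| <= s].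

Lemma sqE x0 s : sq x0 s = crect (x0.1 - s) (x0.1 + s) (x0.2 - s) (x0.2 + s).
Proof.
by apply/seteqP; split => x; rewrite /sq /crect /= !in_itv/= !ler_distl.
Qed.

(** Closeness to x - x0 forces H1 to be negative on the left side and positive on the right one, and
    likewise H2 below and above. [grid_parity], applied to the signs at the nodes of finer and finer
    grids, gives cells whose corners have both signs for H1 and for H2; at a cluster point of these
    cells both functions vanish by continuity. *)
Lemma miranda (x0 : R * R) (s : R) (H1 H2 : R * R -> R) : 0 < s ->
  (forall x, sq x0 s x -> {for x, continuous H1} /\ {for x, continuous H2}) ->
  (forall x, sq x0 s x -> `|H1 x - (x.1 - x0.1)| < s /\ `|H2 x - (x.2 - x0.2)| < s) ->
  exists2 x, sq x0 s x & H1 x = 0 /\ H2 x = 0.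
Proof.
move=> s0 cH bH.
pose st n : R := 2 * s / n.+1%:R.
pose pt n i j : R * R := (x0.1 - s + i%:R * st n, x0.2 - s + j%:R * st n).
have st0 n : 0 < st n by rewrite divr_gt0// mulr_gt0.
have stn n : n.+1%:R * st n = 2 * s by rewrite mulrC divfK// pnatr_eq0.
have ist n i : (i <= n.+1)%N -> i%:R * st n <= 2 * s.
  by move=> h; rewrite -(stn n) ler_pM2r// ler_nat.
have pt_sq n i j : (i <= n.+1)%N -> (j <= n.+1)%N -> sq x0 s (pt n i j).
  move=> /ist hi /ist hj; rewrite /sq /pt /=.
  have i0 : 0 <= i%:R * st n by rewrite mulr_ge0// ltW.
  have j0 : 0 <= j%:R * st n by rewrite mulr_ge0// ltW.
  by rewrite !ler_norml; split; apply/andP; split; lra.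
have cellP n : exists i j, [/\ (i < n.+1)%N, (j < n.+1)%N,
   ~ ((forall k l, (k <= 1)%N -> (l <= 1)%N -> 0 <= H1 (pt n (i + k)%N (j + l)%N)) \/
      (forall k l, (k <= 1)%N -> (l <= 1)%N -> H1 (pt n (i + k)%N (j + l)%N) < 0)) &
   ~ ((forall k l, (k <= 1)%N -> (l <= 1)%N -> 0 <= H2 (pt n (i + k)%N (j + l)%N)) \/
      (forall k l, (k <= 1)%N -> (l <= 1)%N -> H2 (pt n (i + k)%N (j + l)%N) < 0))].
  have aux (H : R * R -> R) i j : ~~ [&& (0 <= H (pt n i j)) == (0 <= H (pt n i.+1 j)),
      (0 <= H (pt n i j)) == (0 <= H (pt n i j.+1)) &
      (0 <= H (pt n i j)) == (0 <= H (pt n i.+1 j.+1))] ->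
    ~ ((forall k l, (k <= 1)%N -> (l <= 1)%N -> 0 <= H (pt n (i + k)%N (j + l)%N)) \/
      (forall k l, (k <= 1)%N -> (l <= 1)%N -> H (pt n (i + k)%N (j + l)%N) < 0)).
    move=> /negP h [] h'; apply: h.
      have := h' 0%N 0%N isT isT; have := h' 1%N 0%N isT isT.
      have := h' 0%N 1%N isT isT; have := h' 1%N 1%N isT isT.
      by rewrite !addn0 !addn1 => -> -> -> ->.
    have := h' 0%N 0%N isT isT; have := h' 1%N 0%N isT isT.
    have := h' 0%N 1%N isT isT; have := h' 1%N 1%N isT isT.
    by rewrite !addn0 !addn1 !ltNge => /negbTE -> /negbTE -> /negbTE -> /negbTE ->.
  have [||||i [j [hi hj h1 h2]]] := @grid_parity n.+1 (fun i j => 0 <= H1 (pt n i j))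
     (fun i j => 0 <= H2 (pt n i j)); last by exists i, j; split => //; exact: aux.
  - move=> i hi; have [+ _] := bH _ (pt_sq n 0%N i isT hi).
    by rewrite /pt /= mul0r ltr_norml => /andP[? ?]; apply/negbTE; rewrite -ltNge; lra.
  - move=> i hi; have [+ _] := bH _ (pt_sq n n.+1 i (leqnn _) hi).
    by rewrite /pt /= stn ltr_norml => /andP[? ?]; lra.
  - move=> i hi; have [_] := bH _ (pt_sq n i 0%N hi isT).
    by rewrite /pt /= mul0r ltr_norml => /andP[? ?]; apply/negbTE; rewrite -ltNge; lra.
  - move=> i hi; have [_] := bH _ (pt_sq n i n.+1 hi (leqnn _)).
    by rewrite /pt /= stn ltr_norml => /andP[? ?]; lra.
have /choice[ci /choice[cj hc]] := cellP.
pose z n := pt n (ci n) (cj n).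
have zsq n : sq x0 s (z n).
  by have [h1 h2 _ _] := hc n; apply: pt_sq; exact: ltnW.
have cK : compact (sq x0 s) by rewrite sqE; exact: compact_crect.
have [|x [xK clx]] := cK (z @ \oo) _; first by exists 0%N => // n _; exact: zsq.
have key (H : R * R -> R) : {for x, continuous H} ->
   (forall n, ~ ((forall k l, (k <= 1)%N -> (l <= 1)%N -> 0 <= H (pt n (ci n + k)%N (cj n + l)%N)) \/
      (forall k l, (k <= 1)%N -> (l <= 1)%N -> H (pt n (ci n + k)%N (cj n + l)%N) < 0))) ->
   H x = 0.
  move=> cHx hn.
  have near_cell (P : R * R -> Prop) : (\forall y \near x, P y) ->
     exists n, forall k l, (k <= 1)%N -> (l <= 1)%N -> P (pt n (ci n + k)%N (cj n + l)%N).
    (* A lower left corner within e / 2 of [x] and a grid step below e / 2 put all four corners of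
       the cell into the given neighbourhood. *)
    move=> /nbhs2P[e e0 he]; have e20 : 0 < e / 2 by rewrite divr_gt0.
    pose N := Num.trunc (2 * s / (e / 2)).
    have [||_ [[n /= Nn <-] hz]] := clx (z @` [set n | (N <= n)%N])
       [set y | `|y.1 - x.1| < e / 2 /\ `|y.2 - x.2| < e / 2].
    - by exists N => // n /= Nn; exists n.
    - by apply/nbhs2P; exists (e / 2).
    exists n => k l k1 l1; case: hz => /= hz1 hz2.
    have stlt : st n < e / 2.
      rewrite /st ltr_pdivrMr ?ltr0n// [e / 2 * _]mulrC -ltr_pdivrMr//.
      apply: lt_le_trans (Num.Theory.truncnS_gt _) _.
      by rewrite ler_nat.
    have b i : (i <= 1)%N -> 0 <= i%:R * st n <= st n.
      move=> i1; rewrite mulr_ge0 ?(ltW (st0 n))//=.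
      by rewrite -[X in _ <= X]mul1r ler_pM2r// (ler_nat R i 1).
    have /andP[k0 kst] := b _ k1; have /andP[l0 lst] := b _ l1.
    move: hz1 hz2; rewrite !ltr_norml => /andP[a1 a2] /andP[a3 a4].
    by apply: he; rewrite /pt /= natrD mulrDl ltr_norml; apply/andP; split; lra.
  apply/eqP; rewrite eq_le; apply/andP; split; rewrite leNgt; apply/negP => Hx.
    have [n h] := near_cell (fun y => 0 < H y) (cvgr_gt _ cHx _ Hx).
    by apply: (hn n); left => k l hk hl; exact: ltW (h _ _ hk hl).
  have [n h] := near_cell (fun y => H y < 0) (cvgr_lt _ cHx _ Hx).
  by apply: (hn n); right => k l hk hl; exact: h.
exists x => //; have [c1 c2] := cH _ xK.
by split; apply: key => // n; have [] := hc n.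
Qed.

(** Miranda's theorem for A^-1 (F - y), where A has rows (a, b) and (c, d): its deviation from x -
    x0 is A^-1 applied to the error (e1, e2), which Cramer's rule writes as the two quotients of the
    hypothesis. *)
Lemma almost_affine_surj (x0 y : R * R) (s a b c d : R) (F : R * R -> R * R) :
  0 < s -> a * d - b * c != 0 ->
  (forall x, sq x0 s x -> {for x, continuous F}) ->
  (forall x, sq x0 s x ->
    let e1 := (F x).1 - y.1 - (a * (x.1 - x0.1) + b * (x.2 - x0.2)) in
    let e2 := (F x).2 - y.2 - (c * (x.1 - x0.1) + d * (x.2 - x0.2)) in
    `|(d * e1 - b * e2) / (a * d - b * c)| < s /\
    `|(a * e2 - c * e1) / (a * d - b * c)| < s) ->
  exists2 x, sq x0 s x & F x = y.
Proof.
move=> s0 D0 cF hF.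
pose H1 x := (d * ((F x).1 - y.1) - b * ((F x).2 - y.2)) / (a * d - b * c).
pose H2 x := (a * ((F x).2 - y.2) - c * ((F x).1 - y.1)) / (a * d - b * c).
have [||x xs [h1 h2]] := @miranda x0 s H1 H2 s0.
- move=> x /cF cFx.
  have c1 : {for x, continuous (fun x => (F x).1)} by apply: continuous_comp cFx _; exact: cvg_fst.
  have c2 : {for x, continuous (fun x => (F x).2)} by apply: continuous_comp cFx _; exact: cvg_snd.
  split; apply: cvgMl; apply: cvgB; apply: cvgMr; apply: cvgB => //; exact: cvg_cst.
- move=> x /hF /= [h1 h2]; split.
    rewrite (_ : _ - _ = (d * ((F x).1 - y.1 - (a * (x.1 - x0.1) + b * (x.2 - x0.2))) -
       b * ((F x).2 - y.2 - (c * (x.1 - x0.1) + d * (x.2 - x0.2)))) / (a * d - b * c))//.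
    by rewrite /H1; field.
  rewrite (_ : _ - _ = (a * ((F x).2 - y.2 - (c * (x.1 - x0.1) + d * (x.2 - x0.2))) -
       c * ((F x).1 - y.1 - (a * (x.1 - x0.1) + b * (x.2 - x0.2)))) / (a * d - b * c))//.
  by rewrite /H2; field.
exists x => //.
have D' : (a * d - b * c)^-1 != 0 by rewrite invr_eq0.
move: h1 h2; rewrite /H1 /H2 => /eqP; rewrite mulf_eq0 (negbTE D') orbF => /eqP h1.
move=> /eqP; rewrite mulf_eq0 (negbTE D') orbF => /eqP h2.
have e1 : (a * d - b * c) * ((F x).1 - y.1) = 0.
  transitivity (a * (d * ((F x).1 - y.1) - b * ((F x).2 - y.2)) +
     b * (a * ((F x).2 - y.2) - c * ((F x).1 - y.1))); first by ring.
  by rewrite h1 h2 !mulr0 addr0.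
have e2 : (a * d - b * c) * ((F x).2 - y.2) = 0.
  transitivity (c * (d * ((F x).1 - y.1) - b * ((F x).2 - y.2)) +
     d * (a * ((F x).2 - y.2) - c * ((F x).1 - y.1))); first by ring.
  by rewrite h1 h2 !mulr0 addr0.
move/eqP: e1; rewrite mulf_eq0 (negbTE D0) /= subr_eq0 => /eqP e1.
move/eqP: e2; rewrite mulf_eq0 (negbTE D0) /= subr_eq0 => /eqP e2.
by rewrite [LHS]surjective_pairing e1 e2 -surjective_pairing.
Qed.

End Miranda.

(** * Quadratic maps *)

Section Quadratic.
Context {R : realType}.

(** The coefficients are the value, the gradient and the Hessian at the base point [qc]; hence the
    halves in [qval]. *)
Record quadratic := Quadratic
  { q0 : R; q1 : R; q2 : R; q11 : R; q12 : R; q22 : R; qc : R * R }.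

Definition qval (q : quadratic) (x : R * R) : R :=
  q0 q + q1 q * (x.1 - (qc q).1) + q2 q * (x.2 - (qc q).2)
  + q11 q / 2 * ((x.1 - (qc q).1) * (x.1 - (qc q).1))
  + q12 q * ((x.1 - (qc q).1) * (x.2 - (qc q).2))
  + q22 q / 2 * ((x.2 - (qc q).2) * (x.2 - (qc q).2)).

Definition qd1 (q : quadratic) (x : R * R) : R :=
  q1 q + q11 q * (x.1 - (qc q).1) + q12 q * (x.2 - (qc q).2).
Definition qd2 (q : quadratic) (x : R * R) : R :=
  q2 q + q12 q * (x.1 - (qc q).1) + q22 q * (x.2 - (qc q).2).

Definition qmid (x y : R * R) : R * R := ((x.1 + y.1) / 2, (x.2 + y.2) / 2).

(* The mean value formula is exact, at the midpoint, for quadratic polynomials. *)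
Lemma qvalB q x y : qval q x - qval q y =
  qd1 q (qmid x y) * (x.1 - y.1) + qd2 q (qmid x y) * (x.2 - y.2).
Proof. by rewrite /qval /qd1 /qd2 /qmid /=; field. Qed.

Lemma continuous_fst : continuous (fst : R * R -> R).
Proof. by move=> x; exact: cvg_fst. Qed.

Lemma continuous_snd : continuous (snd : R * R -> R).
Proof. by move=> x; exact: cvg_snd. Qed.

Definition coords : set (R * R -> R) := [set u | u = fst \/ u = snd].

Lemma is_derive_slice_fst i (x : R * R) :
  is_derive (coordinate i x) 1 (slice i fst x) (i == 0)%:R.
Proof.
case: (ord2P i) => ->; rewrite /coordinate /slice /=; first exact: is_derive_id.
exact: is_derive_cst.
Qed.

Lemma is_derive_slice_snd i (x : R * R) :
  is_derive (coordinate i x) 1 (slice i snd x) (i == 1)%:R.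
Proof.
case: (ord2P i) => ->; rewrite /coordinate /slice /=; last exact: is_derive_id.
exact: is_derive_cst.
Qed.

Lemma gen_coords_smooth u : gen coords u -> smooth_on setT u.
Proof.
move: u; apply: gen_smooth; first exact: openT.
- move=> b [->|->] x _; split.
  + exact: continuous_fst.
  + by move=> i; have [] := is_derive_slice_fst i x.
  + exact: continuous_snd.
  + by move=> i; have [] := is_derive_slice_snd i x.
- move=> b i [->|->].
  + exists (fun=> (i == 0)%:R); first exact: GenCst.
    by move=> x _; apply: partial_is_derive; exact: is_derive_slice_fst.
  + exists (fun=> (i == 1)%:R); first exact: GenCst.
    by move=> x _; apply: partial_is_derive; exact: is_derive_slice_snd.
Qed.

Ltac gen_tac := repeat first [apply: GenCst|apply: GenAdd|apply: GenMul|
  (apply: GenBase; by left)|(apply: GenBase; by right)].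

Lemma gen_qval q : gen coords (qval q).
Proof. rewrite /qval; gen_tac. Qed.
Lemma gen_qd1 q : gen coords (qd1 q).
Proof. rewrite /qd1; gen_tac. Qed.
Lemma gen_qd2 q : gen coords (qd2 q).
Proof. rewrite /qd2; gen_tac. Qed.

Lemma smooth_qval q : smooth_on setT (qval q).
Proof. exact: gen_coords_smooth (gen_qval q). Qed.

Lemma is_derive_qval1 q (x : R * R) :
  is_derive (coordinate 0 x) 1 (slice 0 (qval q) x) (qd1 q x).
Proof.
rewrite /coordinate /slice /=.
apply: (@is_derive_slope _ _ (fun h => qd1 q x + q11 q / 2 * h)).
  by near=> h; rewrite /qval /qd1 /=; field.
have : (qd1 q x + q11 q / 2 * h) @[h --> (0 : R)] --> qd1 q x + q11 q / 2 * 0.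
  by apply: cvgD; [exact: cvg_cst|apply: cvgMr; exact: cvg_id].
by rewrite mulr0 addr0.
Unshelve. all: by end_near. Qed.

Lemma is_derive_qval2 q (x : R * R) :
  is_derive (coordinate 1 x) 1 (slice 1 (qval q) x) (qd2 q x).
Proof.
rewrite /coordinate /slice /=.
apply: (@is_derive_slope _ _ (fun h => qd2 q x + q22 q / 2 * h)).
  by near=> h; rewrite /qval /qd2 /=; field.
have : (qd2 q x + q22 q / 2 * h) @[h --> (0 : R)] --> qd2 q x + q22 q / 2 * 0.
  by apply: cvgD; [exact: cvg_cst|apply: cvgMr; exact: cvg_id].
by rewrite mulr0 addr0.
Unshelve. all: by end_near. Qed.

Definition qmap (p q : quadratic) (x : R * R) : R * R := (qval p x, qval q x).

Definition qjac (p q : quadratic) (x : R * R) : R := qd1 p x * qd2 q x - qd2 p x * qd1 q x.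

Lemma gen_qjac p q : gen coords (qjac p q).
Proof.
have -> : qjac p q = (fun x => qd1 p x * qd2 q x + (-1) * (qd2 p x * qd1 q x)).
  by apply/funext => x; rewrite /qjac mulN1r.
by apply: GenAdd; apply: GenMul; (try apply: GenMul); (exact: gen_qd1 || exact: gen_qd2 || exact: GenCst).
Qed.

Lemma continuous_gen u : gen coords u -> continuous u.
Proof. by move=> /gen_coords_smooth/smooth_on_regular h x; have [] := h x Logic.I. Qed.

Lemma continuous_qmap p q : continuous (qmap p q).
Proof.
move=> x; have c1 := continuous_gen (gen_qval p) (x := x).
have c2 := continuous_gen (gen_qval q) (x := x); exact: (cvg_pair c1 c2).
Qed.

(** Cramer's rule for the exact mean value formula. It yields injectivity wherever the Jacobian does
    not vanish at midpoints, and the difference quotients of the inverse. *)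
Lemma qval_solve p q x y (m := qmid x y) : qjac p q m != 0 ->
  x.1 - y.1 = (qd2 q m * (qval p x - qval p y) - qd2 p m * (qval q x - qval q y)) * (qjac p q m)^-1 /\
  x.2 - y.2 = (qd1 p m * (qval q x - qval q y) - qd1 q m * (qval p x - qval p y)) * (qjac p q m)^-1.
Proof.
by move=> J0; rewrite !qvalB -/m; split; move: J0; rewrite /qjac => J0; field.
Qed.

Lemma qmap_inj p q x y : qjac p q (qmid x y) != 0 -> qmap p q x = qmap p q y -> x = y.
Proof.
move=> /qval_solve[h1 h2] h; have hp : qval p x = qval p y := congr1 fst h.
have hq : qval q x = qval q y := congr1 snd h.
move: h1 h2; rewrite hp hq !subrr !mulr0 !subrr !mul0r.
by move=> /subr0_eq e1 /subr0_eq e2; rewrite [x]surjective_pairing e1 e2 -surjective_pairing.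
Qed.

Lemma ler_norm_half (u : R) : `|u / 2| <= `|u|.
Proof.
rewrite normrM [X in _ * X]ger0_norm ?invr_ge0//.
by have := normr_ge0 u; lra.
Qed.

(** [almost_affine_surj] with the differential at [x0] as linear part: on a small square the
    quadratic remainder and the displacement of [y] together stay below what the inverse matrix can
    absorb. *)
Lemma qmap_open p q x0 (e : R) : qjac p q x0 != 0 -> 0 < e ->
  exists2 d : R, 0 < d & forall y, `|y.1 - qval p x0| < d -> `|y.2 - qval q x0| < d ->
    exists2 x, sq x0 e x & qmap p q x = y.
Proof.
move=> J0 e0.
pose a := qd1 p x0; pose b := qd2 p x0; pose c := qd1 q x0; pose d := qd2 q x0.
pose M := (`|a| + `|b| + `|c| + `|d|) / `|qjac p q x0| + 1.
pose K := `|q11 p| + `|q12 p| + `|q22 p| + `|q11 q| + `|q12 q| + `|q22 q| + 1.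
have nJ0 : 0 < `|qjac p q x0| by rewrite normr_gt0.
have M0 : 0 < M by rewrite ltr_wpDl// divr_ge0// !addr_ge0.
have K0 : 0 < K by rewrite ltr_wpDl// !addr_ge0.
(* [M] bounds the inverse matrix and [K] the second derivatives. The choice gives K s^2 <= s / (4
   M); with |y - g(x0)| < s / (4 M) the error is at most s / (2 M), and the inverse matrix takes it
   to at most s / 2. *)
pose s := Num.min e (1 / (4 * M * K)).
have s0 : 0 < s by rewrite lt_min e0 divr_gt0// !mulr_gt0.
have se : s <= e by rewrite ge_min lexx.
have sMK : M * (K * s) <= 1 / 4.
  have : s <= 1 / (4 * M * K) by rewrite ge_min lexx orbT.
  rewrite ler_pdivlMr ?mulr_gt0// => h; rewrite ler_pdivlMr// [_ * 4](_ : _ = s * (4 * M * K))//.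
  by ring.
exists (s / (4 * M)); first by rewrite divr_gt0// mulr_gt0.
move=> y hy1 hy2.
have D0 : a * d - b * c != 0 by exact: J0.
have [||x xs Px] := @almost_affine_surj _ x0 y s a b c d (qmap p q) s0 D0.
- by move=> x _; exact: continuous_qmap.
- move=> x [hx1 hx2] /=.
  set X := x.1 - x0.1; set Y := x.2 - x0.2.
  have rem (r : quadratic) (z : R) : `|q11 r| + `|q12 r| + `|q22 r| <= K ->
      `|z - qval r x0| < s / (4 * M) ->
      `|qval r x - z - (qd1 r x0 * X + qd2 r x0 * Y)| <= s / (2 * M).
    move=> hK hz.
    rewrite (_ : _ - _ - _ = - (z - qval r x0) +
       (q11 r / 2 * (X * X) + q12 r * (X * Y) + q22 r / 2 * (Y * Y))); last first.
      by rewrite /qval /qd1 /qd2 /X /Y; field.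
    have hXX : `|X * X| <= s * s by rewrite normrM ler_pM.
    have hXY : `|X * Y| <= s * s by rewrite normrM ler_pM.
    have hYY : `|Y * Y| <= s * s by rewrite normrM ler_pM.
    have hq : `|q11 r / 2 * (X * X) + q12 r * (X * Y) + q22 r / 2 * (Y * Y)| <= K * (s * s).
      apply: (@le_trans _ _ ((`|q11 r| + `|q12 r| + `|q22 r|) * (s * s))); last first.
        by rewrite ler_wpM2r// mulr_ge0// ltW.
      rewrite [leRHS]mulrDl [X in _ <= X + _]mulrDl.
      apply: le_trans (ler_normD _ _) _; apply: lerD.
        apply: le_trans (ler_normD _ _) _; apply: lerD; rewrite normrM ler_pM//.
        exact: ler_norm_half.
      by rewrite normrM ler_pM// ler_norm_half.
    have hq' : K * (s * s) <= s / (4 * M).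
      rewrite ler_pdivlMr ?mulr_gt0//.
      have -> : K * (s * s) * (4 * M) = s * (4 * (M * (K * s))) by ring.
      by rewrite -[leRHS]mulr1 ler_wpM2l ?(ltW s0)//; lra.
    apply: le_trans (ler_normD _ _) _; rewrite normrN.
    have -> : s / (2 * M) = s / (4 * M) + s / (4 * M) by field; rewrite gt_eqF.
    by apply: lerD; [exact: ltW|exact: le_trans hq _].
  have r1 := rem p y.1 _ hy1; have r2 := rem q y.2 _ hy2.
  have hp : `|q11 p| + `|q12 p| + `|q22 p| <= K.
    have := normr_ge0 (q11 p); have := normr_ge0 (q12 p); have := normr_ge0 (q22 p);
    have := normr_ge0 (q11 q); have := normr_ge0 (q12 q); have := normr_ge0 (q22 q); rewrite /K; lra.
  have hq : `|q11 q| + `|q12 q| + `|q22 q| <= K.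
    have := normr_ge0 (q11 p); have := normr_ge0 (q12 p); have := normr_ge0 (q22 p);
    have := normr_ge0 (q11 q); have := normr_ge0 (q12 q); have := normr_ge0 (q22 q); rewrite /K; lra.
  move: {r1 r2 rem} (r1 hp) (r2 hq); rewrite -/a -/b -/c -/d.
  set e1 := _ - _ - _; set e2 := _ - _ - _ => h1 h2.
  have fin (u v : R) : `|u| + `|v| <= `|a| + `|b| + `|c| + `|d| ->
     `|(u * e1 - v * e2) / (a * d - b * c)| < s.
    move=> huv; rewrite normrM normfV.
    apply: (@le_lt_trans _ _ (s / 2)); last by lra.
    rewrite ler_pdivrMr//.
    apply: (@le_trans _ _ ((`|a| + `|b| + `|c| + `|d|) * (s / (2 * M)))).
      apply: le_trans (ler_normB _ _) _; rewrite !normrM.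
      apply: (@le_trans _ _ ((`|u| + `|v|) * (s / (2 * M)))).
        by rewrite mulrDl; apply: lerD; rewrite ler_wpM2l.
      by rewrite ler_wpM2r// divr_ge0// ?ltW// mulr_gt0.
    rewrite -[X in _ <= _ * X]/(`|qjac p q x0|).
    have hM : `|a| + `|b| + `|c| + `|d| <= M * `|qjac p q x0|.
      by rewrite /M mulrDl divfK ?gt_eqF// mul1r lerDl.
    apply: (@le_trans _ _ (M * `|qjac p q x0| * (s / (2 * M)))).
      by rewrite ler_wpM2r// divr_ge0// ?ltW// mulr_gt0.
    by rewrite le_eqVlt; apply/orP; left; apply/eqP; field; rewrite gt_eqF.
  split.
    apply: fin; have := normr_ge0 a; have := normr_ge0 b; have := normr_ge0 c; have := normr_ge0 d; lra.
  rewrite (_ : a * e2 - c * e1 = (- c) * e1 - (- a) * e2); last by ring.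
  apply: fin; rewrite !normrN; have := normr_ge0 a; have := normr_ge0 b; have := normr_ge0 c; have := normr_ge0 d; lra.
exists x => //; case: xs => h1 h2; split; exact: le_trans se.
Qed.

End Quadratic.

Lemma near_insert_shift (R : realType) i (x : R * R) (A : set (R * R)) : nbhs x A ->
  \forall t \near (0 : R), A (insert i x (coordinate i x + t)).
Proof.
move=> /nbhs2P[e e0 h]; near=> t.
have ht : `|t| < e by rewrite -normrN -sub0r; near: t; exact: nbhsx_ballx.
by rewrite /coordinate /insert; case: (i == 0); apply: h; rewrite /= ?subrr ?normr0// addrAC subrr add0r.
Unshelve. all: by end_near. Qed.

(** * Smooth inverses of quadratic maps *)

Section LocalInverse.
Context {R : realType}.
Variables (p q : @quadratic R) (V : set (R * R)).
Hypothesis oV : open V.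
Hypothesis J0 : forall x, V x -> qjac p q x != 0.
Hypothesis injV : forall x y, V x -> V y -> qmap p q x = qmap p q y -> x = y.

Let W := qmap p q @` V.
Let h (y : R * R) : R * R := get [set x | V x /\ qmap p q x = y].

Let hP x : V x -> h (qmap p q x) = x.
Proof.
move=> Vx; rewrite /h; case: (getPex (P := [set z | V z /\ qmap p q z = qmap p q x])).
  by exists x.
by move=> Vy e; exact: injV.
Qed.

Let near_sq x0 (e : R) : V x0 -> 0 < e -> exists2 d : R, 0 < d &
  forall y, `|y.1 - qval p x0| < d -> `|y.2 - qval q x0| < d ->
    [/\ V (h y), sq x0 e (h y) & qmap p q (h y) = y].
Proof.
move=> Vx0 e0; have [e1 e10 he1] := (open2P V).1 oV _ Vx0.
have e2 : 0 < Num.min e (e1 / 2) by rewrite lt_min e0 divr_gt0.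
have [d d0 hd] := qmap_open (J0 Vx0) e2.
exists d => // y h1 h2; have [x [x1 x2] xy] := hd y h1 h2.
have Vx : V x.
  apply: he1; [apply: le_lt_trans x1 _|apply: le_lt_trans x2 _];
  by rewrite gt_min; apply/orP; right; lra.
rewrite -xy hP//; split => //; split.
  by apply: le_trans x1 _; rewrite ge_min lexx.
by apply: le_trans x2 _; rewrite ge_min lexx.
Qed.

Let openW : open W.
Proof.
apply/open2P => _ [x Vx <-]; have [d d0 hd] := near_sq Vx ltr01.
by exists d => // y h1 h2; have [Vy _ e] := hd y h1 h2; exists (h y).
Qed.

Let ch y : W y -> {for y, continuous h}.
Proof.
move=> [x Vx <-]; apply/cvgrPdist_lt => e e0.
have e20 : 0 < e / 2 by rewrite divr_gt0.
have [d d0 hd] := near_sq Vx e20; apply/nbhs2P; exists d => // z h1 h2.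
rewrite hP//; have [_ [s1 s2] _] := hd z h1 h2.
rewrite prod_normE/= gt_max; rewrite -[X in X && _]/(`|x.1 - (h z).1| < e) -[X in _ && X]/(`|x.2 - (h z).2| < e).
by rewrite [X in X < _ ]distrC [X in _ && (X < _)]distrC; apply/andP; split; lra.
Qed.

Let ch1 y : W y -> {for y, continuous (fst \o h)}.
Proof. by move=> /ch c; apply: continuous_comp c _; exact: cvg_fst. Qed.

Let ch2 y : W y -> {for y, continuous (snd \o h)}.
Proof. by move=> /ch c; apply: continuous_comp c _; exact: cvg_snd. Qed.

Let cmid u y : gen coords u -> W y ->
  {for y, continuous (fun z => u (qmid (h z) (h y)))}.
Proof.
move=> gu Wy; apply: (@continuous_comp _ _ _ (fun z => qmid (h z) (h y)) u).
  have c1 : {for y, continuous (fun z => ((h z).1 + (h y).1) / 2)}.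
    by apply: cvgMl; apply: cvgD; [exact: (ch1 Wy)|exact: cvg_cst].
  have c2 : {for y, continuous (fun z => ((h z).2 + (h y).2) / 2)}.
    by apply: cvgMl; apply: cvgD; [exact: (ch2 Wy)|exact: cvg_cst].
  exact: (cvg_pair c1 c2).
exact: continuous_gen.
Qed.

Let midE (y : R * R) : qmid y y = y.
Proof. by case: y => a b; rewrite /qmid /=; congr (_, _); field. Qed.

Let cvg_insert i (y : R * R) (u : R * R -> R) : {for y, continuous u} ->
  u (insert i y (coordinate i y + t)) @[t --> 0] --> u y.
Proof.
move=> cu; apply/cvgrPdist_lt => e e0.
have nu : nbhs y [set z | `|u y - u z| < e] by move/cvgrPdist_lt : cu; exact.
exact: (near_insert_shift i nu).
Qed.

(** By the exact mean value formula the increment of [k \o h] along a slice is t times a function of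
    the midpoint of [h z] and [h y]. That function is continuous because [h] is, so the
    differentiability of the inverse is a case of [is_derive_slope]. *)
Let slice_h (k : R * R -> R) (u1 u2 : R * R -> R) y i : gen coords u1 -> gen coords u2 ->
  (forall x y (m := qmid x y), qjac p q m != 0 ->
    k x - k y = (u1 m * (qval p x - qval p y) + u2 m * (qval q x - qval q y)) * (qjac p q m)^-1) ->
  W y ->
  is_derive (coordinate i y) 1 (slice i (k \o h) y)
    ((u1 (h y) * (i == 0)%:R + u2 (h y) * (i == 1)%:R) * (qjac p q (h y))^-1).
Proof.
move=> gu1 gu2 kE Wy.
have Jy : qjac p q (qmid (h y) (h y)) != 0.
  by rewrite midE; case: (Wy) => x Vx <-; rewrite hP// J0.
have cJ := cmid (gen_qjac p q) Wy.
pose G (z : R * R) := (u1 (qmid (h z) (h y)) * (i == 0)%:R + u2 (qmid (h z) (h y)) * (i == 1)%:R) *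
  (qjac p q (qmid (h z) (h y)))^-1.
apply: (@is_derive_slope _ _ (fun t => G (insert i y (coordinate i y + t)))).
  have nW : \forall z \near y, W z /\ qjac p q (qmid (h z) (h y)) != 0.
    by apply: filterI; [exact: open_nbhs_nbhs|exact: cvgr_neq0 cJ Jy].
  have := near_insert_shift i nW; apply: filterS => t -[Wz Jz].
  rewrite sliceE /= insert_coordinate.
  set z := insert _ _ _ in Wz Jz *.
  have zE w : W w -> qmap p q (h w) = w by case=> x Vx <-; rewrite hP.
  have zp w : W w -> qval p (h w) = w.1 by move=> /zE; move/(congr1 fst).
  have zq w : W w -> qval q (h w) = w.2 by move=> /zE; move/(congr1 snd).
  rewrite kE// (zp _ Wz) (zp _ Wy) (zq _ Wz) (zq _ Wy) /G mulrA; congr (_ * _).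
  have z1 : z.1 - y.1 = t * (i == 0)%:R.
    rewrite /z /insert /coordinate; case: (ord2P i) => -> /=; ring.
  have z2 : z.2 - y.2 = t * (i == 1)%:R.
    rewrite /z /insert /coordinate; case: (ord2P i) => -> /=; ring.
  by rewrite z1 z2; ring.
have cG : {for y, continuous G}.
  apply: continuousM; last by apply: continuousV => //; exact: cJ.
  by apply: continuousD; apply: cvgMl; exact: cmid.
have := cvg_insert i cG; rewrite {2}/G midE; exact.
Qed.

Lemma qmap_inverse : open (qmap p q @` V) /\ exists h : R * R -> R * R,
  (forall x, V x -> h (qmap p q x) = x) /\ smooth_map_on (qmap p q @` V) h.
Proof.
split; first exact: openW.
exists h; split; first exact: hP.
pose jinv y := (qjac p q (h y))^-1.
(* The components of [h] have partials of the form (polynomial in [h]) times [jinv], and [jinv] has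
   partials - jinv^2 times those of [qjac p q \o h], which lies in [gen C]. So [gen B] is closed
   under partial derivatives on W. *)
pose C : set (R * R -> R) := [set u | u = fst \o h \/ u = snd \o h].
pose B : set (R * R -> R) := [set u | C u \/ u = jinv].
have CB : C `<=` B by move=> u; left.
have gC u : gen coords u -> gen C (u \o h).
  elim=> [k|b [->|->]|u' v' _ ? _ ?|u' v' _ ? _ ?].
  - exact: GenCst.
  - by apply: GenBase; left.
  - by apply: GenBase; right.
  - exact: GenAdd.
  - exact: GenMul.
have gCB u : gen C u -> gen B u.
  by elim=> *; [exact: GenCst|apply: GenBase; exact: CB|exact: GenAdd|exact: GenMul].
have d1 y i : W y -> is_derive (coordinate i y) 1 (slice i (fst \o h) y)
    ((qd2 q (h y) * (i == 0)%:R + (-1 * qd2 p (h y)) * (i == 1)%:R) * jinv y).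
  apply: (@slice_h fst (qd2 q) (fun y => -1 * qd2 p y)).
  - exact: gen_qd2.
  - by apply: GenMul; [exact: GenCst|exact: gen_qd2].
  - by move=> x z m /qval_solve[-> _]; rewrite mulN1r mulNr.
have d2 y i : W y -> is_derive (coordinate i y) 1 (slice i (snd \o h) y)
    (((-1 * qd1 q (h y)) * (i == 0)%:R + qd1 p (h y) * (i == 1)%:R) * jinv y).
  apply: (@slice_h snd (fun y => -1 * qd1 q y) (qd1 p)).
  - by apply: GenMul; [exact: GenCst|exact: gen_qd1].
  - exact: gen_qd1.
  - by move=> x z m /qval_solve[_ ->]; rewrite mulN1r mulNr [X in _ = X * _]addrC.
have regC b : C b -> regular_on W b.
  move=> [->|->] y Wy; split.
  - exact: ch1.
  - by move=> i; have [] := d1 y i Wy.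
  - exact: ch2.
  - by move=> i; have [] := d2 y i Wy.
have partC b i : C b -> exists2 v, gen B v & forall x, W x -> partial i b x = v x.
  have gj : gen B jinv by apply: GenBase; right.
  move=> [->|->].
  - exists (fun y => ((qd2 q \o h) y * (i == 0)%:R + (-1 * (qd2 p \o h) y) * (i == 1)%:R) * jinv y).
      apply: GenMul => //; apply: GenAdd; apply: GenMul; try exact: GenCst.
        by apply: gCB; apply: gC; exact: gen_qd2.
      by apply: GenMul; [exact: GenCst|apply: gCB; apply: gC; exact: gen_qd2].
    by move=> y Wy; apply: partial_is_derive; exact: d1.
  - exists (fun y => ((-1 * (qd1 q \o h) y) * (i == 0)%:R + (qd1 p \o h) y * (i == 1)%:R) * jinv y).
      apply: GenMul => //; apply: GenAdd; apply: GenMul; try exact: GenCst.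
        by apply: GenMul; [exact: GenCst|apply: gCB; apply: gC; exact: gen_qd1].
      by apply: gCB; apply: gC; exact: gen_qd1.
    by move=> y Wy; apply: partial_is_derive; exact: d2.
have Jh y : W y -> qjac p q (h y) != 0 by case=> x Vx <-; rewrite hP// J0.
have gJ := gC _ (gen_qjac p q).
have rJ := gen_regular regC gJ.
have dj y i : W y -> is_derive (coordinate i y) 1 (slice i jinv y)
    (- (jinv y * jinv y) * partial i (qjac p q \o h) y).
  move=> Wy; have [_ /(_ i)/is_derive_slice dJ] := rJ y Wy.
  have hV := @is_deriveV R (slice i (qjac p q \o h) y) (coordinate i y) _ 1 _ dJ.
  rewrite slice_coordinate in hV.
  have -> : slice i jinv y = (fun t => (slice i (qjac p q \o h) y t)^-1) by rewrite !sliceE.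
  apply: (is_derive_eq (hV (Jh y Wy))).
  by rewrite /GRing.scale/= /jinv -invfM -expr2.
have regB b : B b -> regular_on W b.
  move=> [/regC//|->] y Wy; split.
    by apply: continuousV; [exact: Jh|have [] := rJ y Wy].
  by move=> i; have [] := dj y i Wy.
have partB b i : B b -> exists2 v, gen B v & forall x, W x -> partial i b x = v x.
  move=> [/partC//|->].
  have [v gv hv] := gen_partial CB regC partC i gJ.
  exists (fun y => (-1 * (jinv y * jinv y)) * v y).
    have gj : gen B jinv by apply: GenBase; right.
    by apply: GenMul => //; apply: GenMul; [exact: GenCst|exact: GenMul].
  by move=> y Wy; rewrite -hv// mulN1r; apply: partial_is_derive; exact: dj.
move=> i; apply: (gen_smooth openW regB partB); apply: GenBase; left.
by case: (ord2P i) => ->; [left|right].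
Qed.

End LocalInverse.

(** Global injectivity makes every local inverse a restriction of the one global inverse, which is
    therefore smooth near each point of the image. *)
Lemma piecewise_quadratic_diffeo (R : realType) (U : set (R * R)) (g : R * R -> R * R) :
  open U -> (forall x y, U x -> U y -> g x = g y -> x = y) ->
  (forall x, U x -> exists p q : quadratic, qjac p q x != 0 /\
     \forall y \near x, g y = qmap p q y) ->
  diffeomorphism_onto_image U g.
Proof.
move=> oU ig lg.
have loc x : U x -> exists p q V, [/\ open V, V x, V `<=` U,
    forall y, V y -> g y = qmap p q y & forall y, V y -> qjac p q y != 0].
  move=> Ux; have [p [q [Jx gx]]] := lg x Ux.
  have nJ : \forall y \near x, qjac p q y != 0.
    have c := continuous_gen (gen_qjac p q) (x := x); exact: cvgr_neq0 c Jx.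
  have nU : \forall y \near x, U y by apply: open_nbhs_nbhs.
  have nA : nbhs x [set y | (g y = qmap p q y /\ qjac p q y != 0) /\ U y].
    by apply: filterI => //; exact: filterI.
  move: nA; rewrite nbhsE => -[V [oV Vx] hV].
  by exists p, q, V; split => // y /hV[[]].
have invV p q (V : set (R * R)) : V `<=` U -> (forall y, V y -> g y = qmap p q y) ->
  forall x y, V x -> V y -> qmap p q x = qmap p q y -> x = y.
  by move=> VU gV x y Vx Vy; rewrite -!gV//; apply: ig; exact: VU.
have imV p q (V : set (R * R)) : (forall y, V y -> g y = qmap p q y) -> qmap p q @` V = g @` V.
  by move=> gV; apply/seteqP; split => _ [x Vx <-]; exists x => //; rewrite gV.
split.
- move=> i; apply: smooth_on_local => x Ux.
  have [p [q [V [oV Vx VU gV _]]]] := loc x Ux.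
  exists V, (if i == 0 then qval p else qval q); split => //.
    by apply: smooth_onW (@subsetT _ _) _; case: (i == 0); exact: smooth_qval.
  by move=> y /gV ->; rewrite /coordinate; case: (i == 0).
- rewrite openE => _ [x Ux <-]; have [p [q [V [oV Vx VU gV JV]]]] := loc x Ux.
  have [oW _] := qmap_inverse oV JV (invV _ _ _ VU gV).
  apply: (@filterS _ _ _ (qmap p q @` V)).
    by rewrite (imV _ _ _ gV) => _ [y /VU Uy <-]; exists y.
  by apply: open_nbhs_nbhs; split => //; exists x => //; rewrite gV.
- pose h y := get [set x | U x /\ g x = y].
  have hP x : U x -> h (g x) = x.
    move=> Ux; rewrite /h; case: (getPex (P := [set z | U z /\ g z = g x])).
      by exists x.
    by move=> Uz e; exact: ig.
  exists h; split => // i; apply: smooth_on_local => _ [x Ux <-].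
  have [p [q [V [oV Vx VU gV JV]]]] := loc x Ux.
  have [oW [k [kP sk]]] := qmap_inverse oV JV (invV _ _ _ VU gV).
  exists (qmap p q @` V), (fun x => coordinate i (k x)); split => //.
    by exists x => //; rewrite gV.
  by move=> _ [y Vy <-]; rewrite kP// -gV// hP//; exact: VU.
Qed.

(** * Weak partial derivatives *)

Section PlaneMeasure.
Context {R : realType}.
Local Notation T2 := (measurableTypeR R * measurableTypeR R)%type.
Local Notation mu := (leb2 R).

Lemma ccell_close m (x y : R * R) : ccell m (cidx m x) y ->
  `|y.1 - x.1| <= mesh m /\ `|y.2 - x.2| <= mesh m.
Proof.
have := @cell_sub_ccell R m (cidx m x) x erefl.
rewrite /ccell; set c := cidx m x => -[/andP[a1 a2] /andP[a3 a4]] [/andP[b1 b2] /andP[b3 b4]].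
have h1 := @cell_side R m c.1; have h2 := @cell_side R m c.2.
by rewrite !ler_norml; split; apply/andP; split; lra.
Qed.

(** The union of the cells whose closure lies in [U]. It increases with [m] and exhausts an open
    [U], so open sets are measurable for the product sigma-algebra. *)
Definition inner (m : nat) (U : set (R * R)) : set (R * R) :=
  [set x | ccell m (cidx m x) `<=` U].

Lemma innerS m U : inner m U `<=` U.
Proof. by move=> x; apply; exact: cell_sub_ccell. Qed.

Lemma dyadic_inner m U : dyadic m (inner m U).
Proof. by move=> x y e; rewrite /inner/= e. Qed.

Lemma measurable_inner m U : measurable (inner m U : set T2).
Proof. exact: dyadic_measurable (@dyadic_inner m U). Qed.

Lemma didx_coarse m k (t : R) :
  (didx m t)%:~R * mesh m <= (didx (m + k) t)%:~R * (mesh (m + k) : R) /\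
  (didx (m + k) t + 1)%:~R * mesh (m + k) <= (didx m t + 1)%:~R * (mesh m : R).
Proof.
have mk := @mesh_gt0 R k; have m0 := @mesh_gt0 R m; have mmk := @mesh_gt0 R (m + k).
have E (i : int) : i%:~R * mesh m = (i * 2 ^+ k)%:~R * (mesh (m + k) : R).
  rewrite intrM rmorphXn /= meshD mulrACA -[LHS]mulr1; congr (_ * _).
  by rewrite /mesh mulfV// expf_neq0.
have T : t / mesh m * 2 ^+ k = t / mesh (m + k).
  by rewrite meshD invfM mulrA; congr (_ * _); rewrite /mesh invrK.
rewrite !E !ler_pM2r// !ler_int /didx; split.
  rewrite Num.Theory.floor_ge_int -T intrM rmorphXn /=.
  by rewrite ler_pM2r ?exprn_gt0// Num.Theory.floor_le.
rewrite lezD1 Num.Theory.floor_lt_int -T intrM rmorphXn /=.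
by rewrite ltr_pM2r ?exprn_gt0// Num.Theory.floorD1_gt.
Qed.

Lemma ccell_coarse m k (x : R * R) :
  @ccell R (m + k) (cidx (m + k) x) `<=` ccell m (cidx m x).
Proof.
move=> y; rewrite /ccell /cidx /= => -[/andP[a1 a2] /andP[a3 a4]].
have [b1 b2] := didx_coarse m k x.1; have [b3 b4] := didx_coarse m k x.2.
split; apply/andP; split; [exact: le_trans a1|exact: le_trans b2|exact: le_trans a3|exact: le_trans b4].
Qed.

Lemma inner_incr m U : inner m U `<=` inner m.+1 U.
Proof. by move=> x h y; rewrite -addn1 => /ccell_coarse /h. Qed.

Lemma bigcup_inner U : open U -> \bigcup_m inner m U = U.
Proof.
move=> oU; apply/seteqP; split=> [x [m _]|x Ux]; first exact: innerS.
have [e e0 he] := (open2P U).1 oU _ Ux.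
have [m _ /(_ m (leqnn _)) hm] := @cvgr_lt _ _ _ _ mesh _ (@mesh_cvg0 R) e e0.
exists m => // y /ccell_close[h1 h2]; apply: he; exact: le_lt_trans hm.
Qed.

Lemma open_measurable2 U : open U -> measurable (U : set T2).
Proof.
move=> /bigcup_inner <-; apply: bigcupT_measurable => m; exact: measurable_inner.
Qed.

Lemma compact_measurable2 K : compact K -> measurable (K : set T2).
Proof.
move=> cK; rewrite -(setCK K); apply: measurableC; apply: open_measurable2.
by apply: closed_openC; apply: compact_closed => //; exact: norm_hausdorff.
Qed.

Lemma compact_box K : compact K -> exists N, K `<=` @box R N.
Proof.
move=> /compact_bounded[M [_ hM]].
have [N hN] : exists N : nat, `|M| + 1 < N%:R.
  exists (Num.trunc (`|M| + 1)).+1; exact: Num.Theory.truncnS_gt.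
exists N => x Kx; have : `|x| <= `|M| + 1.
  by apply: hM => //; rewrite (le_lt_trans (ler_norm _))// ltrDl.
rewrite prod_normE/= ge_max => /andP[].
rewrite !ler_norml => /andP[a b] /andP[c d].
by split; rewrite /= in_itv/=; apply/andP; split; lra.
Qed.

Lemma compact_fin K : compact K -> (mu K < +oo)%E.
Proof.
move=> cK; have [N hN] := compact_box cK; apply: le_lt_trans (@leb2_box_fin R N).
by apply: le_measure; rewrite ?inE//; [exact: compact_measurable2|exact: measurable_box].
Qed.

Definition continuous_on (U : set (R * R)) (u : R * R -> R) :=
  forall x, U x -> {for x, continuous u}.

Lemma continuous_on_measurable (U : set (R * R)) u : open U -> continuous_on U u ->
  measurable_fun (U : set T2) u.
Proof.
move=> oU cu; apply: (measurability _ (RGenOInfty.measurableE R)).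
move=> _ [_ [a ->] <-].
have oA : open (U `&` [set x : R * R | a < u x]).
  rewrite openE => x [Ux /= ax]; apply: filterI; first exact: open_nbhs_nbhs.
  exact: cvgr_gt _ (cu _ Ux) _ ax.
rewrite (_ : _ `&` _ = U `&` [set x : R * R | a < u x]); first exact: open_measurable2.
by apply/seteqP; split => x [Ux]; rewrite /preimage/= in_itv/= andbT.
Qed.

Lemma compact_bound K u : compact K -> continuous_on K u ->
  exists2 M, 0 <= M & forall x, K x -> `|u x| <= M.
Proof.
move=> cK cu.
have cw : {within K, continuous u}.
  apply: continuous_in_subspaceT => x; rewrite inE; exact: cu.
have [M [_ hM]] := compact_bounded (continuous_compact cw cK).
exists (`|M| + 1); first by rewrite addr_ge0.
by move=> x Kx; apply: hM; [rewrite (le_lt_trans (ler_norm _))// ltrDl|exists x].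
Qed.

Lemma continuous_on_loc_integrable U u : open U -> continuous_on U u ->
  loc_integrable U u.
Proof.
move=> oU cu K cK KU; apply: measurable_bounded_integrable.
- exact: compact_measurable2.
- exact: compact_fin.
- apply: measurable_funS (continuous_on_measurable oU cu) => //.
  exact: open_measurable2.
have [M M0 hM] := compact_bound cK (fun x Kx => cu x (KU x Kx)).
by exists M; split; rewrite ?num_real// => t Mt x Kx /=; apply: le_trans (hM _ Kx) (ltW Mt).
Qed.

Lemma loc_integrable_measurable U (u : R * R -> R) : open U -> loc_integrable U u ->
  measurable_fun (U : set T2) u.
Proof.
move=> oU lu.
(* [loc_integrable] speaks of compact sets only, so [U] is covered by the countably many closed
   dyadic cells of all levels that it contains. *)
pose F n : set T2 := if (unpickle n : option (nat * (int * int))) is Some mc then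
  if `[< ccell mc.1 mc.2 `<=` U >] then ccell mc.1 mc.2 else set0 else set0.
have FU n : F n `<=` U.
  rewrite /F; case: unpickle => [mc|]; last exact: sub0set.
  by case: asboolP => // _; exact: sub0set.
have -> : U = \bigcup_n F n.
  apply/seteqP; split => [x|x [n _] /FU //].
  rewrite -{1}(bigcup_inner oU) => -[m _ ix].
  exists (pickle (m, cidx m x)); first exact: Logic.I.
  by rewrite /F pickleK /= asboolT//; exact: cell_sub_ccell.
have cF n : compact (F n).
  rewrite /F; case: unpickle => [mc|]; last exact: compact0.
  case: asboolP => _; last exact: compact0.
  by rewrite ccellE; exact: compact_crect.
apply/measurable_fun_bigcup => n; first exact: compact_measurable2.
by have /measurable_int/measurable_EFinP := lu _ (cF n) (FU n).
Qed.

Lemma Rintegral_vanish (D E : set T2) (F : T2 -> R) :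
  (forall x, D x -> ~ E x -> F x = 0) -> (forall x, E x -> ~ D x -> F x = 0) ->
  \int[mu]_(x in D) F x = \int[mu]_(x in E) F x.
Proof.
move=> h1 h2; rewrite /Rintegral integral_mkcond [in RHS]integral_mkcond; congr fine.
apply: eq_integral => x _; rewrite /patch.
case: ifPn; case: ifPn => //; rewrite ?inE ?notin_setE => hE hD.
  by rewrite h1.
by rewrite h2.
Qed.

Definition tsupp (phi : R * R -> R) := closure [set x | phi x != 0].

Lemma tsupp_out phi x : ~ tsupp phi x -> \forall y \near x, phi y = 0.
Proof.
move=> h; have : open (~` tsupp phi) by apply: closed_openC; exact: closed_closure.
move=> /open_near /(_ h); apply => y hy; apply/eqP; apply: contrapT => /negP py.
by apply: hy; exact: subset_closure.
Qed.

Lemma partials_cst0 w (x : R * R) : partials w (fun=> 0 : R) x = 0.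
Proof.
suff -> : partials w (fun=> 0 : R) = (fun=> 0 : R) by [].
elim: w => //= i w ->; apply/funext => y; apply: partial_is_derive.
exact: is_derive_slice_cst.
Qed.

Lemma partials_out w phi x : ~ tsupp phi x -> partials w phi x = 0.
Proof.
move=> /tsupp_out /(partials_near w) /nbhs_singleton ->; exact: partials_cst0.
Qed.

Lemma tsupp_partials w phi : tsupp (partials w phi) `<=` tsupp phi.
Proof.
rewrite /tsupp closureE => x; apply; split; first exact: closed_closure.
move=> y /=; apply: contraPP => /(partials_out w) ->; by rewrite eqxx.
Qed.

Lemma test_partials U w (phi : R * R -> R) : test_function U phi -> test_function U (partials w phi).
Proof.
move=> [sp cp sU]; have h := @tsupp_partials w phi; split.
- by elim: w {h} => [|i w ih]; [exact: sp|exact: (@smooth_on_partial R setT _ i ih)].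
- by apply: subclosed_compact cp h; exact: closed_closure.
- exact: subset_trans sU.
Qed.

Lemma test_continuous U (phi : R * R -> R) : test_function U phi -> continuous phi.
Proof. by move=> [sp _ _] x; have [] := sp [::] x Logic.I. Qed.

Lemma loc_integrableM U (u phi : R * R -> R) : open U -> loc_integrable U u -> test_function U phi ->
  mu.-integrable U (EFin \o (fun x => u x * phi x)).
Proof.
move=> oU lu tp; have [_ cK KU] := tp; have cp := test_continuous tp.
have mU := open_measurable2 oU; have mK := compact_measurable2 cK.
have mu' := loc_integrable_measurable oU lu.
have [M M0 hM] := compact_bound cK (fun x _ => cp x).
have mp : measurable_fun (U : set T2) phi 
  by apply: continuous_on_measurable => // x _; exact: cp.
apply/integrableP; split.
  by apply/measurable_EFinP; exact: measurable_funM.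
rewrite [X in (X < _)%E](_ : _ = \int[mu]_(x in tsupp phi) `|(u x * phi x)%:E|)%E; last first.
  rewrite integral_mkcond [in RHS]integral_mkcond; apply: eq_integral => x _; rewrite /patch.
  case: ifPn; case: ifPn => //; rewrite ?inE ?notin_setE => hE hD.
    have /= e := @partials_out [::] phi x hE; by rewrite /= e mulr0 ?abse0 ?normr0.
  by exfalso; apply: hD; exact: KU.
have lK := lu _ cK KU.
apply: (@le_lt_trans _ _ (\int[mu]_(x in tsupp phi) (M%:E * `|u x|%:E))%E).
  apply: ge0_le_integral => //.
  - apply/measurable_EFinP; apply: measurableT_comp => //; apply: measurable_funM.
      exact: measurable_funS mu'.
    exact: measurable_funS mp.
  - apply: emeasurable_funM => //; apply/measurable_EFinP; apply: measurableT_comp => //.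
    exact: measurable_funS mu'.
  - by move=> x Kx; rewrite -EFinM lee_fin normrM mulrC ler_wpM2r// hM.
rewrite ge0_integralZl//; last first.
  apply/measurable_EFinP; apply: measurableT_comp => //; exact: measurable_funS mu'.
by move/integrableP : lK => [_ h]; apply: lte_mul_pinfty => //; rewrite lee_fin.
Qed.

Lemma is_weak_partialB U w (u v u' v' : R * R -> R) : open U ->
  is_weak_partial U w u v -> is_weak_partial U w u' v' ->
  is_weak_partial U w (fun x => u x - u' x) (fun x => v x - v' x).
Proof.
move=> oU [lu lv h] [lu' lv' h'].
have lB a b : loc_integrable U a -> loc_integrable U b -> loc_integrable U (fun x => a x - b x).
  move=> la lb K cK KU; have mK := compact_measurable2 cK.
  exact: (integrableB mK (la K cK KU) (lb K cK KU)).
split; [exact: lB|exact: lB|move=> phi tp].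
have tw := test_partials w tp; have mU := open_measurable2 oU.
transitivity (\int[mu]_(x in U) (u x * partials w phi x) - \int[mu]_(x in U) (u' x * partials w phi x)).
  rewrite -RintegralB//; try exact: loc_integrableM.
  by congr Rintegral; apply/funext => x; rewrite mulrBl.
rewrite h// h'// -mulrBr; congr (_ * _).
rewrite -RintegralB//; try exact: loc_integrableM.
by congr Rintegral; apply/funext => x; rewrite mulrBl.
Qed.

(** A test function on [V] is one on [U], and all integrands vanish off its support, so the
    integrals over [U] and over [V] coincide. *)
Lemma is_weak_partialS (U V : set (R * R)) w u v : V `<=` U ->
  is_weak_partial U w u v -> is_weak_partial V w u v.
Proof.
move=> VU [lu lv h]; split=> [K cK KV|K cK KV|phi [sp cp sV]].
- by apply: lu => //; exact: subset_trans VU.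
- by apply: lv => //; exact: subset_trans VU.
have tU : test_function U phi by split => //; exact: subset_trans VU.
have out x : U x -> ~ V x -> ~ tsupp phi x by move=> _ nV /sV.
have e1 := h phi tU.
rewrite (@Rintegral_vanish V U); first last.
- by move=> x Ux nV; rewrite partials_out ?mulr0//; exact: out.
- by move=> x /VU.
rewrite e1; congr (_ * _); apply: Rintegral_vanish; last by move=> x /VU.
by move=> x Ux nV; have := @partials_out [::] phi x (out x Ux nV) => /= ->; rewrite mulr0.
Qed.

End PlaneMeasure.

(** * Integration by parts in the plane *)

Section IntegrationByParts.
Context {R : realType}.
Local Notation T2 := (measurableTypeR R * measurableTypeR R)%type.
Local Notation mu := (leb2 R).

Lemma is_derive_continuous (f df : R -> R) : (forall x : R, is_derive x 1 f (df x)) ->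
  continuous f.
Proof.
by move=> h x; apply/differentiable_continuous/derivable1_diffP; have [] := h x.
Qed.

Lemma FTC2_continuous (f df : R -> R) (a b : R) : a < b ->
  (forall x : R, is_derive x 1 f (df x)) -> continuous df ->
  (\int[lebesgue_measure]_(x in `[a, b]) (df x)%:E = (f b - f a)%:E)%E.
Proof.
move=> ab hf cdf; have cf := is_derive_continuous hf.
rewrite (@continuous_FTC2 _ df f a b ab)//.
- exact: continuous_subspaceT.
- split; [by move=> x _; have [] := hf x|apply: cvg_at_right_filter; exact: cf|apply: cvg_at_left_filter; exact: cf].
- by move=> x _; rewrite derive1E; have [] := hf x.
Qed.

Lemma integral_derive_compact (f df : R -> R) (M : R) : 0 < M ->
  (forall x : R, is_derive x 1 f (df x)) -> continuous df ->
  (forall x, M <= `|x| -> f x = 0) -> (forall x, M <= `|x| -> df x = 0) ->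
  (\int[lebesgue_measure]_x (df x)%:E = 0)%E.
Proof.
move=> M0 hf cdf f0 df0.
have -> : (\int[lebesgue_measure]_x (df x)%:E =
    \int[lebesgue_measure]_(x in `[(- M)%R, M]) (df x)%:E)%E.
  rewrite [RHS]integral_mkcond; apply: eq_integral => x _; rewrite /patch.
  case: ifPn => //; rewrite notin_setE /= in_itv/= => h.
  rewrite df0// leNgt; apply/negP; rewrite ltr_norml => /andP[? ?].
  by apply: h; apply/andP; split; exact: ltW.
rewrite (FTC2_continuous _ hf)//; last by lra.
by rewrite !f0 ?normrN ?ger0_norm ?subrr// ltW.
Qed.

Lemma continuous_pairl (y : R) : continuous (fun t : R => (t, y)).
Proof.
move=> x; have c1 : {for x, continuous (fun t : R => t)} := cvg_id.
have c2 : {for x, continuous (fun t : R => y)} := @cst_continuous R R y x.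
exact: (cvg_pair c1 c2).
Qed.

Lemma continuous_pairr (y : R) : continuous (fun t : R => (y, t)).
Proof.
move=> x; have c1 : {for x, continuous (fun t : R => t)} := cvg_id.
have c2 : {for x, continuous (fun t : R => y)} := @cst_continuous R R y x.
exact: (cvg_pair c2 c1).
Qed.

(** By Fubini, integrating first in the direction [i]: each inner integral is that of the derivative
    of a compactly supported function of one variable. *)
Lemma integral_partial_compact (psi : R * R -> R) i :
  regular_on setT psi -> continuous (partial i psi) -> compact (tsupp psi) ->
  \int[mu]_x (partial i psi x) = 0.
Proof.
move=> rp cp cK; have [N hN] := compact_box cK.
have mK := compact_measurable2 cK.
have out w x : ~ box N x -> partials w psi x = 0.
  by move=> nx; apply: partials_out => /hN.
have iT : mu.-integrable (setT : set T2) (EFin \o partial i psi).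
  have -> : EFin \o partial i psi = (EFin \o partial i psi) \_ (tsupp psi).
    apply/funext => x; rewrite /patch; case: ifPn => //; rewrite notin_setE => h /=.
    by have /= -> := @partials_out _ [:: i] psi x h.
  apply/(integrable_mkcond _ mK).
  by apply: (continuous_on_loc_integrable openT) => // x _; exact: cp.
have M0 : 0 < N%:R + 1 :> R by rewrite ltr_wpDl.
have nb1 (t s : R) : N%:R + 1 <= `|t| -> ~ box N (t, s) /\ ~ box N (s, t).
  move=> ht; suff h : ~ (- N%:R <= t < N%:R) by split => -[]; rewrite /= !in_itv/=.
  move=> /andP[a b]; move: ht; rewrite leNgt => /negP; apply.
  by rewrite ltr_norml; apply/andP; split; lra.
have dT x j : is_derive (coordinate j x) 1 (slice j psi x) (partial j psi x).
  by apply: is_derive_slice; have [_ ] := rp x Logic.I.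
rewrite /Rintegral; case: (ord2P i) iT cp => -> iT cp.
  rewrite -[X in fine X](integral21_prod_meas1 iT) integral0_eq// => y _.
  apply: (@integral_derive_compact (fun t => psi (t, y)) _ _ M0) => [x||x|x].
  - exact: (dT (x, y) 0).
  - move=> x; apply: (@continuous_comp _ _ _ (fun t => (t, y)) (partial 0 psi)); last exact: cp.
    exact: continuous_pairl.
  - by move=> /(nb1 _ y)[h _]; have /= -> := out [::] _ h.
  - by move=> /(nb1 _ y)[h _]; have /= -> := out [:: 0] _ h.
rewrite -[X in fine X](integral12_prod_meas1 iT) integral0_eq// => y _.
apply: (@integral_derive_compact (fun t => psi (y, t)) _ _ M0) => [x||x|x].
- exact: (dT (y, x) 1).
- move=> x; apply: (@continuous_comp _ _ _ (fun t => (y, t)) (partial 1 psi)); last exact: cp.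
  exact: continuous_pairr.
- by move=> /(nb1 _ y)[_ h]; have /= -> := out [::] _ h.
- by move=> /(nb1 _ y)[_ h]; have /= -> := out [:: 1] _ h.
Qed.

Lemma integration_by_parts2 U (u phi : R * R -> R) i : open U -> regular_on U u ->
  continuous_on U (partial i u) -> test_function U phi ->
  \int[mu]_(x in U) (u x * partial i phi x) = - \int[mu]_(x in U) (partial i u x * phi x).
Proof.
move=> oU ru cu tp; have [sp cK KU] := tp; have mU := open_measurable2 oU.
have cpi := test_continuous (test_partials [:: i] tp).
(* The extension of u phi by 0 is regular on the whole plane, because every point lies in [U] or in
   the open complement of the support of [phi]. *)
pose psi x := if x \in U then u x * phi x else 0.
have psiU x : U x -> \forall y \near x, u y * phi y = psi y.
  by move=> Ux; apply: open_near Ux _ => // y Uy; rewrite /psi ifT// inE.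
have psiK x : ~ tsupp phi x -> \forall y \near x, 0 = psi y.
  move=> /tsupp_out; apply: filterS => y py.
  by rewrite /psi py mulr0; case: ifP.
have rU : regular_on U (fun x => u x * phi x).
  apply: (regularM ru); apply: smooth_on_regular; exact: smooth_onW sp.
have rpsi : regular_on setT psi.
  move=> x _; have [Ux|nU] := pselect (U x).
    have [c d] := rU x Ux; split; first exact: continuous_near (psiU _ Ux) c.
    by move=> j; exact: derivable_slice_near (psiU _ Ux) (d j).
  have nK : ~ tsupp phi x by move=> /KU.
  split; first by apply: continuous_near (psiK _ nK) _; exact: cst_continuous.
  move=> j; apply: derivable_slice_near (psiK _ nK) _.
  by have [] := is_derive_slice_cst j x (0 : R).
have dU x : U x -> partial i psi x = u x * partial i phi x + partial i u x * phi x.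
  move=> Ux; rewrite -(partial_near i (psiU _ Ux)); apply: partial_is_derive.
  rewrite addrC; apply: is_derive_slice_mul; first by have [_] := ru x Ux.
  by have [_] := smooth_on_regular sp (x := x) Logic.I.
have dK x : ~ tsupp phi x -> partial i psi x = 0.
  move=> nK; rewrite -(partial_near i (psiK _ nK)); apply: partial_is_derive.
  exact: is_derive_slice_cst.
have sK : tsupp psi `<=` tsupp phi.
  rewrite {1}/tsupp closureE => x; apply; split; first exact: closed_closure.
  move=> y /=; apply: contraPP => /psiK /nbhs_singleton <-; by rewrite eqxx.
have cpsi : continuous (partial i psi).
  move=> x; have [Ux|nU] := pselect (U x).
    apply: (@continuous_near _ (fun x => u x * partial i phi x + partial i u x * phi x)).
      by apply: open_near Ux _ => // y Uy; rewrite dU.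
    have [c _] := ru x Ux; apply: cvgD; apply: cvgM => //.
    - exact: cpi.
    - exact: cu.
    - exact: (test_continuous tp).
  have nK : ~ tsupp phi x by move=> /KU.
  apply: (@continuous_near _ (fun=> 0)); last exact: cst_continuous.
  have : \forall y \near x, ~ tsupp phi y.
    have oK : open (~` tsupp phi) by apply: closed_openC; exact: closed_closure.
    exact: open_nbhs_nbhs.
  by apply: filterS => y /dK.
have cKpsi : compact (tsupp psi) by apply: subclosed_compact cK sK; exact: closed_closure.
have I0 := integral_partial_compact rpsi cpsi cKpsi.
have iu : loc_integrable U u by apply: continuous_on_loc_integrable => // x /ru[].
have idu : loc_integrable U (partial i u) by exact: continuous_on_loc_integrable.
apply/eqP; rewrite -addr_eq0; apply/eqP.
rewrite -RintegralD//; last 2 first.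
  exact: (loc_integrableM oU iu (test_partials [:: i] tp)).
  exact: (loc_integrableM oU idu tp).
rewrite -[RHS]I0 (@Rintegral_vanish R setT U (partial i psi)); last 2 first.
- by move=> x _ nU; apply: dK => /KU.
- by move=> x _ [].
by apply: eq_Rintegral => x; rewrite inE => Ux; rewrite dU.
Qed.

(** Integration by parts takes the outermost derivative off [phi] first, so this one becomes the
    innermost derivative of [u]; hence the reversed word. *)
Lemma smooth_weak_partial U w (u : R * R -> R) : open U -> smooth_on U u ->
  is_weak_partial U w u (partials (rev w) u).
Proof.
move=> oU su.
have cw v (w' : seq 'I_2) : smooth_on U v -> continuous_on U (partials w' v).
  by move=> sv x Ux; have [] := sv w' x Ux.
split; try (apply: continuous_on_loc_integrable => //; exact: cw).
  by have := cw u [::] su; exact: continuous_on_loc_integrable.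
move=> phi tp; elim: w u su => [|i w ih] u su.
  by rewrite expr0 mul1r.
rewrite [partials (i :: w) phi]/= integration_by_parts2//; first last.
- exact: test_partials.
- exact: (cw u [:: i]).
- exact: smooth_on_regular.
rewrite ih; last exact: smooth_on_partial.
by rewrite /= exprS mulN1r mulNr rev_cons /partials foldr_rcons.
Qed.

End IntegrationByParts.

(** * The fundamental lemma and uniqueness of weak derivatives *)

Section WeakPartials.
Context {R : realType}.
Local Notation T2 := (measurableTypeR R * measurableTypeR R)%type.
Local Notation mu := (leb2 R).

Lemma ae_mono (P Q : T2 -> Prop) : {ae mu, forall x, P x} ->
  (forall x, P x -> Q x) -> {ae mu, forall x, Q x}.
Proof.
by move=> [A [mA A0 PA]] PQ; exists A; split=> // x h; apply: PA => /PQ.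
Qed.

Definition orect (a1 b1 a2 b2 : R) : set (R * R) := `]a1, b1[%classic `*` `]a2, b2[%classic.

Lemma crectP a1 b1 a2 b2 (x : R * R) : crect a1 b1 a2 b2 x <->
  (a1 <= x.1 <= b1 /\ a2 <= x.2 <= b2).
Proof. by rewrite /crect /= !in_itv. Qed.

Lemma leb2_crect_orect (a1 b1 a2 b2 : R) : a1 < b1 -> a2 < b2 ->
  mu (crect a1 b1 a2 b2 `\` orect a1 b1 a2 b2) = 0%E.
Proof.
move=> h1 h2; have h1' := ltW h1; have h2' := ltW h2.
have sub : orect a1 b1 a2 b2 `<=` crect a1 b1 a2 b2.
  by move=> x []; rewrite /= !in_itv/= => /andP[/ltW a /ltW b] /andP[/ltW c /ltW d];
     apply/crectP; split; apply/andP.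
rewrite measureD; try exact: measurable_itv2.
  rewrite setIidr//.
  rewrite [X in (X - _)%E](@leb2_itv2 R a1 b1 a2 b2)// [X in (_ - X)%E](@leb2_itv2 R a1 b1 a2 b2)//.
  by rewrite -EFinB subrr.
by rewrite [X in (X < _)%E](@leb2_itv2 R a1 b1 a2 b2)// ltry.
Qed.

(** Smooth functions between 0 and 1 converging to the indicator of the open interval. The
    denominator n + 2 keeps each ramp within half of the interval, so that the two ramps do not
    overlap. *)
Definition bump (a b : R) (n : nat) (x : R) : R :=
  stepi a (a + (b - a) / (n.+2)%:R) x - stepi (b - (b - a) / n.+2%:R) b x.

Lemma flat_gen_sub (f g : R -> R) : flat_gen f -> flat_gen g -> flat_gen (fun x => f x - g x).
Proof.
move=> hf hg; have -> : (fun x => f x - g x) = (fun x => f x + (-1) * g x).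
  by apply/funext => x; rewrite mulN1r.
by apply: FlatAdd => //; apply: FlatMul => //; exact: FlatCst.
Qed.

Lemma bump_gap (a b : R) n : a < b -> 0 < (b - a) / n.+2%:R /\ (b - a) / n.+2%:R <= (b - a) / 2.
Proof.
move=> ab; have ba : 0 < b - a by rewrite subr_gt0.
by split; [rewrite divr_gt0|rewrite ler_pM2l// lef_pV2 ?posrE// ler_nat].
Qed.

Lemma bump_out (a b : R) n x : a < b -> (x <= a) || (b <= x) -> bump a b n x = 0.
Proof.
move=> ab; have [h1 h2] := bump_gap n ab; rewrite /bump.
move: h1 h2; move: (_ / _) => d d0 d2 /orP[xa|bx].
  by rewrite !stepi_le ?subrr//; lra.
by rewrite !stepi_ge ?subrr//; lra.
Qed.

Lemma stepi01 (p q x : R) : 0 <= stepi p q x <= 1.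
Proof. by rewrite /stepi step_ge0 step_le1. Qed.

Lemma bump_le1 (a b : R) n x : `|bump a b n x| <= 1.
Proof.
rewrite /bump ler_norml.
have /andP[h1 h2] := stepi01 a (a + (b - a) / (n.+2)%:R) x.
have /andP[h3 h4] := stepi01 (b - (b - a) / n.+2%:R) b x.
by apply/andP; split; lra.
Qed.

Lemma bump_near (a b x : R) : a < x < b -> \forall n \near \oo, bump a b n x = 1.
Proof.
move=> /andP[ax xb]; have ab := lt_trans ax xb.
have ba : 0 < b - a by rewrite subr_gt0.
pose e := Num.min (x - a) (b - x).
have e0 : 0 < e by rewrite lt_min !subr_gt0 ax.
near=> n.
have hn : (b - a) / n.+2%:R <= e.
  rewrite ler_pdivrMr// mulrC -ler_pdivrMr//.
  have : (b - a) / e <= n%:R by near: n; exact: nbhs_infty_ger.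
  by move=> /le_trans; apply; rewrite ler_nat; exact: leqW (leqnSn n).
have [d0 d2] := bump_gap n ab.
move: hn; rewrite /e le_min => /andP[]; rewrite /bump.
move: (_ / n.+2%:R) d0 d2 => d d0 d2 h1 h2.
by rewrite stepi_ge ?stepi_le ?subr0//; lra.
Unshelve. all: by end_near. Qed.

(** Products of bumps are test functions bounded by 1 that converge to the indicator of the
    rectangle; dominated convergence with majorant |d| on the closed rectangle concludes. *)
Lemma integral_orect0 U (d : R * R -> R) a1 b1 a2 b2 : open U ->
  loc_integrable U d ->
  (forall a b, flat_gen a -> flat_gen b -> test_function U (tens a b) ->
     \int[mu]_(x in U) (d x * tens a b x) = 0) ->
  a1 < b1 -> a2 < b2 -> crect a1 b1 a2 b2 `<=` U ->
  (\int[mu]_(x in orect a1 b1 a2 b2) (d x)%:E = 0)%E.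
Proof.
move=> oU ld h0 h1 h2 SU; set S := crect a1 b1 a2 b2.
have mS : measurable (S : set T2) := measurable_itv2 _ _.
have cS : compact S := @compact_crect _ a1 b1 a2 b2.
have iS := ld _ cS SU.
pose phi n := tens (bump a1 b1 n) (bump a2 b2 n).
have tphi n : test_function U (phi n).
  apply: (@test_tens _ U _ _ a1 b1 a2 b2) => //.
  - by apply: flat_gen_sub; exact: flat_gen_stepi.
  - by apply: flat_gen_sub; exact: flat_gen_stepi.
  - by move=> x; exact: bump_out.
  - by move=> x; exact: bump_out.
have phi0 n x : ~ orect a1 b1 a2 b2 x -> phi n x = 0.
  move=> nx; rewrite /phi /tens.
  case: (boolP ((x.1 <= a1) || (b1 <= x.1))) => [z1|]; first by rewrite bump_out// mul0r.
  case: (boolP ((x.2 <= a2) || (b2 <= x.2))) => [z2 _|]; first by rewrite [X in _ * X]bump_out// mulr0.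
  rewrite !negb_or -!ltNge => /andP[? ?] /andP[? ?].
  by exfalso; apply: nx; split; rewrite /= in_itv/=; apply/andP.
pose l x := if x \in orect a1 b1 a2 b2 then d x else 0.
have mor : measurable (orect a1 b1 a2 b2 : set T2) := measurable_itv2 _ _.
have sub : orect a1 b1 a2 b2 `<=` S.
  by move=> x []; rewrite /= !in_itv/= => /andP[/ltW a /ltW b] /andP[/ltW c /ltW e];
     apply/crectP; split; apply/andP.
have md : measurable_fun (S : set T2) d by move/measurable_int/measurable_EFinP : iS.
have := @dominated_convergence _ _ _ mu S mS (fun n x => (d x * phi n x)%:E) (fun x => (l x)%:E)
   (fun x => `|d x|%:E).
case.
- move=> n; apply/measurable_EFinP; apply: measurable_funM => //.
  have cphi : continuous_on setT (phi n) by move=> x _; exact: (test_continuous (tphi n)).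
  exact: measurable_funS (continuous_on_measurable openT cphi).
- have -> : (fun x => (l x)%:E) = (EFin \o d) \_ (orect a1 b1 a2 b2).
    by apply/funext => x; rewrite /l /patch; case: ifP.
  apply/(measurable_restrict _ mor mS).
  by apply: measurable_funS (measurable_int _ iS) => //; exact: subIsetl.
- apply/aeW => x Sx; rewrite /l; case: ifPn => [|]; rewrite ?inE ?notin_setE => ox.
    apply: cvg_near_cst; case: ox; rewrite /= !in_itv/= => o1 o2.
    near=> n; rewrite /phi /tens.
    have -> : bump a1 b1 n x.1 = 1 by near: n; exact: bump_near.
    have -> : bump a2 b2 n x.2 = 1 by near: n; exact: bump_near.
    by rewrite !mulr1.
  by apply: cvg_near_cst; near=> n; rewrite phi0// mulr0.
- exact: (integrable_norm iS).
- apply/aeW => x n Sx; rewrite abse_EFin lee_fin normrM ler_piMr//.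
  by rewrite /phi /tens normrM mulr_ile1// bump_le1.
move=> _ _; rewrite (_ : [sequence _]_n = (fun=> 0%E)); last first.
  apply/funext => n /=; have iu := loc_integrableM oU ld (tphi n).
  have := h0 _ _ (flat_gen_sub (flat_gen_stepi _ _) (flat_gen_stepi _ _))
    (flat_gen_sub (flat_gen_stepi _ _) (flat_gen_stepi _ _)) (tphi n).
  rewrite (@Rintegral_vanish R U S) /Rintegral; first last.
  - by move=> x /SU.
  - by move=> x _ nS; rewrite -/(phi n x) phi0 ?mulr0//; apply: contra_not nS; exact: sub.
  move=> e; have fn : (\int[mu]_(x in S) (d x * phi n x)%:E)%E \is a fin_num.
    have iu' : mu.-integrable (U : set T2) (fun x => (d x * phi n x)%:E) := iu.
    have iS2 := integrableS (open_measurable2 oU) mS SU iu'.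
    exact: (integrable_fin_num mS iS2).
  transitivity (\int[mu]_(x in S) (d x * phi n x)%:E)%E; first by [].
  by rewrite -(fineK fn); congr EFin; exact: e.
move=> hl; have -> : (\int[mu]_(x in orect a1 b1 a2 b2) (d x)%:E = \int[mu]_(x in S) (l x)%:E)%E.
  rewrite -(setIidr sub) integral_mkcondr; apply: eq_integral => x _.
  by rewrite /patch /l; case: ifP.
by rewrite -(cvg_lim (@ereal_hausdorff R) hl) lim_cst//; exact: ereal_hausdorff.
Unshelve. all: by end_near. Qed.

Lemma cell_orect m c : let o := orect (c.1%:~R * mesh m) ((c.1 + 1)%:~R * mesh m)
   (c.2%:~R * mesh m) ((c.2 + 1)%:~R * mesh m) in
  [/\ @ccell R m c = crect (c.1%:~R * mesh m) ((c.1 + 1)%:~R * mesh m)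
   (c.2%:~R * mesh m) ((c.2 + 1)%:~R * mesh m), o `<=` cell m c & mu (cell m c `\` o) = 0%E].
Proof.
move=> o; split; first exact: ccellE.
  rewrite cellE => x [/=]; rewrite !in_itv/= => /andP[/ltW a b] /andP[/ltW e d].
  by split; apply/andP.
apply/eqP; rewrite -measure_le0.
have side (i : int) : i%:~R * mesh m < (i + 1)%:~R * mesh m :> R.
  by rewrite -subr_gt0 cell_side mesh_gt0.
rewrite -(leb2_crect_orect (side c.1) (side c.2)); apply: le_measure; rewrite ?inE.
- by apply: measurableD; [exact: measurable_cell|exact: measurable_itv2].
- by apply: measurableD; exact: measurable_itv2.
- by move=> x [/cell_sub_ccell]; rewrite ccellE.
Qed.

Lemma integral_cell0 U (d : R * R -> R) m c : open U -> loc_integrable U d ->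
  (forall a b, flat_gen a -> flat_gen b -> test_function U (tens a b) ->
     \int[mu]_(x in U) (d x * tens a b x) = 0) ->
  ccell m c `<=` U -> (\int[mu]_(x in cell m c) (d x)%:E = 0)%E.
Proof.
move=> oU ld h0 cU; have [e1 e2 e3] := cell_orect m c.
have side (i : int) : i%:~R * mesh m < (i + 1)%:~R * mesh m :> R.
  by rewrite -subr_gt0 cell_side mesh_gt0.
have mc := @measurable_cell R m c.
set o := orect _ _ _ _ in e2 e3.
have mo : measurable (o : set T2) := measurable_itv2 _ _.
have ic : mu.-integrable (cell m c : set T2) (EFin \o d).
  have ck : compact (@ccell R m c) by rewrite ccellE; exact: compact_crect.
  apply: integrableS (ld _ ck cU) => //; first exact: measurable_ccell.
  exact: cell_sub_ccell.
rewrite (negligible_integral _ mc ic e3); last exact: measurableD.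
rewrite setDD setIidr//; by apply: (integral_orect0 oU ld h0) => //; rewrite -e1.
Qed.

(** The fundamental lemma of the calculus of variations, tested on products only. All integrals over
    interior cells vanish, hence so do the dyadic means, and their convergence in L^1 forces d = 0
    almost everywhere. *)
Lemma weak_partial_test0 U (d : R * R -> R) : open U -> loc_integrable U d ->
  (forall a b, flat_gen a -> flat_gen b -> test_function U (tens a b) ->
     \int[mu]_(x in U) (d x * tens a b x) = 0) ->
  {ae mu, forall x, U x -> d x = 0}.
Proof.
move=> oU ld h0.
have loc l c : ccell l c `<=` U -> {ae mu, forall x, cell l c x -> d x = 0}.
  move=> cU; have mc := @measurable_cell R l c.
  have ic : mu.-integrable (cell l c : set T2) (EFin \o d).
    have ck : compact (@ccell R l c) by rewrite ccellE; exact: compact_crect.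
    apply: integrableS (ld _ ck cU) => //; first exact: measurable_ccell.
    exact: cell_sub_ccell.
  pose h := d \_ (cell l c).
  have hL1 : L1 h.
    rewrite /L1 (_ : EFin \o h = (EFin \o d) \_ (cell l c)); first exact/(integrable_mkcond _ mc).
    by apply/funext => x; rewrite /h /patch /=; case: ifP.
  (* Cut off to a cell of level [l], [d] becomes integrable on the plane. Cells of level at least
     [l] lie inside that cell, where [integral_cell0] applies, or are disjoint from it, where [h] is
     0. *)
  have Eh m x : (l <= m)%N -> dproj m h x = 0.
    move=> lm; rewrite /dproj /dmean /Rintegral; set c' := cidx m x.
    have [xc|nxc] := pselect (cell l c x).
      rewrite (_ : (\int[mu]_(y in _) _)%E = 0%E) ?mulr0//.
      have cc : @cell R m c' `<=` cell l c.
        move=> y; rewrite /cell/= -xc => yc; apply: (@cidx_coarse R l (m - l)).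
        by rewrite subnKC.
      rewrite -[RHS](@integral_cell0 U d m c' oU ld h0).
        by apply: eq_integral => y; rewrite inE => /cc yc; rewrite /h /patch ifT// inE.
      have hc := @ccell_coarse R l (m - l) x; rewrite subnKC// xc in hc.
      exact: subset_trans cU.
    rewrite integral0_eq ?mulr0// => y yc; rewrite /h /patch ifF//.
    apply/negP; rewrite inE => yl; apply: nxc; rewrite /cell/= -yl.
    by apply: (@cidx_coarse R l (m - l)); rewrite subnKC// yc.
  have I0 : (\int[mu]_x `|h x|%:E = 0)%E.
    apply/eqP; rewrite eq_le; apply/andP; split; last exact: integral_ge0.
    apply/lee_addgt0Pr => e e0; rewrite add0e.
    have [m0 hm0] := dproj_cvg hL1 e0.
    have := hm0 (maxn m0 l) (leq_maxl _ _).
    rewrite (_ : (fun x => `|h x - dproj _ h x|%:E) = (fun x => `|h x|%:E)); first exact: ltW.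
    by apply/funext => x; rewrite Eh ?leq_maxr// subr0.
  have mh := L1_measurable hL1.
  have /(ae_eq_integral_abs mu measurableT (measurable_int _ hL1)).1 : (\int[mu]_x `|(EFin \o h) x| = 0)%E.
    by rewrite -[RHS]I0; apply: eq_integral => x _.
  apply: filterS => x /(_ Logic.I) /= [hx] cx.
  by move: hx; rewrite /h /patch ifT// inE.
pose P (n : nat) (x : T2) : Prop := if (unpickle n : option (nat * (int * int))) is Some mc then
  ccell mc.1 mc.2 `<=` U -> cell mc.1 mc.2 x -> d x = 0 else True.
have : {ae mu, forall x, forall n, P n x}.
  apply: ae_foralln => n; rewrite /P; case: unpickle => [[m c]|]; last exact: aeW.
  have [cU|ncU] := pselect (ccell m c `<=` U).
    by apply: ae_mono (loc m c cU) _ => x h _.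
  by apply: aeW => x /ncU.
apply: filterS => x hx; rewrite -{1}(bigcup_inner oU) => -[m _ ix].
by have := hx (pickle (m, cidx m x)); rewrite /P pickleK; apply.
Qed.

(** The difference of the two candidates is a weak derivative of u - u, so its integral against
    every test function is 0. *)
Lemma weak_partial_unique U w (u v v' : R * R -> R) : open U ->
  is_weak_partial U w u v -> is_weak_partial U w u v' ->
  {ae mu, forall x, U x -> v x = v' x}.
Proof.
move=> oU hv hv'; have [_ lvv h] := is_weak_partialB oU hv hv'.
have ae0 : {ae mu, forall x, U x -> v x - v' x = 0}.
  apply: (weak_partial_test0 oU lvv) => a b _ _ tp.
  have := h _ tp; rewrite (_ : \int[mu]_(x in U) ((u x - u x) * _) = 0).
    by move/esym/eqP; rewrite mulf_eq0 signr_eq0 => /eqP.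
  by rewrite /Rintegral integral0_eq// => x _; rewrite subrr mul0r.
by apply: ae_mono ae0 _ => x hx /hx /subr0_eq.
Qed.

End WeakPartials.

(** * Uniform estimate by the mixed derivative *)

Section SupEstimate.
Context {R : realType}.
Local Notation T2 := (measurableTypeR R * measurableTypeR R)%type.
Local Notation mu := (leb2 R).

(** The constant [M] bounds the derivative of the unit step and is the same for all intervals;
    rescaling contributes the factor 1 / (q - p). This provides kernels of integral 1 with a
    scale-invariant bound. *)
Lemma stepi_derive : exists2 M : R, 0 < M & forall p q : R, p < q ->
  exists a : R -> R, [/\ flat_gen a, forall x : R, is_derive x 1 (stepi p q) (a x),
    forall x, `|a x| <= M / (q - p) & forall x, (x <= p) || (q <= x) -> a x = 0].
Proof.
have [ds [M [gds M0 hds bds zds]]] := @step_derive R.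
exists M => // p q pq; have qp : 0 < q - p by rewrite subr_gt0.
have [a ga ha] := flat_gen_derive (flat_gen_stepi p q).
have aE x : a x = ds ((x - p) / (q - p)) * (q - p)^-1.
  have h : is_derive x 1 (stepi p q) (ds ((x - p) / (q - p)) * (q - p)^-1).
    have -> : stepi p q = step \o (fun x => (q - p)^-1 * x + (- (p / (q - p)))).
      by apply/funext => y /=; rewrite /stepi mulrBl [y / _]mulrC.
    apply: is_derive1_comp (is_derive_affine _ _ _).
    have -> : (q - p)^-1 * x + - (p / (q - p)) = (x - p) / (q - p) by rewrite mulrBl [x / _]mulrC.
    exact: hds.
  by have [_ <-] := ha x; have [_ <-] := h.
exists a; split => // x.
  by rewrite aE normrM (ger0_norm (_ : 0 <= (q - p)^-1)) ?invr_ge0 ?(ltW qp)// ler_wpM2r// invr_ge0 ltW.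
move=> h; rewrite aE zds ?mul0r//; case/orP: h => h; apply/orP; [left|right].
  by rewrite mulr_le0_ge0 ?subr_le0// invr_ge0 ltW.
by rewrite ler_pdivlMr// mul1r lerD2r.
Qed.

Lemma stepi_sub_out (a b p q x : R) : a < b -> p < q -> a <= p -> q <= b ->
  (x <= a) || (b <= x) -> stepi p q x - stepi a b x = 0.
Proof.
move=> ab pq ap qb /orP[xa|bx]; first by rewrite !stepi_le ?subrr// (le_trans xa).
by rewrite !stepi_ge ?subrr// (le_trans qb).
Qed.

Lemma stepi_sub_le1 (a b p q x : R) : `|stepi p q x - stepi a b x| <= 1.
Proof.
have /andP[h1 h2] := stepi01 p q x; have /andP[h3 h4] := stepi01 a b x.
by rewrite ler_norml; apply/andP; split; lra.
Qed.

Lemma integral_tens1 (p1 q1 p2 q2 : R) (a b : R -> R) : p1 < q1 -> p2 < q2 ->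
  flat_gen a -> flat_gen b ->
  (forall x : R, is_derive x 1 (stepi p1 q1) (a x)) -> (forall x : R, is_derive x 1 (stepi p2 q2) (b x)) ->
  (forall x, (x <= p1) || (q1 <= x) -> a x = 0) ->
  (forall x, (x <= p2) || (q2 <= x) -> b x = 0) ->
  \int[mu]_x tens a b x = 1.
Proof.
move=> h1 h2 ga gb da db a0 b0.
have one (k p q : R) (f : R -> R) : p < q -> flat_gen f ->
    (forall x : R, is_derive x 1 (stepi p q) (f x)) ->
    (forall x, (x <= p) || (q <= x) -> f x = 0) ->
    (\int[lebesgue_measure]_x (k * f x)%:E = k%:E)%E.
  move=> pq gf df f0.
  rewrite (_ : (\int[_]_x _ = \int[lebesgue_measure]_(x in `[p, q]) (k * f x)%:E)%E); last first.
    rewrite [RHS]integral_mkcond; apply: eq_integral => x _; rewrite /patch.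
    case: ifPn => //; rewrite notin_setE /= in_itv/= => h; rewrite f0 ?mulr0//.
    by move/negP: h; rewrite negb_and -!ltNge => /orP[/ltW ->//|/ltW ->]; rewrite orbT.
  have dk (x : R) : is_derive x 1 (fun x => k * stepi p q x) (k * f x).
    apply: (is_derive_eq (is_derive_mul (@is_derive_cst _ _ _ k x 1) (df x))).
    by rewrite mul0r add0r.
  rewrite (FTC2_continuous pq dk); last first.
    by move=> x; apply: cvgMr; exact: flat_gen_continuous.
  by rewrite stepi_ge// stepi_le// mulr0 mulr1 subr0.
have ct : continuous_on setT (tens a b).
  by move=> x _; apply: continuous_tens; exact: flat_gen_continuous.
have iT : mu.-integrable (setT : set T2) (EFin \o tens a b).
  have cS := @compact_crect R p1 q1 p2 q2.
  have mS : measurable (crect p1 q1 p2 q2 : set T2) := measurable_itv2 _ _.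
  rewrite (_ : EFin \o tens a b = (EFin \o tens a b) \_ (crect p1 q1 p2 q2)).
    apply/(integrable_mkcond _ mS).
    exact: (continuous_on_loc_integrable openT ct cS).
  apply/funext => x; rewrite /patch; case: ifPn => //; rewrite notin_setE => h /=.
  rewrite /tens; case: (boolP ((x.1 <= p1) || (q1 <= x.1))) => [z|]; first by rewrite a0// mul0r.
  case: (boolP ((x.2 <= p2) || (q2 <= x.2))) => [z _|]; first by rewrite b0// mulr0.
  rewrite !negb_or -!ltNge => /andP[? ?] /andP[? ?].
  by exfalso; apply: h; apply/crectP; split; apply/andP; split; exact: ltW.
rewrite /Rintegral -[X in fine X](integral12_prod_meas1 iT).
rewrite (_ : (\int[_]_x _)%E = (\int[lebesgue_measure]_x (1 * a x)%:E)%E); first by rewrite (one 1 p1 q1).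
by apply: eq_integral => x _; rewrite /fubini_F /= /tens /= (one (a x) p2 q2)// mul1r.
Qed.

Lemma loc_integrable_tens_le (U : set (R * R)) (v : R * R -> R) (a b : R -> R) a1 b1 a2 b2 K :
  open U -> crect a1 b1 a2 b2 `<=` U -> loc_integrable U v -> flat_gen a -> flat_gen b ->
  (forall x, (x <= a1) || (b1 <= x) -> a x = 0) ->
  (forall x, (x <= a2) || (b2 <= x) -> b x = 0) ->
  (forall x, crect a1 b1 a2 b2 x -> `|tens a b x| <= K) ->
  `|\int[mu]_(x in U) (v x * tens a b x)| <= K * \int[mu]_(x in crect a1 b1 a2 b2) `|v x|.
Proof.
move=> oU SU lv ga gb a0 b0 hK; set S := crect a1 b1 a2 b2.
have mS : measurable (S : set T2) := measurable_itv2 _ _.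
have cS : compact S := @compact_crect R a1 b1 a2 b2.
have iS := lv _ cS SU.
have tp := @test_tens R U a b a1 b1 a2 b2 SU ga gb a0 b0.
have iU : mu.-integrable (U : set T2) (EFin \o (fun x => v x * tens a b x)) := loc_integrableM oU lv tp.
have iUS := integrableS (open_measurable2 oU) mS SU iU.
rewrite (@Rintegral_vanish R U S); last 2 first.
- move=> x _ nS; have [z|z] := boolP ((x.1 <= a1) || (b1 <= x.1)).
    by rewrite /tens a0// mul0r mulr0.
  have [y|y] := boolP ((x.2 <= a2) || (b2 <= x.2)).
    by rewrite /tens [X in _ * (_ * X)]b0// !mulr0.
  move: z y; rewrite !negb_or -!ltNge => /andP[? ?] /andP[? ?].
  by exfalso; apply: nS; apply/crectP; split; apply/andP; split; exact: ltW.
- by move=> x /SU.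
apply: le_trans (le_normr_Rintegral mS iUS) _.
rewrite -RintegralZl//; last exact: (integrable_norm iS).
apply: le_Rintegral => //.
- exact: (integrable_norm iUS).
- exact: (integrableZl mS K (integrable_norm iS)).
- by move=> x Sx; rewrite normrM mulrC ler_wpM2r// hK.
Qed.

Lemma partial_tens (A a B b : R -> R) : (forall x : R, is_derive x 1 A (a x)) ->
  (forall x : R, is_derive x 1 B (b x)) ->
  [/\ partials [:: 0] (tens A B) = tens a B, partials [:: 1] (tens A B) = tens A b &
      partials [:: 0; 1] (tens A B) = tens a b].
Proof.
move=> dA dB.
have e1 C : partial 0 (tens A C) = tens a C.
  by apply/funext => x; apply: partial_is_derive; exact: is_derive_tens0.
have e2 : partial 1 (tens A B) = tens A b.
  by apply/funext => x; apply: partial_is_derive; exact: is_derive_tens1.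
by rewrite /partials /= e1 e2 e1.
Qed.

Lemma RintegralD3 (D : set T2) (f g h : T2 -> R) : measurable D ->
  mu.-integrable D (EFin \o f) -> mu.-integrable D (EFin \o g) -> mu.-integrable D (EFin \o h) ->
  \int[mu]_(x in D) (f x + g x + h x) =
  \int[mu]_(x in D) f x + \int[mu]_(x in D) g x + \int[mu]_(x in D) h x.
Proof.
move=> mD i1 i2 i3.
have i12 : mu.-integrable D (EFin \o (fun x => f x + g x)) := integrableD mD i1 i2.
by rewrite (RintegralD mD i12 i3) RintegralD.
Qed.

(* A product kernel s1 (x) s2 concentrated near z differs from the fixed kernel
   t1 (x) t2 of the whole rectangle by A' (x) B' + A' (x) t2 + t1 (x) B' with A, B
   compactly supported; the three terms integrate u to terms in v12, v1, v2. *)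
Lemma sup_estimate : exists2 M : R, 0 < M &
  forall (U : set (R * R)) (a1 b1 a2 b2 : R) (u v1 v2 v12 : R * R -> R),
  open U -> a1 < b1 -> a2 < b2 -> crect a1 b1 a2 b2 `<=` U -> continuous_on U u ->
  is_weak_partial U [:: 0] u v1 -> is_weak_partial U [:: 1] u v2 ->
  is_weak_partial U [:: 0; 1] u v12 ->
  forall z z', crect a1 b1 a2 b2 z -> crect a1 b1 a2 b2 z' ->
  `|u z - u z'| <= 2 * (\int[mu]_(x in crect a1 b1 a2 b2) `|v12 x| +
     M / (b2 - a2) * \int[mu]_(x in crect a1 b1 a2 b2) `|v1 x| +
     M / (b1 - a1) * \int[mu]_(x in crect a1 b1 a2 b2) `|v2 x|).
Proof.
have [M M0 hM] := stepi_derive; exists M => // U a1 b1 a2 b2 u v1 v2 v12 oU h1 h2 SU cu w1 w2 w12.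
set S := crect a1 b1 a2 b2; set Bd := (X in 2 * X).
have [t1 [gt1 dt1 bt1 zt1]] := hM _ _ h1; have [t2 [gt2 dt2 bt2 zt2]] := hM _ _ h2.
pose T := \int[mu]_(x in U) (u x * tens t1 t2 x).
have mU := open_measurable2 oU.
have lu : loc_integrable U u := continuous_on_loc_integrable oU cu.
suff key z : S z -> `|u z - T| <= Bd.
  move=> z z' /key h /key h'; rewrite (_ : u z - u z' = (u z - T) - (u z' - T)); last by ring.
  by apply: le_trans (ler_normB _ _) _; rewrite mulr_natl mulr2n lerD.
move=> /crectP[z1 z2].
apply/ler_addgt0Pr => e e0.
(* The kernel s1 s2 is bounded by M^2 over the area of its support, so an oscillation of [u] below e
   / (M^2 + 1) there changes the average by at most e. *)
have e20 : 0 < e / (M * M + 1) by rewrite divr_gt0// ltr_wpDl// mulr_ge0// ltW.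
have nz : \forall y \near z, `|u z - u y| < e / (M * M + 1).
  have Uz : U z by apply: SU; exact/crectP.
  by move/cvgrPdist_lt : (cu _ Uz); exact.
have [d d0 hd] := (nbhs2P _ _).1 nz.
(* A short interval starting at [t], or ending at [b] if [t] is too close to it. It stays inside
   [a, b], so the estimate holds for points on the boundary of the rectangle as well. *)
have loc (a b t : R) : a < b -> a <= t <= b -> exists p q, [/\ p < q, a <= p, q <= b &
    forall y, p <= y <= q -> `|y - t| < d].
  move=> ab /andP[at_ tb]; have m0 : 0 < Num.min (d / 2) (b - a).
    by rewrite lt_min subr_gt0 ab divr_gt0.
  have m1 : Num.min (d / 2) (b - a) <= d / 2 by rewrite ge_min lexx.
  have m2 : Num.min (d / 2) (b - a) <= b - a by rewrite ge_min lexx orbT.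
  move: (Num.min _ _) m0 m1 m2 => m m0 m1 m2.
  have [c|c] := leP (t + m) b.
    exists t, (t + m); split => //; first by lra.
    by move=> y /andP[y1 y2]; rewrite ltr_norml; apply/andP; split; lra.
  exists (b - m), b; split => //; [lra|lra|].
  by move=> y /andP[y1 y2]; rewrite ltr_norml; apply/andP; split; lra.
have [p1 [q1 [pq1 ap1 qb1 hz1]]] := loc _ _ _ h1 z1.
have [p2 [q2 [pq2 ap2 qb2 hz2]]] := loc _ _ _ h2 z2.
have [s1 [gs1 ds1 bs1 zs1]] := hM _ _ pq1; have [s2 [gs2 ds2 bs2 zs2]] := hM _ _ pq2.
have zs1' x : (x <= a1) || (b1 <= x) -> s1 x = 0.
  by move=> /orP[h|h]; apply: zs1; [rewrite (le_trans h)|rewrite (le_trans qb1) ?orbT].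
have zs2' x : (x <= a2) || (b2 <= x) -> s2 x = 0.
  by move=> /orP[h|h]; apply: zs2; [rewrite (le_trans h)|rewrite (le_trans qb2) ?orbT].
pose A x := stepi p1 q1 x - stepi a1 b1 x; pose B x := stepi p2 q2 x - stepi a2 b2 x.
pose A' x := s1 x - t1 x; pose B' x := s2 x - t2 x.
have gA : flat_gen A by apply: flat_gen_sub; exact: flat_gen_stepi.
have gB : flat_gen B by apply: flat_gen_sub; exact: flat_gen_stepi.
have gA' : flat_gen A' by exact: flat_gen_sub.
have gB' : flat_gen B' by exact: flat_gen_sub.
have dA (x : R) : is_derive x 1 A (A' x) by exact: is_deriveB.
have dB (x : R) : is_derive x 1 B (B' x) by exact: is_deriveB.
have zA x : (x <= a1) || (b1 <= x) -> A x = 0 by exact: stepi_sub_out.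
have zB x : (x <= a2) || (b2 <= x) -> B x = 0 by exact: stepi_sub_out.
have [dt1' gdt1' hdt1'] := flat_gen_derive gt1; have [dt2' gdt2' hdt2'] := flat_gen_derive gt2.
have [_ _ P12] := partial_tens dA dB.
have [P1 _ _] := partial_tens dA hdt2'.
have [_ P2 _] := partial_tens hdt1' dB.
have T12 := @test_tens R U A B a1 b1 a2 b2 SU gA gB zA zB.
have T1 := @test_tens R U A t2 a1 b1 a2 b2 SU gA gt2 zA zt2.
have T2_ := @test_tens R U t1 B a1 b1 a2 b2 SU gt1 gB zt1 zB.
have Ts := @test_tens R U s1 s2 a1 b1 a2 b2 SU gs1 gs2 zs1' zs2'.
have Tt := @test_tens R U t1 t2 a1 b1 a2 b2 SU gt1 gt2 zt1 zt2.
have E12 := let: And3 _ _ h := w12 in h _ T12.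
have E1 := let: And3 _ _ h := w1 in h _ T1.
have E2 := let: And3 _ _ h := w2 in h _ T2_.
have l12 : loc_integrable U v12 by have [] := w12.
have l1 : loc_integrable U v1 by have [] := w1.
have l2 : loc_integrable U v2 by have [] := w2.
have split_T : \int[mu]_(x in U) (u x * tens s1 s2 x) - T =
   \int[mu]_(x in U) (u x * partials [:: 0; 1] (tens A B) x) +
   \int[mu]_(x in U) (u x * partials [:: 0] (tens A t2) x) +
   \int[mu]_(x in U) (u x * partials [:: 1] (tens t1 B) x).
  rewrite -RintegralD3//; first last.
  - exact: (loc_integrableM oU lu (test_partials [:: 1] T2_)).
  - exact: (loc_integrableM oU lu (test_partials [:: 0] T1)).
  - exact: (loc_integrableM oU lu (test_partials [:: 0; 1] T12)).
  rewrite -RintegralB//; first last.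
  - exact: (loc_integrableM oU lu Tt).
  - exact: (loc_integrableM oU lu Ts).
  congr Rintegral; apply/funext => x; rewrite P12 P1 P2 /tens /A' /B'; ring.
have bA x : `|A x| <= 1 by exact: stepi_sub_le1.
have bB x : `|B x| <= 1 by exact: stepi_sub_le1.
have main : `|\int[mu]_(x in U) (u x * tens s1 s2 x) - T| <= Bd.
  rewrite split_T E12 E1 E2 /Bd.
  apply: le_trans (ler_normD _ _) _; apply: lerD; first (apply: le_trans (ler_normD _ _) _; apply: lerD).
  - rewrite normrM normrX normrN1 expr1n mul1r -[X in _ <= X]mul1r.
    apply: loc_integrable_tens_le => // x _; rewrite /tens normrM mulr_ile1//.
  - rewrite normrM normrX normrN1 expr1n mul1r.
    apply: loc_integrable_tens_le => // x _; rewrite /tens normrM -[X in _ <= X]mul1r.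
    by apply: ler_pM.
  - rewrite normrM normrX normrN1 expr1n mul1r.
    apply: loc_integrable_tens_le => // x _; rewrite /tens normrM -[X in _ <= X]mulr1.
    by apply: ler_pM.
have near_z : `|u z - \int[mu]_(x in U) (u x * tens s1 s2 x)| <= e.
  pose Q := crect p1 q1 p2 q2.
  have QS : Q `<=` S.
    move=> x /crectP[/andP[? ?] /andP[? ?]]; apply/crectP; split; apply/andP; split;
      [exact: le_trans ap1 _|exact: le_trans qb1|exact: le_trans ap2 _|exact: le_trans qb2].
  have mQ : measurable (Q : set T2) := measurable_itv2 _ _.
  have cQ : compact Q := @compact_crect R p1 q1 p2 q2.
  have one := integral_tens1 pq1 pq2 gs1 gs2 ds1 ds2 zs1 zs2.
  have vanQ x : ~ Q x -> tens s1 s2 x = 0.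
    move=> nQ; have [zz|zz] := boolP ((x.1 <= p1) || (q1 <= x.1)).
      by rewrite /tens zs1// mul0r.
    have [yy|yy] := boolP ((x.2 <= p2) || (q2 <= x.2)).
      by rewrite /tens [X in (_ * X)]zs2// mulr0.
    move: zz yy; rewrite !negb_or -!ltNge => /andP[? ?] /andP[? ?].
    by exfalso; apply: nQ; apply/crectP; split; apply/andP; split; exact: ltW.
  have cs : continuous_on U (tens s1 s2).
    by move=> x _; apply: continuous_tens; exact: flat_gen_continuous.
  have QU := subset_trans QS SU.
  have i1 : mu.-integrable (Q : set T2) (EFin \o (fun x => u z * tens s1 s2 x)).
    apply: (continuous_on_loc_integrable oU _ cQ QU) => x Ux.
    by apply: cvgMr; exact: cs.
  have i2 : mu.-integrable (Q : set T2) (EFin \o (fun x => u x * tens s1 s2 x)).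
    apply: (continuous_on_loc_integrable oU _ cQ QU) => x Ux.
    by apply: cvgM; [exact: cu|exact: cs].
  have i3 : mu.-integrable (Q : set T2) (EFin \o tens s1 s2).
    exact: (continuous_on_loc_integrable oU cs cQ QU).
  rewrite (@Rintegral_vanish R U Q (fun x => u x * tens s1 s2 x)); last 2 first.
  - by move=> x _ /vanQ ->; rewrite mulr0.
  - by move=> x /QU.
  have one' : \int[mu]_(x in Q) tens s1 s2 x = 1.
    rewrite -one; apply: Rintegral_vanish; first by move=> x _ [].
    by move=> x _ /vanQ.
  have -> : u z = \int[mu]_(x in Q) (u z * tens s1 s2 x) by rewrite RintegralZl// one' mulr1.
  rewrite -RintegralB//.
  have i4 : mu.-integrable (Q : set T2) (EFin \o (fun x => u z * tens s1 s2 x - u x * tens s1 s2 x)).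
    exact: (integrableB mQ i1 i2).
  apply: le_trans (le_normr_Rintegral mQ i4) _.
  pose k := e / (M * M + 1) * (M / (q1 - p1) * (M / (q2 - p2))).
  have ik : mu.-integrable (Q : set T2) (EFin \o (fun=> k)).
    by apply: (continuous_on_loc_integrable oU _ cQ QU) => x Ux; exact: cst_continuous.
  apply: (@le_trans _ _ (\int[mu]_(x in Q) k)).
    apply: le_Rintegral => //; first exact: (integrable_norm i4).
    move=> x /crectP[x1 x2]; rewrite -mulrBl normrM /k; apply: ler_pM => //.
      by apply: ltW; apply: hd; [exact: hz1|exact: hz2].
    by rewrite /tens normrM; exact: ler_pM.
  rewrite /Rintegral integral_cst// [X in fine (_ * X)](@leb2_itv2 R p1 q1 p2 q2) ?(ltW pq1) ?(ltW pq2)//.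
  rewrite -EFinM /= /k.
  have q1p1 : q1 - p1 != 0 by rewrite subr_eq0 gt_eqF.
  have q2p2 : q2 - p2 != 0 by rewrite subr_eq0 gt_eqF.
  have MM : M * M + 1 != 0 by rewrite gt_eqF// ltr_wpDl// mulr_ge0// ltW.
  have -> : e / (M * M + 1) * (M / (q1 - p1) * (M / (q2 - p2))) * ((q1 - p1) * (q2 - p2)) =
      e * (M * M / (M * M + 1)) by field; rewrite MM q1p1 q2p2.
  rewrite -[X in _ <= X]mulr1 ler_wpM2l ?(ltW e0)// ler_pdivrMr ?mul1r ?lerDl//.
  by rewrite ltr_wpDl// mulr_ge0// ltW.
rewrite (_ : u z - T = (\int[mu]_(x in U) (u x * tens s1 s2 x) - T) +
   (u z - \int[mu]_(x in U) (u x * tens s1 s2 x))); last by ring.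
by apply: le_trans (ler_normD _ _) _; exact: lerD.
Qed.

End SupEstimate.

(** * Removed squares *)

Section Removal.
Context {R : realType}.
Local Notation T2 := (measurableTypeR R * measurableTypeR R)%type.
Local Notation mu := (leb2 R).

Lemma compact_margin (K U : set (R * R)) : compact K -> open U -> K `<=` U ->
  exists2 e : R, 0 < e & forall x y, K x -> `|y.1 - x.1| < e -> `|y.2 - x.2| < e -> U y.
Proof.
move=> cK oU KU; apply: contrapT => nex.
have /choice[z hz] : forall n : nat, exists z : (R * R) * (R * R), [/\ K z.1,
    `|z.2.1 - z.1.1| < mesh n, `|z.2.2 - z.1.2| < mesh n & ~ U z.2].
  move=> n; apply: contrapT => h; apply: nex; exists (mesh n); first exact: mesh_gt0.
  by move=> x y Kx h1 h2; apply: contrapT => nU; apply: h; exists (x, y).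
have [|x [Kx clx]] := cK ((fun n => (z n).1) @ \oo) _.
  by exists 0%N => // n _; have [] := hz n.
have [e e0 he] := (open2P U).1 oU _ (KU _ Kx).
have e20 : 0 < e / 2 by rewrite divr_gt0.
have [N _ hN] := @cvgr_lt _ _ _ _ mesh _ (@mesh_cvg0 R) (e / 2) e20.
have [||_ [[n /= Nn <-] hx]] := clx ((fun n => (z n).1) @` [set n | (N <= n)%N])
       [set y | `|y.1 - x.1| < e / 2 /\ `|y.2 - x.2| < e / 2].
- by exists N => // n /= Nn; exists n.
- by apply/nbhs2P; exists (e / 2).
case: hx => /= hx1 hx2; have [_ h1 h2 nU] := hz n; have hn := hN n Nn.
apply: nU; apply: he.
  rewrite (_ : _ - _ = ((z n).2.1 - (z n).1.1) + ((z n).1.1 - x.1)); last by ring.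
  by rewrite (le_lt_trans (ler_normD _ _))// [e]splitr ltrD// (lt_trans h1).
rewrite (_ : _ - _ = ((z n).2.2 - (z n).1.2) + ((z n).1.2 - x.2)); last by ring.
by rewrite (le_lt_trans (ler_normD _ _))// [e]splitr ltrD// (lt_trans h2).
Qed.

Lemma is_square_ccell m c : is_square (@ccell R m c).
Proof.
pose r : R := mesh m; have r0 : 0 < r := mesh_gt0 m.
exists ((c.1%:~R + 2^-1) * r, (c.2%:~R + 2^-1) * r), (r / 2), 0; split.
  have r20 : 0 < r / 2 by rewrite divr_gt0.
  by apply/eqP => -[h]; move: r20; rewrite h ltxx.
have i1 (i : int) : (i + 1)%:~R = i%:~R + 1 :> R by rewrite intrD.
rewrite /ccell !i1 -/r; apply/seteqP; split => -[x y] /=.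
  move=> [/andP[a1 a2] /andP[a3 a4]].
  exists ((x - (c.1%:~R + 2^-1) * r) / (r / 2)), ((y - (c.2%:~R + 2^-1) * r) / (r / 2)).
  split.
  - rewrite ler_norml ler_pdivrMr ?divr_gt0// ler_pdivlMr ?divr_gt0//.
    by apply/andP; split; lra.
  - rewrite ler_norml ler_pdivrMr ?divr_gt0// ler_pdivlMr ?divr_gt0//.
    by apply/andP; split; lra.
  - by congr (_, _); field; rewrite gt_eqF.
move=> [s [t [hs ht [-> ->]]]]; move: hs ht; rewrite !ler_norml => /andP[s1 s2] /andP[t1 t2].
by split; apply/andP; split; nra.
Qed.

Lemma closed_ccell m c : closed (@ccell R m c).
Proof. by rewrite ccellE; exact: closed_crect. Qed.

Lemma finite_int_range (B : nat) : finite_set [set i : int | - B%:Z <= i <= B%:Z].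
Proof.
apply: (@sub_finite_set _ _ ((fun n : nat => n%:Z - B%:Z) @` `I_(2 * B).+1)).
  move=> i /= /andP[h1 h2]; exists (absz (i + B%:Z : int)).
    by rewrite /=; lia.
  by lia.
by apply: finite_image; exact: finite_II.
Qed.

Lemma finite_cells_meeting (K : set (R * R)) (L : nat) : compact K ->
  finite_set [set lc : nat * (int * int) | (lc.1 <= L)%N /\ K `&` ccell lc.1 lc.2 !=set0].
Proof.
move=> /compact_box[N KN].
(* Bounds the indices at all levels up to [L] of the cells meeting the box; the unit added to [N]
   accounts for cells that reach beyond its lower or left edge. *)
pose B : nat := (2 ^ L * N.+1)%N.
apply: (@sub_finite_set _ _ (`I_L.+1 `*` ([set i : int | - B%:Z <= i <= B%:Z] `*`
   [set i : int | - B%:Z <= i <= B%:Z]))); last first.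
  by apply: finite_setX; [exact: finite_II|apply: finite_setX; exact: finite_int_range].
move=> [l [i j]] /= [lL [x [/KN [/= hx1 hx2] [/andP[a1 a2] /andP[a3 a4]]]]].
move: hx1 hx2; rewrite !in_itv/= => /andP[b1 b2] /andP[b3 b4].
have r0 := @mesh_gt0 R l.
have BE : (N.+1)%:R <= B%:R * mesh l :> R.
  rewrite /mesh ler_pdivlMr ?exprn_gt0// /B natrM natrX mulrC ler_wpM2r//.
  by rewrite ler_weXn2l// ler1n.
have r1 : mesh l <= 1 :> R by rewrite /mesh invf_le1 ?exprn_gt0// exprn_ege1// ler1n.
have S1 : (N.+1)%:R = N%:R + 1 :> R by rewrite -natr1.
have key (k : int) (t : R) : k%:~R * mesh l <= t -> t <= (k + 1)%:~R * mesh l ->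
    - N%:R <= t -> t < N%:R -> - B%:Z <= k <= B%:Z.
  move=> h1 h2 h3 h4; rewrite intrD mulrDl mul1r in h2.
  apply/andP; split.
    rewrite -(ler_int R) -(ler_pM2r r0) mulrNz mulNr -pmulrn.
    by move: BE; rewrite S1; lra.
  rewrite -(ler_int R) -(ler_pM2r r0) -pmulrn.
  by move: BE; rewrite S1; lra.
split => //; split; [exact: key a1 a2 b1 b2|exact: key a3 a4 b3 b4].
Qed.

(* Indices that do not code a removed cell are filled with tiny cells escaping to infinity. *)
Lemma enumerate_cells (P : set (nat * (int * int))) (e : R) : 0 < e ->
  exists Q : nat -> set (R * R), [/\ forall i, is_square (Q i), forall i, closed (Q i),
    forall lc, P lc -> ccell lc.1 lc.2 `<=` \bigcup_i Q i,
    (exists2 D : set T2, measurable D /\ (mu D <= e%:E)%E &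
       \bigcup_i Q i `<=` [set x | exists2 lc, P lc & ccell lc.1 lc.2 x] `|` D) &
    forall K, compact K ->
      finite_set [set lc | P lc /\ K `&` ccell lc.1 lc.2 !=set0] ->
      finite_set [set i | K `&` Q i !=set0]].
Proof.
move=> e0.
have e20 : 0 < e / 2 by rewrite divr_gt0.
have [j _ /(_ j (leqnn _)) hj] := @cvgr_lt _ _ _ _ mesh _ (@mesh_cvg0 R) (e / 2) e20.
(* The first index puts the left edge at abscissa [n], so a bounded set meets finitely many of these
   cells. The level j + n makes the area at most (e / 2) 2^-n, with sum at most e. *)
pose dum n : set (R * R) := ccell (j + n) ((2 ^ (j + n) * n)%N%:Z, 0).
(* With [pickle lc = n] each cell of [P] has one index only, so finitely many cells meeting a
   compact set give finitely many indices. *)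
pose code n (lc : nat * (int * int)) := (unpickle n = Some lc) /\ (pickle lc = n) /\ P lc.
have code_inj n lc lc' : code n lc -> code n lc' -> lc = lc'.
  by move=> [h1 _] [h2 _]; move: h1; rewrite h2 => -[].
pose Q n : set (R * R) := [set x | (exists2 lc, code n lc & ccell lc.1 lc.2 x) \/
   ((forall lc, ~ code n lc) /\ dum n x)].
have QE n : (exists2 lc, code n lc & Q n = ccell lc.1 lc.2) \/
    ((forall lc, ~ code n lc) /\ Q n = dum n).
  have [[lc clc]|nc] := pselect (exists lc, code n lc); [left|right].
    exists lc => //; apply/seteqP; split => x.
      by move=> [[lc' /(code_inj _ _ _ clc) <-]//|[/(_ lc)]].
    by move=> h; left; exists lc.
  have nc' lc : ~ code n lc by move=> h; apply: nc; exists lc.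
  split => //; apply/seteqP; split => x; last by right.
  by move=> [[lc /nc']|[]].
exists Q; split.
- by move=> n; have [[lc _ ->]|[_ ->]] := QE n; exact: is_square_ccell.
- by move=> n; have [[lc _ ->]|[_ ->]] := QE n; exact: closed_ccell.
- move=> lc Plc x xlc; exists (pickle lc); first exact: Logic.I.
  by left; exists lc => //; split; [exact: pickleK|split].
- have mD : measurable (\bigcup_n dum n : set T2).
    by apply: bigcupT_measurable => n; exact: measurable_ccell.
  exists (\bigcup_n dum n); first split => //.
    apply: le_trans.
      apply: (@measure_sigma_subadditive _ _ _ mu _ dum _ mD) => //.
      by move=> n; exact: measurable_ccell.
    have := @epsilon_trick0 R e xpredT (ltW e0); apply: le_trans.
    apply: lee_nneseries => n _; first by [].
    rewrite [X in (X <= _)%E](@leb2_ccell R) lee_fin meshD.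
    have mj0 := @mesh_gt0 R j; have mn0 := @mesh_gt0 R n.
    have le1 k : mesh k <= 1 :> R by rewrite /mesh invf_le1 ?exprn_gt0// exprn_ege1// ler1n.
    have -> : e / (2 ^ n.+1)%:R = e / 2 * mesh n :> R.
      by rewrite natrX exprS invfM /mesh mulrA.
    rewrite expr2 mulrACA; apply: ler_pM; rewrite ?mulr_ge0 ?(ltW mj0) ?(ltW mn0)//.
      by apply: le_trans (ltW hj); rewrite ler_piMr// ltW.
    by rewrite ler_piMr// ltW.
  move=> x [n _]; have [[lc [_ [_ Plc]] ->]|[_ ->]] := QE n.
    by left; exists lc.
  by right; exists n.
- move=> K cK fK.
  have [N KN] := compact_box cK.
  apply: (@sub_finite_set _ _ ((pickle @` [set lc | P lc /\ K `&` ccell lc.1 lc.2 !=set0]) `|` `I_N.+1)); last first.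
    by rewrite finite_setU; split; [exact: finite_image|exact: finite_II].
  move=> n /=; have [[lc [_ [<- Plc]] ->]|[_ ->]] := QE n; first by left; exists lc.
  move=> [x [/KN [/= hx _] [/andP[/= h _] _]]]; right; rewrite /= ltnS.
  move: hx; rewrite in_itv/= => /andP[_ xN].
  rewrite -(ler_nat R); apply: ltW; apply: le_lt_trans xN; apply: le_trans h.
  by rewrite -pmulrn natrM natrX /mesh mulrAC mulfV ?mul1r// expf_neq0.
Qed.

(** A small closed square around a point of [U] meets finitely many of the sets [Q i], and a finite
    union of closed sets is closed. *)
Lemma open_remove (U : set (R * R)) (Q : nat -> set (R * R)) : open U ->
  (forall i, closed (Q i)) -> locally_finite_in U Q -> open (U `\` \bigcup_i Q i).
Proof.
move=> oU cQ lQ; rewrite openE => x [Ux nx].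
have [e e0 he] := (open2P U).1 oU _ Ux.
pose K := sq x (e / 2).
have cK : compact K by rewrite /K sqE; exact: compact_crect.
have KU : K `<=` U by move=> y [h1 h2]; apply: he; [apply: le_lt_trans h1 _|apply: le_lt_trans h2 _]; lra.
have [s hs] := (finite_seqP _).1 (lQ K cK KU).
have cl : closed (\big[setU/set0]_(i <- s) Q i) by apply: closed_bigsetU => i _; exact: cQ.
have nxs : nbhs x (~` (\big[setU/set0]_(i <- s) Q i)).
  apply: open_nbhs_nbhs; split; first exact: closed_openC.
  rewrite -bigcup_seq => -[i _ Qi]; apply: nx; by exists i.
have nK : nbhs x K.
  by apply/nbhs2P; exists (e / 2); [rewrite divr_gt0|move=> y h1 h2; split; exact: ltW].
apply: filterS2 nxs nK => y ny Ky; split; first exact: KU.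
move=> [i _ Qi]; apply: ny; rewrite -bigcup_seq; exists i => //=.
have : [set i | K `&` Q i !=set0] i by exists y.
by rewrite hs.
Qed.

(* The points at distance at least mesh (m + k) from the boundary of their cell of level m. *)
Definition off_frame (m k : nat) (x : R * R) : Prop :=
  ((didx m x.1)%:~R * mesh m + mesh (m + k) <= x.1 < (didx m x.1 + 1)%:~R * mesh m - mesh (m + k)) /\
  ((didx m x.2)%:~R * mesh m + mesh (m + k) <= x.2 < (didx m x.2 + 1)%:~R * mesh m - mesh (m + k)).

(** The half-open inequalities in [off_frame] are conditions on floors at level m + k, so the frame
    is exactly a union of cells of that level. *)
Lemma dyadic_off_frame m k : dyadic (m + k) [set x | off_frame m k x].
Proof.
have key (t : R) : ((didx m t)%:~R * mesh m + mesh (m + k) <= t < (didx m t + 1)%:~R * mesh m - mesh (m + k))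
   = (didx m t * 2 ^+ k + 1 <= didx (m + k) t < (didx m t + 1) * 2 ^+ k - 1).
  have E (i : int) : i%:~R * mesh m = (i * 2 ^+ k)%:~R * (mesh (m + k) : R).
    rewrite intrM rmorphXn /= meshD mulrACA -[LHS]mulr1; congr (_ * _).
    by rewrite /mesh mulfV// expf_neq0.
  rewrite !E {2 3}/didx Num.Theory.floor_ge_int Num.Theory.floor_lt_int.
  rewrite ler_pdivlMr ?mesh_gt0// ltr_pdivrMr ?mesh_gt0//.
  by rewrite [in RHS]intrD [in RHS]intrB [in RHS]mulrDl [in RHS]mulrBl !mul1r /didx.
move=> x y e; have e' := cidx_coarse e.
have x1 : didx (m + k) x.1 = didx (m + k) y.1 := congr1 fst e.
have x2 : didx (m + k) x.2 = didx (m + k) y.2 := congr1 snd e.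
have y1 : didx m x.1 = didx m y.1 := congr1 fst e'.
have y2 : didx m x.2 = didx m y.2 := congr1 snd e'.
by rewrite /off_frame /= !key x1 x2 y1 y2.
Qed.

(** [R1] is a Whitney decomposition of the region near the boundary: cells finer than level [m] that
    fit into [U] while their parent does not. [R2] holds the bad cells and [R3] the cells of level m
    + k that make up the frames. The last term of the bound pays for the filler squares of the
    enumeration. *)
Lemma removal (U : set (R * R)) (m k : nat) (bad : set (int * int)) (e : R) :
  open U -> 0 < e ->
  exists Q : nat -> set (R * R), [/\ forall i, is_square (Q i), locally_finite_in U Q,
    open (U `\` \bigcup_i Q i),
    (mu (\bigcup_i Q i) <= mu (U `\` inner m U) + mu (inner m U `&` [set x | bad (cidx m x)]) +
       mu (inner m U `\` [set x | off_frame m k x]) + e%:E)%E &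
    forall x, (U `\` \bigcup_i Q i) x -> [/\ inner m U x, ~ bad (cidx m x) & off_frame m k x]].
Proof.
move=> oU e0.
pose R1 (lc : nat * (int * int)) := [/\ (m < lc.1)%N, ccell lc.1 lc.2 `<=` U &
  exists2 x, cell lc.1 lc.2 x & ~ inner lc.1.-1 U x].
pose R2 (lc : nat * (int * int)) := [/\ lc.1 = m, ccell m lc.2 `<=` U & bad lc.2].
pose R3 (lc : nat * (int * int)) := lc.1 = (m + k)%N /\
  exists x, [/\ cell lc.1 lc.2 x, inner m U x & ~ off_frame m k x].
pose P : set (nat * (int * int)) := [set lc | [\/ R1 lc, R2 lc | R3 lc]].
have [Q [sQ cQ covQ [D [mD muD] DQ] fQ]] := enumerate_cells P e0.
have lfQ : locally_finite_in U Q.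
  move=> K cK KU; apply: fQ => //.
  (* If a cell meeting [K] has a parent of mesh below d / 2, then the whole parent lies within d of
     [K], hence in [U], and [R1] excludes the cell. So the levels of the cells meeting [K] are
     bounded. *)
  have [d d0 hd] := compact_margin cK oU KU.
  have d20 : 0 < d / 2 by rewrite divr_gt0.
  have [n0 _ hn0] := @cvgr_lt _ _ _ _ mesh _ (@mesh_cvg0 R) (d / 2) d20.
  apply: sub_finite_set (finite_cells_meeting (n0 + (m + k)).+1 cK).
  move=> [l c] /= [Plc [p [Kp clp]]]; split; last by exists p.
  case: Plc => [[/= ml cU [x xc ni]]|[/= -> _ _]|[/= -> _]]; last 2 first.
  - by clear; lia.
  - by clear; lia.
  rewrite leqNgt; apply/negP => big; apply: ni => y.
  have l0 : (n0 <= l.-1)%N by clear -big; lia.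
  have h1 := hn0 _ l0; have h2 := hn0 _ (leq_trans l0 (leq_pred l)).
  move=> /ccell_close[y1 y2].
  have [p1 p2] : `|p.1 - x.1| <= mesh l /\ `|p.2 - x.2| <= mesh l.
    by apply: ccell_close; rewrite xc.
  apply: (hd p) => //.
    rewrite (_ : _ - _ = (y.1 - x.1) - (p.1 - x.1)); last by ring.
    by rewrite (le_lt_trans (ler_normB _ _))// [d]splitr ltrD//; [exact: le_lt_trans h1|exact: le_lt_trans h2].
  rewrite (_ : _ - _ = (y.2 - x.2) - (p.2 - x.2)); last by ring.
  by rewrite (le_lt_trans (ler_normB _ _))// [d]splitr ltrD//; [exact: le_lt_trans h1|exact: le_lt_trans h2].
exists Q; split => //.
- exact: open_remove.
(* The removed squares are closed while the sets in the bound are unions of half-open cells; the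
   difference is contained in this null set of edges. *)
- pose N : set T2 := \bigcup_n (if (unpickle n : option (nat * (int * int))) is Some lc then
     ccell lc.1 lc.2 `\` cell lc.1 lc.2 else set0).
  have mN : measurable N.
    apply: bigcupT_measurable => n; case: unpickle => // lc.
    by apply: measurableD; [exact: measurable_ccell|exact: measurable_cell].
  have N0 : mu N = 0%E.
    apply/eqP; rewrite -measure_le0; apply: le_trans.
      apply: (@measure_sigma_subadditive _ _ _ mu _ (fun n => if (unpickle n : option (nat * (int * int))) is Some lc then
     ccell lc.1 lc.2 `\` cell lc.1 lc.2 else set0) _ mN) => //.
      move=> n; case: unpickle => // lc.
      by apply: measurableD; [exact: measurable_ccell|exact: measurable_cell].
    rewrite eseries0// => n _ _; case: unpickle => [[l c]/=|]; last exact: measure0.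
    have [e1 e2 _] := @cell_orect R l c.
    have side (i : int) : i%:~R * mesh l < (i + 1)%:~R * mesh l :> R.
      by rewrite -subr_gt0 cell_side mesh_gt0.
    apply/eqP; rewrite -measure_le0 -(leb2_crect_orect (side c.1) (side c.2)).
    rewrite e1; apply: le_measure; rewrite ?inE.
    - by apply: measurableD; [exact: measurable_itv2|exact: measurable_cell].
    - by apply: measurableD; exact: measurable_itv2.
    - by apply: setDS; exact: e2.
  have mU := open_measurable2 oU; have mI := @measurable_inner R m U.
  have mB := @measurable_dyadic R m bad.
  have mF := dyadic_measurable (@dyadic_off_frame m k).
  have mUI := measurableD mU mI; have mIB := measurableI _ _ mI mB.
  have mIF := measurableD mI mF.
  have mQ : measurable (\bigcup_i Q i : set T2).
    apply: bigcupT_measurable => n; rewrite -(setCK (Q n)); apply: measurableC.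
    by apply: open_measurable2; exact: closed_openC.
  apply: (@le_trans _ _ (mu ((((U `\` inner m U) `|` (inner m U `&` [set x | bad (cidx m x)])) `|`
     (inner m U `\` [set x | off_frame m k x])) `|` (D `|` N)))).
    apply: le_measure; rewrite ?inE//.
      by do !apply: measurableU.
    move=> x /DQ[[[l c] Plc] /= xc|]; last by right; left.
    have [xin|xnin] := pselect (cell l c x); last first.
      right; right; exists (pickle (l, c)); first exact: Logic.I.
      by rewrite pickleK.
    left; case: Plc => [[/= ml cU [y yc ni]]|[/= lm cU bc]|[/= lm [y [yc iy nin]]]].
    + left; left; split; first exact: cU.
      move=> ix; apply: ni; have e1 : cidx l x = cidx l y by rewrite xin yc.
      have lm : (l = (m + (l.-1 - m)).+1)%N by clear -ml; lia.
      have e2 : cidx l.-1 x = cidx l.-1 y.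
        by apply: (@cidx_coarse R _ 1); rewrite addn1 prednK// (leq_trans _ ml).
      rewrite /inner/= -e2 lm /=; apply: subset_trans ix; exact: ccell_coarse.
    + by left; right; split; rewrite /inner/= -?lm xin ?lm//; move: bc; rewrite -xin lm.
    + right; have e1 : cidx (m + k) y = cidx (m + k) x by rewrite -lm xin yc.
      have e2 := cidx_coarse e1; split; first by rewrite /inner/= -e2.
      by move=> ix; apply: nin; apply: (@dyadic_off_frame m k x).
  apply: le_trans; first by apply: measureU2; do !apply: measurableU.
  apply: leeD.
    apply: le_trans; first by apply: measureU2 => //; exact: measurableU.
    by apply: leeD => //; apply: measureU2.
  apply: le_trans; first exact: measureU2.
  have N0' : (mu N <= 0)%E by rewrite N0.
  by apply: le_trans (leeD muD N0') _; rewrite adde0.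
- move=> x [Ux nx]; have nP lc : P lc -> ~ ccell lc.1 lc.2 x by move=> /covQ h /h.
  have xi : inner m U x.
    apply: contrapT => ni.
    have : exists l, (m + l.+1)%N \in [set l | inner l U x].
      have : (\bigcup_m inner m U) x by rewrite bigcup_inner.
      move=> [l0 _ il0]; exists l0; rewrite inE /=.
      rewrite (_ : (m + l0.+1 = l0 + m.+1)%N); last by clear; lia.
      elim: (m.+1) => [|n ih]; first by rewrite addn0.
      by rewrite addnS; exact: inner_incr.
    (* The first level beyond [m] at which the closed cell of [x] fits into [U]. Its parent does not
       fit, by minimality, or by [ni] when the parent has level [m]; so the cell is in [R1]. *)
    move=> exl; have [l hl minl] := @ex_minnP (fun l => (m + l.+1)%N \in [set l | inner l U x]) exl.
    rewrite inE /= in hl.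
    apply: (nP ((m + l.+1)%N, cidx (m + l.+1) x)); last exact: cell_sub_ccell.
    apply: Or31; split => /=; [by rewrite addnS ltnS leq_addr|exact: hl|].
    exists x => //; rewrite addnS /=; case: l hl minl => [|l] hl minl; first by rewrite addn0.
    move=> h; have := minl l; rewrite inE /= => /(_ h); by rewrite ltnn.
  split => //.
    move=> bx; apply: (nP (m, cidx m x)); last exact: cell_sub_ccell.
    by apply: Or32; split.
  apply: contrapT => nin; apply: (nP ((m + k)%N, cidx (m + k) x)); last exact: cell_sub_ccell.
  by apply: Or33; split => //; exists x.
Qed.

End Removal.

(** * Quadratic interpolation on a cell *)

Section QuadApprox.
Context {R : realType}.
Local Notation T2 := (measurableTypeR R * measurableTypeR R)%type.
Local Notation mu := (leb2 R).

Lemma qd1_qval (q : quadratic) :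
  qd1 q = qval (Quadratic (q1 q) (q11 q) (q12 q) 0 0 0 (qc q)) :> (R * R -> R).
Proof. by apply/funext => x; rewrite /qd1 /qval /=; field. Qed.

Lemma qd2_qval (q : quadratic) :
  qd2 q = qval (Quadratic (q2 q) (q12 q) (q22 q) 0 0 0 (qc q)) :> (R * R -> R).
Proof. by apply/funext => x; rewrite /qd2 /qval /=; field. Qed.

Lemma partial0_qval q : partial 0 (qval q) = qd1 q :> (R * R -> R).
Proof. by apply/funext => x; apply: partial_is_derive; exact: is_derive_qval1. Qed.

Lemma partial1_qval q : partial 1 (qval q) = qd2 q :> (R * R -> R).
Proof. by apply/funext => x; apply: partial_is_derive; exact: is_derive_qval2. Qed.

Definition qgrad (q : quadratic) (i : 'I_2) : R * R -> R := if i == 0 then qd1 q else qd2 q.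

Definition qhess (q : quadratic) (i j : 'I_2) : R :=
  if i == 0 then (if j == 0 then q11 q else q12 q)
  else (if j == 0 then q12 q else q22 q).

Lemma partial_qval q i : partial i (qval q) = qgrad q i.
Proof. by case: (ord2P i) => ->; rewrite /qgrad /= ?partial0_qval ?partial1_qval. Qed.

Lemma partial2_qval q i j : partial i (partial j (qval q)) = (fun=> qhess q i j).
Proof.
rewrite partial_qval; case: (ord2P i) => ->; case: (ord2P j) => ->;
  rewrite /qgrad /qhess /= ?qd1_qval ?qd2_qval ?partial0_qval ?partial1_qval;
  by apply/funext => x; rewrite /qd1 /qd2 /=; ring.
Qed.

Lemma Rintegral_ccell m c (w : T2 -> R) : mu.-integrable (ccell m c : set T2) (EFin \o w) ->
  \int[mu]_(x in ccell m c) w x = mesh m ^+ 2 * dmean m w c.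
Proof.
move=> iw; have mc := @measurable_cell R m c; have mcc := @measurable_ccell R m c.
rewrite /dmean mulrA mulfV ?mul1r ?expf_neq0 ?mesh_neq0//.
rewrite /Rintegral; congr fine.
have [e1 e2 _] := @cell_orect R m c.
have side (i : int) : i%:~R * mesh m < (i + 1)%:~R * mesh m :> R.
  by rewrite -subr_gt0 cell_side mesh_gt0.
have N0 : mu (ccell m c `\` cell m c) = 0%E.
  apply/eqP; rewrite -measure_le0 -(leb2_crect_orect (side c.1) (side c.2)) e1.
  apply: le_measure; rewrite ?inE.
  - by apply: measurableD; [exact: measurable_itv2|exact: measurable_cell].
  - by apply: measurableD; exact: measurable_itv2.
  - by apply: setDS; exact: e2.
rewrite (negligible_integral _ mcc iw N0); last exact: measurableD.
by rewrite setDD setIidr//; exact: cell_sub_ccell.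
Qed.

Lemma dmean_cst m (k : R) c : dmean m (fun=> k) c = k.
Proof.
rewrite /dmean /Rintegral integral_cst; last exact: measurable_cell.
rewrite [X in fine (_ * X)](@leb2_cell R) -EFinM /= mulrC mulfK//.
by rewrite expf_neq0// mesh_neq0.
Qed.

Lemma le_dmean m (w v : T2 -> R) c :
  mu.-integrable (cell m c : set T2) (EFin \o w) -> mu.-integrable (cell m c : set T2) (EFin \o v) ->
  (forall x, cell m c x -> w x <= v x) -> dmean m w c <= dmean m v c.
Proof.
move=> iw iv h; rewrite /dmean ler_wpM2l ?invr_ge0 ?exprn_ge0 ?(ltW (mesh_gt0 _))//.
by apply: le_Rintegral => //; exact: measurable_cell.
Qed.

Definition osc m (w : T2 -> R) (x : T2) : R := `|w x - dproj m w x|.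

Lemma L1_osc m (w : T2 -> R) : L1 w -> L1 (osc m w).
Proof. by move=> iw; apply: L1_norm; apply: L1B => //; exact: L1_dproj. Qed.

Lemma norm_dmean m (w : T2 -> R) c : L1 w -> `|dmean m w c| <= dmean m (fun x => `|w x|) c.
Proof.
move=> iw; have iwc := L1_cell m c iw; rewrite /dmean normrM ger0_norm ?invr_ge0 ?exprn_ge0 ?(ltW (mesh_gt0 _))//.
rewrite ler_wpM2l ?invr_ge0 ?exprn_ge0 ?(ltW (mesh_gt0 _))//.
by apply: le_normr_Rintegral => //; exact: measurable_cell.
Qed.

Definition cell_center m (c : int * int) : R * R :=
  ((c.1%:~R + 2^-1) * mesh m, (c.2%:~R + 2^-1) * mesh m).

Lemma ccell_center m c : ccell m c (cell_center m c).
Proof.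
have r0 := @mesh_gt0 R m.
by rewrite /ccell /cell_center /= !intrD; split; apply/andP; split; nra.
Qed.

Lemma ccell_center_dist m c x : ccell m c x ->
  `|x.1 - (cell_center m c).1| <= mesh m /\ `|x.2 - (cell_center m c).2| <= mesh m.
Proof.
have r0 := @mesh_gt0 R m.
rewrite /ccell /cell_center /= !intrD => -[/andP[? ?] /andP[? ?]].
by rewrite !ler_norml; split; apply/andP; split; lra.
Qed.

(** [sup_estimate] for F - q on the closed cell. The mixed derivative of F - q is that of F minus
    its mean, which gives r^2 times a mean oscillation; a first derivative leaves its oscillation
    plus r times the Hessian, and the kernel bound M / r turns the area r^2 into M r. Everything is
    expressed through the integrable extensions [v0], [v1], [v01], to which the averages belong. *)
Lemma quad_approx : exists2 M : R, 0 < M &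
  forall (U : set (R * R)) (F V0 V1 V01 v0 v1 v01 : R * R -> R) m c (q : quadratic),
  open U -> ccell m c `<=` U -> continuous_on U F ->
  is_weak_partial U [:: 0] F V0 -> is_weak_partial U [:: 1] F V1 ->
  is_weak_partial U [:: 0; 1] F V01 ->
  L1 v0 -> L1 v1 -> L1 v01 ->
  (forall x, U x -> v0 x = V0 x) -> (forall x, U x -> v1 x = V1 x) ->
  (forall x, U x -> v01 x = V01 x) ->
  qc q = cell_center m c -> q0 q = F (cell_center m c) ->
  q1 q = dmean m v0 c -> q2 q = dmean m v1 c -> q12 q = dmean m v01 c ->
  forall z, ccell m c z -> `|F z - qval q z| <=
    2 * (mesh m ^+ 2 * dmean m (osc m v01) c +
      M * mesh m * (dmean m (osc m v0) c + dmean m (osc m v1) c) +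
      M * mesh m ^+ 2 * (`|q11 q| + 2 * `|q12 q| + `|q22 q|)).
Proof.
have [M M0 hM] := @sup_estimate R; exists M => //.
move=> U F V0 V1 V01 v0 v1 v01 m c q oU cU cF w0 w1 w01 i0 i1 i01 e0 e1 e01 qcE q0E q1E q2E q12E z cz.
set r : R := mesh m; have r0 : 0 < r := mesh_gt0 m.
pose a1 : R := c.1%:~R * r; pose b1 : R := (c.1 + 1)%:~R * r.
pose a2 : R := c.2%:~R * r; pose b2 : R := (c.2 + 1)%:~R * r.
have s1 : b1 - a1 = r := cell_side m c.1; have s2 : b2 - a2 = r := cell_side m c.2.
have ab1 : a1 < b1 by rewrite -subr_gt0 s1.
have ab2 : a2 < b2 by rewrite -subr_gt0 s2.
have E : ccell m c = crect a1 b1 a2 b2 by exact: ccellE.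
have sq : smooth_on U (qval q) by apply: smooth_onW (@smooth_qval R q).
have cq : continuous_on U (qval q) by move=> x Ux; have [] := smooth_on_regular sq Ux.
have p0 := is_weak_partialB oU w0 (smooth_weak_partial [:: 0] oU sq).
have p1 := is_weak_partialB oU w1 (smooth_weak_partial [:: 1] oU sq).
have p01 := is_weak_partialB oU w01 (smooth_weak_partial [:: 0; 1] oU sq).
have cu : continuous_on U (fun x => F x - qval q x).
  by move=> x Ux; apply: cvgB; [exact: cF|exact: cq].
have cUr : crect a1 b1 a2 b2 `<=` U by rewrite -E.
have cz' : crect a1 b1 a2 b2 z by rewrite -E.
have cc' : crect a1 b1 a2 b2 (cell_center m c) by rewrite -E; exact: ccell_center.
have := hM U a1 b1 a2 b2 _ _ _ _ oU ab1 ab2 cUr cu p0 p1 p01 z (cell_center m c) cz' cc'.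
(* The polynomial takes the value of [F] at the centre, so the oscillation estimate bounds the error
   itself. *)
have -> : F z - qval q z - (F (cell_center m c) - qval q (cell_center m c)) = F z - qval q z.
  by rewrite /qval qcE q0E !subrr !(mulr0, addr0, subr0) subrr subr0.
move=> /le_trans; apply; rewrite s1 s2 -E ler_pM2l//.
have comp : compact (@ccell R m c) by rewrite E; exact: compact_crect.
have icc w : loc_integrable U w -> mu.-integrable (ccell m c : set T2) (EFin \o (fun x => `|w x|)).
  by move=> lw; exact: (integrable_norm (lw _ comp cU)).
have ic w : loc_integrable U w -> mu.-integrable (cell m c : set T2) (EFin \o (fun x => `|w x|)).
  move=> lw; apply: integrableS (icc _ lw) => //; [exact: measurable_ccell|exact: measurable_cell|exact: cell_sub_ccell].
have cst_int (k : R) : mu.-integrable (cell m c : set T2) (EFin \o (fun=> k)).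
  apply: (@integrableS _ _ _ mu (ccell m c)); [exact: measurable_ccell|exact: measurable_cell|exact: cell_sub_ccell|].
  by apply: (continuous_on_loc_integrable openT _ comp) => // x _; exact: cst_continuous.
have key w v V (D : R * R -> R) (k : R) : is_weak_partial U w (fun x => F x - qval q x) (fun x => V x - D x) ->
    L1 v -> (forall x, U x -> v x = V x) ->
    (forall x, ccell m c x -> `|dmean m v c - D x| <= k) ->
    \int[mu]_(x in ccell m c) `|V x - D x| <= r ^+ 2 * (dmean m (osc m v) c + k).
  move=> [_ lVD _] iv vV hk; rewrite Rintegral_ccell; last exact: icc.
  rewrite ler_pM2l ?exprn_gt0//.
  have io := L1_cell m c (L1_osc m iv).
  have ios : mu.-integrable (cell m c : set T2) (EFin \o (fun x => osc m v x + k)).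
    exact: (integrableD (measurable_cell m c) io (cst_int k)).
  apply: (@le_trans _ _ (dmean m (fun x => osc m v x + k) c)).
    apply: le_dmean => //; first exact: ic.
    move=> x xc; have xcc := cell_sub_ccell xc.
    rewrite -vV; last exact: cU.
    rewrite (_ : v x - D x = (v x - dproj m v x) + (dmean m v c - D x)).
      by apply: le_trans (ler_normD _ _) _; rewrite lerD// hk.
    by rewrite /dproj xc; ring.
  rewrite /dmean (RintegralD (measurable_cell m c) io (cst_int k)) mulrDr lerD2l.
  by rewrite -/(dmean m (fun=> k) c) dmean_cst.
have k01 := key _ _ _ _ 0 p01 i01 e01.
have k0 := key _ _ _ _ (r * (`|q11 q| + `|q12 q|)) p0 i0 e0.
have k1 := key _ _ _ _ (r * (`|q12 q| + `|q22 q|)) p1 i1 e1.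
have h01 : \int[mu]_(x in ccell m c) `|V01 x - partials (rev [:: 0; 1]) (qval q) x| <=
    r ^+ 2 * dmean m (osc m v01) c.
  rewrite -[dmean _ _ _]addr0; apply: k01 => x _.
  by rewrite /= partial2_qval /qhess /= q12E subrr normr0.
have h0 : \int[mu]_(x in ccell m c) `|V0 x - partials (rev [:: 0]) (qval q) x| <=
    r ^+ 2 * (dmean m (osc m v0) c + r * (`|q11 q| + `|q12 q|)).
  apply: k0 => x xc; have [d1 d2] := ccell_center_dist xc.
  rewrite /= partial_qval /qgrad /= /qd1 qcE -q1E.
  rewrite (_ : _ - _ = - (q11 q * (x.1 - (cell_center m c).1) + q12 q * (x.2 - (cell_center m c).2))); last by ring.
  rewrite normrN; apply: le_trans (ler_normD _ _) _; rewrite !normrM mulrDr [r * _]mulrC [r * `|q12 q|]mulrC.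
  by rewrite lerD// ler_wpM2l.
have h1 : \int[mu]_(x in ccell m c) `|V1 x - partials (rev [:: 1]) (qval q) x| <=
    r ^+ 2 * (dmean m (osc m v1) c + r * (`|q12 q| + `|q22 q|)).
  apply: k1 => x xc; have [d1 d2] := ccell_center_dist xc.
  rewrite /= partial_qval /qgrad /= /qd2 qcE -q2E.
  rewrite (_ : _ - _ = - (q12 q * (x.1 - (cell_center m c).1) + q22 q * (x.2 - (cell_center m c).2))); last by ring.
  rewrite normrN; apply: le_trans (ler_normD _ _) _; rewrite !normrM mulrDr [r * _]mulrC [r * `|q22 q|]mulrC.
  by rewrite lerD// ler_wpM2l.
have Mr : 0 <= M / r by rewrite divr_ge0// ltW.
have h0' := ler_wpM2l Mr h0; have h1' := ler_wpM2l Mr h1.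
apply: le_trans (lerD (lerD h01 h0') h1') _.
have alg (A B C D G : R) : r ^+ 2 * A + M / r * (r ^+ 2 * (B + r * D)) + M / r * (r ^+ 2 * (C + r * G)) =
    r ^+ 2 * A + M * r * (B + C) + M * r ^+ 2 * (D + G) by field; rewrite gt_eqF.
rewrite alg (_ : _ + _ + (`|q12 q| + `|q22 q|) = `|q11 q| + 2 * `|q12 q| + `|q22 q|)//.
by rewrite mulr_natl mulr2n !addrA.
Qed.

End QuadApprox.

(** * Consequences of small averages on a cell *)

Section GoodCells.
Context {R : realType}.
Local Notation T2 := (measurableTypeR R * measurableTypeR R)%type.
Local Notation mu := (leb2 R).

Lemma L1_sum (I : finType) (w : I -> T2 -> R) : (forall i, L1 (w i)) ->
  L1 (fun x => \sum_i w i x) /\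
  \int[mu]_x (\sum_i w i x) = \sum_i \int[mu]_x w i x.
Proof.
move=> iw; elim: (index_enum I) => [|i s [ih1 ih2]].
  rewrite big_nil; have -> : (fun x : T2 => \sum_(i <- [::]) w i x) = (fun=> 0).
    by apply/funext => x; rewrite big_nil.
  by split; [exact: integrable0|rewrite /Rintegral integral0_eq].
have -> : (fun x : T2 => \sum_(j <- i :: s) w j x) = (fun x => w i x + \sum_(j <- s) w j x).
  by apply/funext => x; rewrite big_cons.
split; first exact: L1D.
by rewrite big_cons -ih2 (RintegralD measurableT (iw i) ih1).
Qed.

Lemma Rintegral_norm_EFin (w : T2 -> R) : L1 w ->
  (\int[mu]_x `|w x|%:E = (\int[mu]_x `|w x|)%:E)%E.
Proof.
by move=> iw; rewrite /Rintegral fineK//; apply: integrable_fin_num => //; exact: L1_norm.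
Qed.

Lemma ge0_Rintegral_EFin (w : T2 -> R) : L1 w -> (\int[mu]_x (w x)%:E = (\int[mu]_x w x)%:E)%E.
Proof. by move=> iw; rewrite /Rintegral fineK//; exact: integrable_fin_num. Qed.

Lemma Rintegral_dproj_le m (w : T2 -> R) : L1 w ->
  \int[mu]_x `|dproj m w x| <= \int[mu]_x `|w x|.
Proof.
move=> iw; have := le_integral_dproj m iw.
by rewrite !Rintegral_norm_EFin ?lee_fin//; exact: L1_dproj.
Qed.

Lemma osc_ge0 m (w : T2 -> R) x : 0 <= osc m w x.
Proof. by rewrite /osc. Qed.

Lemma osc_cvg (w : T2 -> R) : L1 w -> forall e : R, 0 < e ->
  exists m0, forall m, (m0 <= m)%N -> \int[mu]_x osc m w x < e.
Proof.
move=> iw e e0; have [m0 h] := dproj_cvg iw e0; exists m0 => m /h.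
have iB : L1 (fun x => w x - dproj m w x) by apply: L1B => //; exact: L1_dproj.
by rewrite (Rintegral_norm_EFin iB) lte_fin.
Qed.

Lemma osc_sum_cvg (I : finType) (w : I -> T2 -> R) : (forall i, L1 (w i)) ->
  forall e : R, 0 < e ->
  exists m0, forall m, (m0 <= m)%N -> \sum_i \int[mu]_x osc m (w i) x < e.
Proof.
move=> iw; elim: (index_enum I) => [|i s ih] e e0.
  by exists 0%N => m _; rewrite big_nil.
have e20 : 0 < e / 2 by rewrite divr_gt0.
have [m1 h1] := osc_cvg (iw i) e20; have [m2 h2] := ih _ e20.
exists (maxn m1 m2) => m; rewrite geq_max => /andP[/h1 {}h1 /h2 {}h2].
by rewrite big_cons [e]splitr ltrD.
Qed.

Lemma ler_sum1 (I : finType) (F : I -> R) i : (forall j, 0 <= F j) -> F i <= \sum_j F j.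
Proof. by move=> F0; rewrite (bigD1 i)//= lerDl sumr_ge0. Qed.

(** Markov's inequality for the averaged function, whose integral is at most that of [phi] by
    contraction. *)
Lemma leb2_dmean_ge1 m (phi : T2 -> R) (A : set T2) : L1 phi -> (forall x, 0 <= phi x) ->
  measurable A -> (forall x, A x -> 1 <= dmean m phi (cidx m x)) ->
  (mu A <= (\int[mu]_x phi x)%:E)%E.
Proof.
move=> iphi phi0 mA hA.
have iE := L1_dproj m iphi.
have -> : mu A = (\int[mu]_x (\1_A x)%:E)%E by rewrite integral_indic// setIT.
apply: (@le_trans _ _ (\int[mu]_x `|dproj m phi x|%:E)%E).
  apply: ge0_le_integral => //.
  - by apply/measurable_EFinP; exact: measurable_indic.
  - exact: measurable_normE (L1_measurable iE).
  move=> x _; rewrite lee_fin indicE; case: (boolP (x \in A)) => [|_]; last exact: normr_ge0.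
  by rewrite inE => /hA h; apply: le_trans (ler_norm _).
apply: le_trans (le_integral_dproj m iphi) _.
rewrite (Rintegral_norm_EFin iphi) lee_fin.
by under eq_Rintegral do rewrite ger0_norm//.
Qed.

Lemma dmean_lt1 m (phi : T2 -> R) c : L1 phi -> dmean m phi c < 1 ->
  exists2 x, cell m c x & phi x < 1.
Proof.
move=> iphi h; apply: contrapT => nex; move: h; rewrite ltNge => /negP; apply.
have comp : compact (@ccell R m c) by rewrite ccellE; exact: compact_crect.
have ic : mu.-integrable (cell m c : set T2) (EFin \o (fun=> 1)).
  apply: (@integrableS _ _ _ mu (ccell m c)); [exact: measurable_ccell|exact: measurable_cell|exact: cell_sub_ccell|].
  by apply: (continuous_on_loc_integrable openT _ comp) => // x _; exact: cst_continuous.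
rewrite -(dmean_cst m 1 c); apply: le_dmean => //; first exact: L1_cell.
move=> x xc; rewrite leNgt; apply/negP => hx; by apply: nex; exists x.
Qed.

Lemma dmean_lt m (w phi : T2 -> R) c (e : R) : 0 < e -> L1 w -> L1 phi ->
  (forall x, e^-1 * w x <= phi x) -> dmean m phi c < 1 -> dmean m w c < e.
Proof.
move=> e0 iw iphi h d1; have : e^-1 * dmean m w c < 1.
  apply: le_lt_trans d1; rewrite -dmeanZ//; apply: le_dmean; [|exact: L1_cell|by move=> x _].
  by apply: L1_cell; exact: L1Z.
by rewrite mulrC ltr_pdivrMr// mul1r.
Qed.

Lemma qd_center m c (q : @quadratic R) (C : R) x : qc q = cell_center m c ->
  `|q11 q| <= C -> `|q12 q| <= C -> `|q22 q| <= C -> ccell m c x ->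
  `|qd1 q x - q1 q| <= 2 * C * mesh m /\ `|qd2 q x - q2 q| <= 2 * C * mesh m.
Proof.
move=> qcE h11 h12 h22 /ccell_center_dist[d1 d2].
rewrite /qd1 /qd2 qcE; move: (cell_center m c) d1 d2 => z d1 d2; split.
  rewrite (_ : _ - _ = q11 q * (x.1 - z.1) + q12 q * (x.2 - z.2)); last by ring.
  apply: le_trans (ler_normD _ _) _; rewrite !normrM (_ : 2 * C * _ = C * mesh m + C * mesh m); last by ring.
  by apply: lerD; apply: ler_pM.
rewrite (_ : _ - _ = q12 q * (x.1 - z.1) + q22 q * (x.2 - z.2)); last by ring.
apply: le_trans (ler_normD _ _) _; rewrite !normrM (_ : 2 * C * _ = C * mesh m + C * mesh m); last by ring.
by apply: lerD; apply: ler_pM.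
Qed.

Lemma ler_normM2 (a b s t : R) : `|a| <= s -> `|b| <= t -> - (s * t) <= a * b <= s * t.
Proof. by move=> ha hb; rewrite -ler_norml normrM ler_pM. Qed.

Lemma det_perturb (C t a b c d a' b' c' d' : R) : 0 <= t ->
  `|a| <= C -> `|b| <= C -> `|c| <= C -> `|d| <= C ->
  `|a' - a| <= t -> `|b' - b| <= t -> `|c' - c| <= t -> `|d' - d| <= t ->
  `|(a' * d' - b' * c') - (a * d - b * c)| <= 4 * C * t + 2 * t * t.
Proof.
move=> t0 ha hb hc hd ka kb kc kd.
rewrite (_ : _ - _ - _ = a * (d' - d) + d * (a' - a) + (a' - a) * (d' - d)
  - (b * (c' - c) + c * (b' - b) + (b' - b) * (c' - c))); last by ring.
have /andP[? ?] := ler_normM2 ha kd; have /andP[? ?] := ler_normM2 hd ka.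
have /andP[? ?] := ler_normM2 ka kd; have /andP[? ?] := ler_normM2 hb kc.
have /andP[? ?] := ler_normM2 hc kb; have /andP[? ?] := ler_normM2 kb kc.
by rewrite ler_norml; apply/andP; split; lra.
Qed.

Lemma ccell_mid m c x y : @ccell R m c x -> ccell m c y -> ccell m c (qmid x y).
Proof.
rewrite /ccell /qmid /= => -[/andP[? ?] /andP[? ?]] [/andP[? ?] /andP[? ?]].
by split; apply/andP; split; lra.
Qed.

Section OneCell.
Variables (m : nat) (c : int * int) (p q : @quadratic R) (C D : R).
Local Notation r := (mesh m).
Hypotheses (pc : qc p = cell_center m c) (qcE : qc q = cell_center m c).
Hypotheses (C1 : 0 <= C) (D0 : 0 < D).
Hypotheses (hp1 : `|q1 p| <= C) (hp2 : `|q2 p| <= C) (hq1 : `|q1 q| <= C) (hq2 : `|q2 q| <= C).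
Hypotheses (hp11 : `|q11 p| <= C) (hp12 : `|q12 p| <= C) (hp22 : `|q22 p| <= C).
Hypotheses (hq11 : `|q11 q| <= C) (hq12 : `|q12 q| <= C) (hq22 : `|q22 q| <= C).
Hypothesis hdet : D <= q1 p * q2 q - q2 p * q1 q.

(** Within the cell the gradients move by at most t = 2 C r, so [det_perturb] changes the
    determinant by at most 4 C t + 2 t^2. Since r <= 1, both terms are at most 8 C^2 r, whence the
    constant 16. *)
Lemma qjac_cell_neq0 x : 16 * C * C * r < D -> ccell m c x -> qjac p q x != 0.
Proof.
move=> hr cx.
have r0 := @mesh_gt0 R m.
have r1 : r <= 1 :> R by rewrite /mesh invf_le1 ?exprn_gt0// exprn_ege1// ler1n.
have [p1 p2] := qd_center pc hp11 hp12 hp22 cx.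
have [t1 t2] := qd_center qcE hq11 hq12 hq22 cx.
have t0 : 0 <= 2 * C * r by rewrite !mulr_ge0// ltW.
have := det_perturb t0 hp1 hp2 hq1 hq2 p1 p2 t1 t2.
rewrite -/(qjac p q x) => h.
have CC : 2 * (2 * C * r) * (2 * C * r) <= 8 * C * C * r.
  rewrite (_ : 2 * (2 * C * r) * (2 * C * r) = 8 * C * C * r * r); last by ring.
  by rewrite ler_piMr// !mulr_ge0// ltW.
have : 0 < qjac p q x.
  move: h; rewrite ler_norml => /andP[h _]; move: h CC hr hdet.
  rewrite (_ : 4 * C * (2 * C * r) = 8 * C * C * r); last by ring.
  rewrite (_ : 16 * C * C * r = 8 * C * C * r + 8 * C * C * r); last by ring.
  by move: (8 * C * C * r) (2 * _ * _) (_ * _ - _) => X Y Z; lra.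
by move=> /lt0r_neq0.
Qed.

Variable f : R * R -> R * R.
Hypothesis cf : forall x, ccell m c x -> {for x, continuous f}.

(** [almost_affine_surj] for [f] around [x0], with target g(x0) and the gradients at the centre as
    linear part. The error consists of |f - g| <= eta r and of two gradient variations 2 C r acting
    over a distance at most s <= r. Cramer's rule multiplies it by at most 2 C / D, and the result
    has to be below [s]. *)
Lemma qmap_in_image (eta s : R) x0 : 0 < s -> s <= r ->
  sq x0 s `<=` cell m c -> 0 <= eta ->
  (forall z, ccell m c z -> `|(f z).1 - qval p z| <= eta * r /\ `|(f z).2 - qval q z| <= eta * r) ->
  2 * C * (eta + 4 * C * r) * r < D * s ->
  exists2 z, cell m c z & f z = qmap p q x0.
Proof.
move=> s0 sr sc eta0 hf hs.
have r0 := @mesh_gt0 R m.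
have x0c : ccell m c x0.
  by apply: cell_sub_ccell; apply: sc; split; rewrite subrr normr0 ltW.
have DN : q1 p * q2 q - q2 p * q1 q != 0 by rewrite gt_eqF// (lt_le_trans D0).
have [||z zs fz] := @almost_affine_surj R x0 (qmap p q x0) s (q1 p) (q2 p) (q1 q) (q2 q) f s0 DN.
- by move=> x /sc/cell_sub_ccell; exact: cf.
- move=> x xs; have xc := cell_sub_ccell (sc _ xs); case: xs => hX hY.
  have [f1 f2] := hf _ xc; move=> /=.
  have rem (w : @quadratic R) (z : R) : qc w = cell_center m c ->
      `|q11 w| <= C -> `|q12 w| <= C -> `|q22 w| <= C -> `|z - qval w x| <= eta * r ->
      `|z - qval w x0 - (q1 w * (x.1 - x0.1) + q2 w * (x.2 - x0.2))| <= (eta + 4 * C * r) * r.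
    move=> wc w11 w12 w22 hz.
    have [k1 k2] := qd_center wc w11 w12 w22 (ccell_mid xc x0c).
    have := qvalB w x x0; set mid := qmid x x0 in k1 k2 *.
    move=> hq; rewrite (_ : _ - _ - _ = (z - qval w x) + ((qd1 w mid - q1 w) * (x.1 - x0.1) +
       (qd2 w mid - q2 w) * (x.2 - x0.2))); last first.
      rewrite (_ : z - qval w x0 = (z - qval w x) + (qval w x - qval w x0)); last by ring.
      by rewrite hq; ring.
    apply: le_trans (ler_normD _ _) _; rewrite [leRHS]mulrDl; apply: lerD => //.
    apply: le_trans (ler_normD _ _) _; rewrite !normrM.
    rewrite (_ : 4 * C * r * r = 2 * C * r * r + 2 * C * r * r); last by ring.
    by apply: lerD; apply: ler_pM => //; [exact: le_trans sr|exact: le_trans sr].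
  have e1 := rem p _ pc hp11 hp12 hp22 f1; have e2 := rem q _ qcE hq11 hq12 hq22 f2.
  move: e1 e2; set e1 := _ - _ - _; set e2 := (f x).2 - _ - _ => he1 he2.
  have fin (u v : R) : `|u| <= C -> `|v| <= C ->
      `|(u * e1 - v * e2) / (q1 p * q2 q - q2 p * q1 q)| < s.
    move=> hu hv; rewrite normrM normfV [X in _ / X]gtr0_norm; last exact: lt_le_trans hdet.
    rewrite ltr_pdivrMr; last exact: lt_le_trans hdet.
    apply: (@lt_le_trans _ _ (D * s)); last by rewrite mulrC ler_pM2l.
    apply: le_lt_trans hs; apply: le_trans (ler_normB _ _) _; rewrite !normrM.
    rewrite (_ : 2 * C * _ * r = C * ((eta + 4 * C * r) * r) + C * ((eta + 4 * C * r) * r)); last by ring.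
    by apply: lerD; apply: ler_pM.
  split; first exact: fin.
  rewrite (_ : q1 p * e2 - q1 q * e1 = (- q1 q) * e1 - (- q1 p) * e2); last by ring.
  by apply: fin; rewrite normrN.
by exists z => //; exact: sc.
Qed.

End OneCell.

End GoodCells.

(** * Difference of a Sobolev function and a smooth one *)

Section SobolevDifference.
Context {R : realType}.
Local Notation T2 := (measurableTypeR R * measurableTypeR R)%type.
Local Notation mu := (leb2 R).

Lemma ae_and (P Q : T2 -> Prop) : {ae mu, forall x, P x} -> {ae mu, forall x, Q x} ->
  {ae mu, forall x, P x /\ Q x}.
Proof.
by move=> hP hQ; have := @filterI _ _ (ae_filter_ringOfSetsType mu) _ _ hP hQ.
Qed.

(** Testing on tensor products suffices by [weak_partial_test0], and on these both mixed partials
    are the product of the two derivatives. *)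
Lemma weak_mixed_comm U (u v v' : R * R -> R) : open U ->
  is_weak_partial U [:: 0; 1] u v -> is_weak_partial U [:: 1; 0] u v' ->
  {ae mu, forall x, U x -> v x = v' x}.
Proof.
move=> oU [iu iv hv] [_ iv' hv'].
have iB : loc_integrable U (fun x => v x - v' x).
  by move=> K cK KU; apply: (@integrableB _ _ _ mu K _ (EFin \o v) (EFin \o v'));
    [exact: compact_measurable2|exact: iv|exact: iv'].
suff h : {ae mu, forall x, U x -> v x - v' x = 0}.
  by apply: ae_mono h _ => x h /h /subr0_eq.
apply: weak_partial_test0 => // a b ga gb tab.
have sw : partials [:: 1; 0] (tens a b) = partials [:: 0; 1] (tens a b) :> (R * R -> R).
  have [a' _ da] := flat_gen_derive ga; have [b' _ db] := flat_gen_derive gb.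
  have [_ _ ->] := partial_tens da db.
  have eb : partial 0 (tens a b) = tens a' b.
    by apply/funext => x; apply: partial_is_derive; exact: is_derive_tens0.
  rewrite /partials /= -/(partial _ _) eb.
  by apply/funext => x; apply: partial_is_derive; exact: is_derive_tens1.
have := hv _ tab; rewrite -sw; have -> := hv' _ tab.
rewrite /= sqrrN !expr1n !mul1r => e.
have -> : (fun x => (v x - v' x) * tens a b x) = (fun x => v x * tens a b x - v' x * tens a b x).
  by apply/funext => x; rewrite mulrBl.
have i1 := loc_integrableM oU iv tab; have i2 := loc_integrableM oU iv' tab.
by rewrite (RintegralB (open_measurable2 oU) i1 i2); apply/eqP; rewrite subr_eq0; apply/eqP.
Qed.

(** [weak_partial] is a choice of representative, and those for [U] and for [Omega] agree only
    almost everywhere on [U]. Uniqueness links them, so an almost everywhere bound on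
    [Omega]-derivatives passes to the norm on [U]. *)
Lemma sobolev_diff (Omega U : set (R * R)) (F G B : R * R -> R) :
  open Omega -> open U -> U `<=` Omega -> sobolev1 2 Omega F -> smooth_on U G ->
  L1 B -> (forall x, 0 <= B x) ->
  (forall w, (size w <= 2)%N -> {ae mu, forall x, U x ->
     `|weak_partial Omega w F x - partials (rev w) G x| <= B x}) ->
  sobolev1 2 U (fun x => F x - G x) /\
  forall w, (size w <= 2)%N ->
    (\int[mu]_(x in U) `|weak_partial U w (fun x => (F x - G x)%R) x|%:E <= (\int[mu]_x B x)%:E)%E.
Proof.
move=> oO oU UO sF sG iB B0 hB.
have mU := open_measurable2 oU.
have main w : (size w <= 2)%N ->
  is_weak_partial U w (fun x => F x - G x) (weak_partial U w (fun x => F x - G x)) /\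
  (\int[mu]_(x in U) `|weak_partial U w (fun x => (F x - G x)%R) x|%:E <= (\int[mu]_x B x)%:E)%E.
  move=> sw; have [exF _] := sF w sw; have wF := getPex exF.
  have wU := is_weak_partialB oU (is_weak_partialS UO wF) (smooth_weak_partial w oU sG).
  have wV : is_weak_partial U w (fun x => F x - G x) (weak_partial U w (fun x => F x - G x)).
    by apply: (@getPex _ [set v | is_weak_partial U w (fun x => F x - G x) v]); exists (fun x => weak_partial Omega w F x - partials (rev w) G x).
  split => //.
  have mV : measurable_fun (U : set T2) (weak_partial U w (fun x => F x - G x)).
    by case: wV => _ iV _; exact: loc_integrable_measurable.
  have mB := L1_measurable iB.
  rewrite -ge0_Rintegral_EFin//.
  apply: (@le_trans _ _ (\int[mu]_(x in U) (B x)%:E)%E); last first.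
    apply: ge0_subset_integral => //; first by apply/measurable_EFinP.
    by move=> x _; rewrite lee_fin.
  apply: ae_ge0_le_integral => //.
  - by apply/measurable_EFinP; apply: measurableT_comp => //; exact: normr_measurable.
  - by move=> x _; rewrite lee_fin.
  - by apply/measurable_EFinP; exact: measurable_funTS.
  have e := weak_partial_unique oU wV wU.
  apply: ae_mono (ae_and e (hB w sw)) _ => x [e1 e2] Ux.
  by rewrite lee_fin e1//; exact: e2.
split => [w sw|w sw]; last by have [] := main w sw.
have [wV le] := main w sw; split; first by eexists; exact: wV.
apply/integrableP; split.
  by apply/measurable_EFinP; case: wV => _ iV _; exact: loc_integrable_measurable.
by apply: le_lt_trans le _; rewrite ltry.
Qed.

End SobolevDifference.

(** * Piecewise quadratic interpolation *)

Lemma det2 (K : comPzRingType) (A : 'M[K]_2) : \det A = A 0 0 * A 1 1 - A 0 1 * A 1 0.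
Proof.
rewrite (expand_det_row _ 0) big_ord_recl big_ord1 /cofactor !det_mx11 !mxE /=.
rewrite expr0 mul1r expr1 mulN1r mulrN.
by congr (A _ _ * A _ _ - A _ _ * A _ _); apply/val_inj.
Qed.

Section Interpolation.
Context {R : realType}.
Local Notation T2 := (measurableTypeR R * measurableTypeR R)%type.
Local Notation mu := (leb2 R).
Variables (Omega : set (R * R)) (f : R * R -> R * R).

(** The derivatives whose averages enter the interpolation. One word stands for both mixed
    derivatives, which agree almost everywhere; order 0 is absent because the value is taken at the
    cell centre. *)
Definition deriv_word (t : 'I_5) : seq 'I_2 :=
  nth [::] [:: [:: 0]; [:: 1]; [:: 0; 0]; [:: 0; 1]; [:: 1; 1]] t.

Local Notation F k := (fun x => coordinate k (f x)).

(** Extended by 0 to a function integrable on the whole plane, where the averaging theorem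
    applies. *)
Definition wpart (i : 'I_2 * 'I_5) (x : T2) : R :=
  if x \in Omega then weak_partial Omega (deriv_word i.2) (F i.1) x else 0.

Definition quad m (c : int * int) (k : 'I_2) : quadratic :=
  let E (t : 'I_5) := dmean m (wpart (k, t)) c in
  Quadratic (coordinate k (f (cell_center m c))) (E (@Ordinal 5 0 isT)) (E (@Ordinal 5 1 isT))
    (E (@Ordinal 5 2 isT)) (E (@Ordinal 5 3 isT)) (E (@Ordinal 5 4 isT)) (cell_center m c).

Definition qinterp m (x : R * R) : R * R :=
  qmap (quad m (cidx m x) 0) (quad m (cidx m x) 1) x.

Definition osum m (x : T2) : R := \sum_i osc m (wpart i) x.
Definition nsum (x : T2) : R := \sum_i `|wpart i x|.

Definition degenerate (d : R) : set T2 := [set x | Omega x /\ weak_jacobian Omega f x <= d].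

(* If its mean over a cell is less than 1, then on that cell all partials have
   means bounded by C and oscillations bounded by e in the mean, and at some point
   the Jacobian exceeds d while the partials are e-close to their means. *)
Definition defect (e C d : R) m (x : T2) : R :=
  \1_(degenerate d) x + (e^-1 * osum m x + C^-1 * nsum x).

Hypothesis oO : open Omega.
Hypothesis cf : forall x, Omega x -> {for x, continuous f}.
Hypothesis sf : sobolev1_map 2 Omega f.

Lemma size_deriv_word t : (size (deriv_word t) <= 2)%N.
Proof. by case: t => [[|[|[|[|[|]]]]]]. Qed.

Lemma weak_partialP k w : (size w <= 2)%N ->
  is_weak_partial Omega w (F k) (weak_partial Omega w (F k)).
Proof. by move=> hw; have [ex _] := sf k hw; exact: getPex ex. Qed.

Lemma L1_wpart i : L1 (wpart i).
Proof.
have [_ h] := sf i.1 (size_deriv_word i.2).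
move: h; rewrite (integrable_mkcond _ (open_measurable2 oO)) /L1 => h.
rewrite (_ : EFin \o wpart i = (EFin \o weak_partial Omega (deriv_word i.2) (F i.1)) \_ Omega)//.
by apply/funext => x; rewrite /wpart /patch /=; case: ifP.
Qed.

Lemma wpartE i x : Omega x -> wpart i x = weak_partial Omega (deriv_word i.2) (F i.1) x.
Proof. by move=> Ox; rewrite /wpart mem_set. Qed.

Lemma continuous_coordinate k : continuous_on Omega (F k).
Proof.
move=> x Ox; case: (ord2P k) => ->; rewrite /coordinate /=.
  exact: (continuous_comp (cf Ox) (@continuous_fst R (f x))).
exact: (continuous_comp (cf Ox) (@continuous_snd R (f x))).
Qed.

Lemma quad_error : exists2 M : R, 0 < M & forall m c k z,
  ccell m c `<=` Omega -> ccell m c z ->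
  `|coordinate k (f z) - qval (quad m c k) z| <=
    2 * (mesh m ^+ 2 * dmean m (osc m (wpart (k, @Ordinal 5 3 isT))) c +
      M * mesh m * (dmean m (osc m (wpart (k, @Ordinal 5 0 isT))) c +
                    dmean m (osc m (wpart (k, @Ordinal 5 1 isT))) c) +
      M * mesh m ^+ 2 * (`|q11 (quad m c k)| + 2 * `|q12 (quad m c k)| + `|q22 (quad m c k)|)).
Proof.
have [M M0 hM] := @quad_approx R; exists M => // m c k z cO.
apply: (hM Omega (F k) (weak_partial Omega [:: 0] (F k)) (weak_partial Omega [:: 1] (F k))
  (weak_partial Omega [:: 0; 1] (F k)) _ _ _ m c _ oO cO (@continuous_coordinate k)) => //;
  by [exact: weak_partialP|exact: L1_wpart|move=> x; exact: wpartE].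
Qed.

Lemma L1_osum m : L1 (osum m).
Proof. by have [] := L1_sum (fun i => L1_osc m (L1_wpart i)). Qed.

Lemma L1_nsum : L1 nsum.
Proof. by have [] := L1_sum (fun i => L1_norm (L1_wpart i)). Qed.

Lemma osum_ge0 m x : 0 <= osum m x.
Proof. by apply: sumr_ge0 => i _; exact: osc_ge0. Qed.

Lemma nsum_ge0 x : 0 <= nsum x.
Proof. by apply: sumr_ge0. Qed.

Lemma weak_jacobianE x : weak_jacobian Omega f x =
  weak_partial Omega [:: 0] (F 0) x * weak_partial Omega [:: 1] (F 1) x -
  weak_partial Omega [:: 1] (F 0) x * weak_partial Omega [:: 0] (F 1) x.
Proof. by rewrite /weak_jacobian det2 !mxE. Qed.

Lemma measurable_degenerate d : measurable (degenerate d).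
Proof.
have mO := open_measurable2 oO.
have mw w k : (size w <= 2)%N -> measurable_fun (Omega : set T2) (weak_partial Omega w (F k)).
  by move=> hw; have [_ iv _] := weak_partialP k hw; exact: loc_integrable_measurable.
have mJ : measurable_fun (Omega : set T2) (weak_jacobian Omega f).
  rewrite (_ : weak_jacobian Omega f = (fun x =>
    weak_partial Omega [:: 0] (F 0) x * weak_partial Omega [:: 1] (F 1) x -
    weak_partial Omega [:: 1] (F 0) x * weak_partial Omega [:: 0] (F 1) x)); last first.
    by apply/funext => x; exact: weak_jacobianE.
  by apply: measurable_funB; apply: measurable_funM; exact: mw.
rewrite (_ : degenerate d = Omega `&` weak_jacobian Omega f @^-1` `]-oo, d]%classic).
  exact: mJ.
by apply/seteqP; split => x [Ox]; rewrite /= in_itv.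
Qed.

Hypothesis Ofin : (mu Omega < +oo)%E.

Lemma degenerate_fin d : (mu (degenerate d) < +oo)%E.
Proof.
apply: le_lt_trans Ofin; apply: le_measure; rewrite ?inE; [exact: measurable_degenerate|exact: open_measurable2|].
by move=> x [].
Qed.

Lemma defect_ge0 e C d m x : 0 <= e -> 0 <= C -> 0 <= defect e C d m x.
Proof.
move=> e0 C0; rewrite /defect !addr_ge0// ?mulr_ge0// ?invr_ge0// ?osum_ge0 ?nsum_ge0//.
Qed.

Lemma L1_defect e C d m : L1 (defect e C d m).
Proof.
apply: L1D; first by apply: L1_indic; [exact: measurable_degenerate|exact: degenerate_fin].
by apply: L1D; apply: L1Z; [exact: L1_osum|exact: L1_nsum].
Qed.

Lemma good_cell (e C d : R) m c (q := quad m c) : 0 < e -> 0 < C ->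
  4 * C * e + 2 * e * e <= d / 2 -> ccell m c `<=` Omega ->
  dmean m (defect e C d m) c < 1 ->
  [/\ forall i, dmean m (osc m (wpart i)) c <= e,
      forall i, `|dmean m (wpart i) c| <= C &
      d / 2 <= q1 (q 0) * q2 (q 1) - q2 (q 0) * q1 (q 1)].
Proof.
move=> e0 C0 hd cO good.
have iphi := L1_defect e C d m.
have ind0 x : 0 <= \1_(degenerate d) x :> R by rewrite indicE.
have o1 i x : e^-1 * osc m (wpart i) x <= defect e C d m x.
  apply: (@le_trans _ _ (e^-1 * osum m x)).
    rewrite ler_wpM2l ?invr_ge0 ?(ltW e0)//.
    by apply: (ler_sum1 (F := fun i => osc m (wpart i) x)) => j; exact: osc_ge0.
  rewrite /defect; have : 0 <= C^-1 * nsum x by rewrite mulr_ge0 ?nsum_ge0// invr_ge0 ltW.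
  by have := ind0 x; lra.
have o2 i x : C^-1 * `|wpart i x| <= defect e C d m x.
  apply: (@le_trans _ _ (C^-1 * nsum x)).
    rewrite ler_wpM2l ?invr_ge0 ?(ltW C0)//.
    exact: (ler_sum1 (F := fun i => `|wpart i x|)).
  rewrite /defect; have : 0 <= e^-1 * osum m x by rewrite mulr_ge0 ?osum_ge0// invr_ge0 ltW.
  by have := ind0 x; lra.
have a1 i : dmean m (osc m (wpart i)) c < e.
  by apply: (dmean_lt e0 (L1_osc m (L1_wpart i)) iphi).
have a2 i : `|dmean m (wpart i) c| < C.
  apply: le_lt_trans (norm_dmean _ _ (L1_wpart i)) _.
  exact: (dmean_lt C0 (L1_norm (L1_wpart i)) iphi).
split; [by move=> i; exact: ltW|by move=> i; exact: ltW|].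
(* At a point where all terms together are below 1 the indicator is 0, so the Jacobian exceeds [d];
   the determinant of the means differs from it by at most 4 C e + 2 e^2 <= d / 2. *)
have [z zc hz] := dmean_lt1 iphi good.
have Oz : Omega z by apply: cO; exact: cell_sub_ccell.
have n1 i : `|wpart i z| <= C.
  by have := le_lt_trans (o2 i z) hz; rewrite mulrC ltr_pdivrMr// mul1r => /ltW.
have n2 i : `|dmean m (wpart i) c - wpart i z| <= e.
  have := le_lt_trans (o1 i z) hz; rewrite mulrC ltr_pdivrMr// mul1r => /ltW.
  by rewrite /osc /dproj (zc : cidx m z = c) distrC.
have zJ : d < weak_jacobian Omega f z.
  rewrite ltNge; apply/negP => hJ; move: hz; rewrite /defect indicE mem_set//=.
  have : 0 <= e^-1 * osum m z by rewrite mulr_ge0 ?osum_ge0// invr_ge0 ltW.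
  have : 0 <= C^-1 * nsum z by rewrite mulr_ge0 ?nsum_ge0// invr_ge0 ltW.
  by lra.
move: zJ; rewrite weak_jacobianE.
rewrite -(wpartE (0, @Ordinal 5 0 isT) Oz) -(wpartE (1, @Ordinal 5 1 isT) Oz).
rewrite -(wpartE (0, @Ordinal 5 1 isT) Oz) -(wpartE (1, @Ordinal 5 0 isT) Oz) => zJ.
have := det_perturb (ltW e0) (n1 (0, @Ordinal 5 0 isT)) (n1 (0, @Ordinal 5 1 isT))
  (n1 (1, @Ordinal 5 0 isT)) (n1 (1, @Ordinal 5 1 isT))
  (n2 (0, @Ordinal 5 0 isT)) (n2 (0, @Ordinal 5 1 isT))
  (n2 (1, @Ordinal 5 0 isT)) (n2 (1, @Ordinal 5 1 isT)).
rewrite /q /quad /= ler_norml => /andP[+ _].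
move: (dmean m _ _ * _ - _) (4 * C * e + _) hd => B t hd.
move: zJ; move: (wpart _ _ * _ - _) => A; clear -hd => zJ h.
by move: h; rewrite lerBrDr => h; lra.
Qed.

End Interpolation.

(** * The interpolation on the remaining set *)

Section OnGoodCells.
Context {R : realType}.
Local Notation T2 := (measurableTypeR R * measurableTypeR R)%type.
Local Notation mu := (leb2 R).

Lemma off_frame_sq m k (x : R * R) : off_frame m k x -> sq x (mesh (m + k)) `<=` cell m (cidx m x).
Proof.
move=> [/andP[a1 a2] /andP[b1 b2]] y [].
rewrite !ler_norml => /andP[? ?] /andP[? ?].
have side (i : int) : (i + 1)%:~R * mesh m = i%:~R * mesh m + mesh m :> R.
  by rewrite intrD mulrDl mul1r.
by rewrite cellE; split; rewrite /= in_itv /=; apply/andP; split; lra.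
Qed.

Lemma near_cidx m (s : R) (x : R * R) : 0 < s -> sq x s `<=` cell m (cidx m x) ->
  \forall y \near x, cidx m y = cidx m x.
Proof.
move=> s0 h; apply/nbhs2P; exists s => // y h1 h2.
by apply: h; split; exact: ltW.
Qed.

(** On a good cell the error of [quad_error] is a small multiple of the side: the first-order
    oscillations contribute 4 N e, and all the rest carries one more factor r. *)
Lemma quad_error_le (N e r C A B D X Y Z : R) : 0 <= N -> 0 <= e -> 0 < r -> e <= 1 -> 0 <= C ->
  A <= e -> B <= e -> D <= e -> X <= C -> Y <= C -> Z <= C ->
  2 * (r ^+ 2 * A + N * r * (B + D) + N * r ^+ 2 * (X + 2 * Y + Z)) <=
  (4 * N * e + r * (2 + 8 * N * C)) * r.
Proof.
move=> N0 e0 r0 e1 C0 hA hB hD hX hY hZ.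
rewrite (_ : (4 * N * e + r * (2 + 8 * N * C)) * r =
  2 * (r ^+ 2 * 1 + N * r * (e + e) + N * r ^+ 2 * (C + 2 * C + C))); last by ring.
have r20 : 0 <= r ^+ 2 by rewrite sqr_ge0.
have Nr : 0 <= N * r by apply: mulr_ge0 => //; exact: ltW.
have Nr2 : 0 <= N * r ^+ 2 by rewrite mulr_ge0.
by rewrite ler_pM2l//; apply: lerD; [apply: lerD|]; apply: ler_wpM2l => //; lra.
Qed.

(** The same error bounded linearly in sums [S] of mean oscillations and [T] of means, a form that
    can be integrated over the plane. *)
Lemma quad_error_le2 (N r A B D X Y Z S T : R) : 0 <= N -> 0 < r -> r <= 1 -> 0 <= S ->
  A <= S -> B <= S -> D <= S -> X <= T -> Y <= T -> Z <= T -> 0 <= T ->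
  2 * (r ^+ 2 * A + N * r * (B + D) + N * r ^+ 2 * (X + 2 * Y + Z)) <=
  (2 + 4 * N) * S + 8 * N * r * T.
Proof.
move=> N0 r0 r1 S0 hA hB hD hX hY hZ T0.
rewrite (_ : (2 + 4 * N) * S + 8 * N * r * T = 2 * (1 * S + N * 1 * (S + S) + N * r * (4 * T))); last by ring.
have r20 : 0 <= r ^+ 2 by rewrite sqr_ge0.
have r21 : r ^+ 2 <= 1 by rewrite expr_le1// ltW.
have r22 : r ^+ 2 <= r by rewrite expr2 ler_piMl// ltW.
rewrite ler_pM2l//; apply: lerD; [apply: lerD|].
- by apply: (@le_trans _ _ (r ^+ 2 * S)); [exact: ler_wpM2l|exact: ler_wpM2r].
- apply: (@le_trans _ _ (N * r * (S + S))); first by apply: ler_wpM2l; [apply: mulr_ge0 => //; exact: ltW|lra].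
  by apply: ler_wpM2r; [exact: addr_ge0|exact: ler_wpM2l].
apply: (@le_trans _ _ (N * r ^+ 2 * (4 * T))).
  by apply: ler_wpM2l; [exact: mulr_ge0|lra].
by apply: ler_wpM2r; [lra|exact: ler_wpM2l].
Qed.

Lemma mesh_le1 m : mesh m <= 1 :> R.
Proof. by rewrite /mesh invf_le1 ?exprn_gt0// exprn_ege1// ler1n. Qed.

Variables (Omega : set (R * R)) (f : R * R -> R * R).
Hypothesis oO : open Omega.
Hypothesis cf : forall x, Omega x -> {for x, continuous f}.
Hypothesis injf : forall x y, Omega x -> Omega y -> f x = f y -> x = y.
Hypothesis sf : sobolev1_map 2 Omega f.
Hypothesis Ofin : (mu Omega < +oo)%E.
Variable M : R.
Hypothesis M0 : 0 < M.
Local Notation q := (quad Omega f).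
Local Notation wpart := (wpart Omega f).
Hypothesis hM : forall m c k z,
  ccell m c `<=` Omega -> ccell m c z ->
  `|coordinate k (f z) - qval (q m c k) z| <=
    2 * (mesh m ^+ 2 * dmean m (osc m (wpart (k, @Ordinal 5 3 isT))) c +
      M * mesh m * (dmean m (osc m (wpart (k, @Ordinal 5 0 isT))) c +
                    dmean m (osc m (wpart (k, @Ordinal 5 1 isT))) c) +
      M * mesh m ^+ 2 * (`|q11 (q m c k)| + 2 * `|q12 (q m c k)| + `|q22 (q m c k)|)).

Variables (e C d : R) (m n : nat).
Local Notation r := (mesh m : R).
Hypotheses (e0 : 0 < e) (e1 : e <= 1) (C1 : 1 <= C) (d0 : 0 < d).
Hypothesis he : 4 * C * e + 2 * e * e <= d / 2.
Hypothesis hr : 16 * C * C * r < d / 2.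
(** The relative error |f - g| / r on a good cell, from [quad_error_le]. The next hypothesis
    compares it with the width [mesh (m + n)] of the frame. *)
Let eta := 4 * M * e + r * (2 + 8 * M * C).
Hypothesis hs : 2 * C * (eta + 4 * C * r) * r < d / 2 * mesh (m + n).
Variable U : set (R * R).
Hypothesis oU : open U.
Hypothesis hU : forall x, U x -> [/\ inner m Omega x,
  ~ (1 <= dmean m (defect Omega f e C d m) (cidx m x)) & off_frame m n x].

Let C0 : 0 < C. Proof. exact: lt_le_trans C1. Qed.

Lemma removed_sub : U `<=` Omega.
Proof. by move=> x /hU[/innerS]. Qed.

Let good x : U x -> [/\ ccell m (cidx m x) `<=` Omega,
  forall i, dmean m (osc m (wpart i)) (cidx m x) <= e,
  forall i, `|dmean m (wpart i) (cidx m x)| <= C &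
  d / 2 <= q1 (q m (cidx m x) 0) * q2 (q m (cidx m x) 1) - q2 (q m (cidx m x) 0) * q1 (q m (cidx m x) 1)].
Proof.
move=> /hU[iO /negP]; rewrite -ltNge => hd _.
by have [? ? ?] := good_cell oO sf Ofin e0 C0 he iO hd.
Qed.

Lemma quad_close x k z : U x -> ccell m (cidx m x) z ->
  `|coordinate k (f z) - qval (q m (cidx m x) k) z| <= eta * r.
Proof.
move=> Ux zc; have [cO h1 h2 _] := good Ux.
apply: le_trans (hM k cO zc) _.
by apply: quad_error_le; [exact: ltW|exact: ltW|exact: mesh_gt0|exact: e1|exact: ltW|..];
  [exact: h1|exact: h1|exact: h1|exact: h2|exact: h2|exact: h2].
Qed.

Lemma cell_quad (x : R * R) : U x -> forall z, ccell m (cidx m x) z ->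
  qjac (q m (cidx m x) 0) (q m (cidx m x) 1) z != 0.
Proof.
move=> Ux z zc; have [cO _ h2 hd] := good Ux.
have C0' := ltW C0; have d20 : 0 < d / 2 by rewrite divr_gt0.
by apply: (@qjac_cell_neq0 R m (cidx m x) _ _ C (d / 2)) => //; exact: h2.
Qed.

Lemma qinterp_in_image (x : R * R) : U x ->
  exists2 z, cell m (cidx m x) z & f z = qinterp Omega f m x.
Proof.
move=> Ux; have [cO _ h2 hd] := good Ux; have [_ _ xn] := hU Ux.
have C0' := ltW C0; have d20 : 0 < d / 2 by rewrite divr_gt0.
have r0 := @mesh_gt0 R m.
apply: (@qmap_in_image R m (cidx m x) (q m (cidx m x) 0) (q m (cidx m x) 1) C (d / 2) _ _ _ _ _ _ _ _ _ _ _ _ _ hd f _ eta (mesh (m + n)) x) => //.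
all: try exact: h2.
- by move=> y yc; apply: cf; exact: cO.
- exact: mesh_gt0.
- by rewrite meshD ler_piMr ?mesh_le1// ltW.
- exact: off_frame_sq.
- by rewrite /eta addr_ge0 ?mulr_ge0 ?addr_ge0 ?mulr_ge0 ?ltW.
by move=> z zc; split; [exact: (quad_close 0 Ux zc)|exact: (quad_close 1 Ux zc)].
Qed.

(* The values of the interpolation are values of f in the same cell, so points of
   different cells have different images. *)
Lemma qinterp_inj (x y : R * R) : U x -> U y -> qinterp Omega f m x = qinterp Omega f m y -> x = y.
Proof.
move=> Ux Uy e12; have [cOx _ _ _] := good Ux; have [cOy _ _ _] := good Uy.
have exy : cidx m x = cidx m y.
  have [z zx fz] := qinterp_in_image Ux; have [z' zy fz'] := qinterp_in_image Uy.
  have zz : z = z'.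
    apply: injf; [by apply: cOx; exact: cell_sub_ccell|by apply: cOy; exact: cell_sub_ccell|].
    by rewrite fz fz'.
  by rewrite -(zx : cidx m z = _) zz.
move: e12; rewrite /qinterp -exy; apply: qmap_inj; apply: cell_quad => //.
by apply: ccell_mid; apply: cell_sub_ccell => //; rewrite /cell /= -exy.
Qed.

Lemma qinterp_near (x : R * R) : U x -> \forall y \near x,
  qinterp Omega f m y = qmap (q m (cidx m x) 0) (q m (cidx m x) 1) y.
Proof.
move=> Ux; have [_ _ /off_frame_sq xn] := hU Ux.
by apply: filterS (near_cidx (mesh_gt0 _) xn) => y; rewrite /qinterp => ->.
Qed.

Lemma qinterp_diffeo : diffeomorphism_onto_image U (qinterp Omega f m).
Proof.
apply: piecewise_quadratic_diffeo => //; first exact: qinterp_inj.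
move=> x Ux; exists (q m (cidx m x) 0), (q m (cidx m x) 1); split; last exact: qinterp_near.
by apply: cell_quad => //; exact: cell_sub_ccell.
Qed.

(** One majorant for all partials of f - g of order at most 2, up to null sets. The first sum comes
    from the uniform estimate, [osum] from the derivatives compared with their means, and the last
    sum carries a factor r: 8 M again from the uniform estimate and 2 from the variation of the
    gradient inside a cell. *)
Definition sobolev_error (x : T2) : R :=
  (2 + 4 * M) * (\sum_i dproj m (osc m (wpart i)) x) + osum Omega f m x +
  (8 * M + 2) * r * (\sum_i `|dproj m (wpart i) x|).

Lemma dproj_osc_ge0 i x : 0 <= dproj m (osc m (wpart i)) x.
Proof.
have := @le_dmean R m (fun=> 0) (osc m (wpart i)) (cidx m x).
rewrite dmean_cst; apply.
- by apply: L1_cell; exact: integrable0.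
- by apply: L1_cell; apply: L1_osc; exact: L1_wpart.
by move=> y _; exact: osc_ge0.
Qed.

Let osc_part_ge0 x : 0 <= (2 + 4 * M) * (\sum_i dproj m (osc m (wpart i)) x).
Proof.
by apply: mulr_ge0; [rewrite addr_ge0// mulr_ge0// ltW|apply: sumr_ge0 => i _; exact: dproj_osc_ge0].
Qed.

Let mean_part_ge0 x : 0 <= (8 * M + 2) * r * (\sum_i `|dproj m (wpart i) x|).
Proof.
apply: mulr_ge0; last exact: sumr_ge0.
by apply: mulr_ge0; [rewrite addr_ge0// mulr_ge0// ltW|exact: ltW (mesh_gt0 _)].
Qed.

Lemma sobolev_error_ge0 x : 0 <= sobolev_error x.
Proof. by rewrite !addr_ge0// osum_ge0. Qed.

Lemma L1_sobolev_error : L1 sobolev_error.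
Proof.
apply: L1D; first apply: L1D; [apply: L1Z|exact: L1_osum|apply: L1Z].
  by have [] := L1_sum (fun i => L1_dproj m (L1_osc m (L1_wpart oO sf i))).
by have [] := L1_sum (fun i => L1_norm (L1_dproj m (L1_wpart oO sf i))).
Qed.

(** Averaging contracts L^1, so the averaged oscillations integrate to at most the oscillations
    themselves; together with [osum] this turns 2 + 4 M into 3 + 4 M. *)
Lemma integral_sobolev_error : \int[mu]_x sobolev_error x <=
  (3 + 4 * M) * (\sum_i \int[mu]_x osc m (wpart i) x) +
  (8 * M + 2) * r * (\sum_i \int[mu]_x `|wpart i x|).
Proof.
have [i1 e1'] := L1_sum (fun i => L1_dproj m (L1_osc m (L1_wpart oO sf i))).
have [i2 e2] := L1_sum (fun i => L1_osc m (L1_wpart oO sf i)).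
have [i3 e3] := L1_sum (fun i => L1_norm (L1_dproj m (L1_wpart oO sf i))).
have j1 := L1Z (2 + 4 * M) i1; have j3 := L1Z ((8 * M + 2) * r) i3.
have r0 := @mesh_gt0 R m.
have -> : \int[mu]_x sobolev_error x =
   (2 + 4 * M) * (\sum_i \int[mu]_x dproj m (osc m (wpart i)) x) + (\sum_i \int[mu]_x osc m (wpart i) x) +
   (8 * M + 2) * r * (\sum_i \int[mu]_x `|dproj m (wpart i) x|).
  apply: etrans (RintegralD measurableT (L1D j1 i2) j3) _.
  congr (_ + _); last first.
    by apply: etrans (RintegralZl ((8 * M + 2) * r) measurableT i3) _; rewrite e3.
  apply: etrans (RintegralD measurableT j1 i2) _; rewrite e2; congr (_ + _).
  by apply: etrans (RintegralZl (2 + 4 * M) measurableT i1) _; rewrite e1'.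
have le1 : \sum_i \int[mu]_x dproj m (osc m (wpart i)) x <= \sum_i \int[mu]_x osc m (wpart i) x.
  apply: ler_sum => i _; have iW := L1_osc m (L1_wpart oO sf i).
  have := Rintegral_dproj_le m iW.
  under eq_Rintegral do rewrite ger0_norm ?dproj_osc_ge0//.
  by under [X in _ <= X -> _]eq_Rintegral do rewrite ger0_norm ?osc_ge0//.
have le2 : \sum_i \int[mu]_x `|dproj m (wpart i) x| <= \sum_i \int[mu]_x `|wpart i x|.
  by apply: ler_sum => i _; exact: Rintegral_dproj_le (L1_wpart oO sf i).
rewrite (_ : 3 + 4 * M = (2 + 4 * M) + 1); last by ring.
rewrite [((2 + 4 * M) + 1) * _]mulrDl mul1r; apply: lerD; first by rewrite lerD2r ler_wpM2l// addr_ge0// mulr_ge0// ltW.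
by rewrite ler_wpM2l// mulr_ge0// ?addr_ge0// ?mulr_ge0// ltW.
Qed.

Let G k := (fun y => coordinate k (qinterp Omega f m y)).

Lemma partials_qinterp k w (x : R * R) : U x ->
  partials w (G k) x = partials w (qval (q m (cidx m x) k)) x.
Proof.
move=> Ux; apply: (@nbhs_singleton _ x (fun y => partials w (G k) y = partials w (qval (q m (cidx m x) k)) y)).
apply: partials_near; apply: filterS (qinterp_near Ux) => y; rewrite /G => ->.
by case: (ord2P k) => ->.
Qed.

Lemma le_osum i x : osc m (wpart i) x <= sobolev_error x.
Proof.
apply: (@le_trans _ _ (osum Omega f m x)).
  by apply: (ler_sum1 (F := fun i => osc m (wpart i) x)) => j; exact: osc_ge0.
by rewrite /sobolev_error -addrA addrCA lerDl addr_ge0.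
Qed.

Lemma value_error k (x : R * R) : U x -> `|coordinate k (f x) - partials [::] (G k) x| <= sobolev_error x.
Proof.
move=> Ux; rewrite partials_qinterp//; have [cO _ _ _] := good Ux.
have xc : ccell m (cidx m x) x by apply: cell_sub_ccell.
apply: le_trans (hM k cO xc) _; rewrite /sobolev_error.
set S := \sum_i dproj _ _ _; set T := \sum_i `|_|.
have hS i : dmean m (osc m (wpart i)) (cidx m x) <= S.
  by apply: (ler_sum1 (F := fun i => dproj m (osc m (wpart i)) x)) => j; exact: dproj_osc_ge0.
have hT i : `|dmean m (wpart i) (cidx m x)| <= T.
  exact: (ler_sum1 (F := fun i => `|dproj m (wpart i) x|)).
have S0 : 0 <= S by apply: sumr_ge0 => i _; exact: dproj_osc_ge0.
have T0 : 0 <= T by apply: sumr_ge0.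
have rT : 0 <= r * T by rewrite mulr_ge0// ltW// mesh_gt0.
apply: (@le_trans _ _ ((2 + 4 * M) * S + 8 * M * r * T)).
  apply: quad_error_le2; [exact: ltW|exact: mesh_gt0|exact: mesh_le1|exact: S0|exact: hS|
    exact: hS|exact: hS|exact: hT|exact: hT|exact: hT|exact: T0].
have := osum_ge0 Omega f m x; move: (osum _ _ _ _) => o o0.
rewrite (_ : (8 * M + 2) * r * T = 8 * M * r * T + 2 * (r * T)); last by ring.
by apply: lerD; rewrite lerDl// mulr_ge0.
Qed.

(** The positions [j], [j1], [j2] in [deriv_word] select a first derivative and its row of the
    Hessian, so that one proof serves both directions. The gradient of the polynomial is the mean
    plus a linear term of size at most r (|b| + |c|). *)
Lemma gradient_error k i j1 j2 j (x : R * R) : U x ->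
  dmean m (wpart (k, j)) (cidx m x) = (if i == 0 then q1 else q2) (q m (cidx m x) k) ->
  dmean m (wpart (k, j1)) (cidx m x) = (if i == 0 then q11 else q12) (q m (cidx m x) k) ->
  dmean m (wpart (k, j2)) (cidx m x) = (if i == 0 then q12 else q22) (q m (cidx m x) k) ->
  `|wpart (k, j) x - partials [:: i] (G k) x| <= sobolev_error x.
Proof.
move=> Ux ej ej1 ej2; rewrite partials_qinterp// /= partial_qval.
have : qc (q m (cidx m x) k) = cell_center m (cidx m x) by [].
move: (q m (cidx m x) k) ej ej1 ej2 => Q ej ej1 ej2 qcQ.
have xc : ccell m (cidx m x) x by apply: cell_sub_ccell.
have [d1 d2] := ccell_center_dist xc.
have e' : `|wpart (k, j) x - qgrad Q i x| <= osc m (wpart (k, j)) x +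
   r * (`|dproj m (wpart (k, j1)) x| + `|dproj m (wpart (k, j2)) x|).
  rewrite /osc /dproj ej ej1 ej2 /qgrad /qd1 /qd2 /= qcQ.
  move: (wpart (k, j) x) => w0.
  have gen (a b c X Y : R) : `|X| <= r -> `|Y| <= r ->
      `|w0 - (a + b * X + c * Y)| <= `|w0 - a| + r * (`|b| + `|c|).
    move=> hX hY; rewrite (_ : w0 - _ = (w0 - a) - (b * X + c * Y)); last by ring.
    apply: le_trans (ler_normB _ _) _; rewrite lerD2l mulrDr.
    apply: le_trans (ler_normD _ _) _; rewrite !normrM.
    by apply: lerD; rewrite mulrC ler_wpM2r.
  by case: eqP => _; exact: gen.
apply: le_trans e' _; rewrite /sobolev_error.
have hT i' : `|dproj m (wpart i') x| <= \sum_i `|dproj m (wpart i) x|.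
  exact: (ler_sum1 (F := fun i => `|dproj m (wpart i) x|)).
have h1 := hT (k, j1); have h2 := hT (k, j2); move: (\sum_i `|_|) h1 h2 (osc_part_ge0 x) => T h1 h2 o1.
have r0 := @mesh_gt0 R m.
have T0 : 0 <= T by apply: le_trans h1.
apply: lerD.
  apply: (@le_trans _ _ (osum Omega f m x)); last by rewrite lerDr.
  by apply: (ler_sum1 (F := fun i => osc m (wpart i) x)) => j'; exact: osc_ge0.
apply: (@le_trans _ _ (r * (T + T))); first by rewrite ler_pM2l//; exact: lerD.
rewrite (_ : (8 * M + 2) * r * T = r * (T + T) + 8 * M * (r * T)); last by ring.
by rewrite lerDl; apply: mulr_ge0; [rewrite mulr_ge0// ltW|rewrite mulr_ge0// ltW].
Qed.

Lemma hessian_error k i i' j (x : R * R) : U x ->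
  dmean m (wpart (k, j)) (cidx m x) = qhess (q m (cidx m x) k) i i' ->
  `|wpart (k, j) x - partials [:: i; i'] (G k) x| <= sobolev_error x.
Proof.
move=> Ux ej; rewrite partials_qinterp// /= partial2_qval -ej; exact: (le_osum (k, j) x).
Qed.

Lemma ae_all (P : T2 -> Prop) : (forall x, P x) -> {ae mu, forall x, P x}.
Proof.
by move=> h; exists set0; split => //; move=> x /= hx; exfalso; exact: hx.
Qed.

(** The chosen weak derivative of order 0 is only some representative of the coordinate function,
    which is itself another one. *)
Lemma weak_partial_nil k : {ae mu, forall x, Omega x ->
  weak_partial Omega [::] (fun y => coordinate k (f y)) x = coordinate k (f x)}.
Proof.
apply: (weak_partial_unique oO (weak_partialP sf k (isT : (@size 'I_2 [::] <= 2)%N))).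
have iF := continuous_on_loc_integrable oO (continuous_coordinate cf (k := k)).
by split => // phi _; rewrite expr0 mul1r.
Qed.

Lemma ae_sobolev_error k w : (size w <= 2)%N -> {ae mu, forall x, U x ->
  `|weak_partial Omega w (fun y => coordinate k (f y)) x - partials (rev w) (G k) x| <=
    sobolev_error x}.
Proof.
have E t (x : R * R) : U x -> weak_partial Omega (deriv_word t) (fun y => coordinate k (f y)) x = wpart (k, t) x.
  by move=> /removed_sub Ox; rewrite (wpartE f (k, t) Ox).
case: w => [|i [|j [|//]]] _.
- apply: ae_mono (weak_partial_nil k) _ => x e' Ux.
  by rewrite e'; [exact: value_error|exact: removed_sub].
- apply: ae_all => x Ux; case: (ord2P i) => ->.
    rewrite (E (@Ordinal 5 0 isT))//.
    by apply: (@gradient_error k 0 (@Ordinal 5 2 isT) (@Ordinal 5 3 isT)).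
  rewrite (E (@Ordinal 5 1 isT))//.
  by apply: (@gradient_error k 1 (@Ordinal 5 3 isT) (@Ordinal 5 4 isT)).
case: (ord2P i) => ->; case: (ord2P j) => ->.
- by apply: ae_all => x Ux; rewrite (E (@Ordinal 5 2 isT))//; exact: hessian_error.
- by apply: ae_all => x Ux; rewrite (E (@Ordinal 5 3 isT))//; exact: hessian_error.
(* The word [:: 1; 0] does not occur in [deriv_word]; its weak derivative is exchanged for that of
   [:: 0; 1]. *)
- have c := weak_mixed_comm oO (weak_partialP sf k (isT : (@size 'I_2 [:: 0%R; 1%R] <= 2)%N))
    (weak_partialP sf k (isT : (@size 'I_2 [:: 1%R; 0%R] <= 2)%N)).
  have E3 x : U x -> weak_partial Omega [:: 0; 1] (fun y => coordinate k (f y)) x =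
      wpart (k, @Ordinal 5 3 isT) x by move=> Ux; exact: (E (@Ordinal 5 3 isT)).
  have h3 x : U x -> `|wpart (k, @Ordinal 5 3 isT) x - partials [:: 0; 1] (G k) x| <= sobolev_error x.
    by move=> Ux; exact: hessian_error.
  move: (weak_partial Omega [:: 0; 1] _) (weak_partial Omega [:: 1; 0] _) E3 c => u v E3 c.
  by apply: (ae_mono c) => x e' Ux; rewrite -(e' (removed_sub Ux)) (E3 _ Ux); exact: h3.
by apply: ae_all => x Ux; rewrite (E (@Ordinal 5 4 isT))//; exact: hessian_error.
Qed.

Lemma qinterp_sobolev : sobolev1_map 2 U (f \- qinterp Omega f m)%R /\
  (sobolev1_norm 2 U (f \- qinterp Omega f m)%R <= (14 * \int[mu]_x sobolev_error x)%:E)%E.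
Proof.
have cB k : (fun x => coordinate k ((f \- qinterp Omega f m)%R x)) =
    (fun x => coordinate k (f x) - G k x).
  by apply/funext => x; case: (ord2P k) => ->.
have [sg _ _] := qinterp_diffeo.
have main k := sobolev_diff oO oU removed_sub (sf k) (sg k) L1_sobolev_error
  sobolev_error_ge0 (ae_sobolev_error k).
split => [k|]; first by rewrite cB; have [] := main k.
rewrite /sobolev1_norm.
(* Two components and 1 + 2 + 4 words of length at most 2 give 14 summands, each at most the
   integral of the majorant. *)
apply: (@le_trans _ _ (\sum_(i < 2) \sum_(j < 3) \sum_(w : j.-tuple 'I_2)
   (\int[mu]_x sobolev_error x)%:E)%E).
  apply: lee_sum => k _; apply: lee_sum => j _; apply: lee_sum => w _.
  rewrite cB; have [_ h] := main k; apply: h.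
  by rewrite size_tuple -ltnS.
move: (\int[mu]_x sobolev_error x) => b.
under eq_bigr do under eq_bigr do rewrite sumEFin sumr_const card_tuple card_ord.
under eq_bigr do rewrite sumEFin.
rewrite sumEFin lee_fin !big_ord_recl !big_ord0 /= !expn0 !expn1.
by rewrite !addr0 !mulrS !mulr0n !addr0; lra.
Qed.

End OnGoodCells.

(** * Smallness of the removed set *)

Section Smallness.
Context {R : realType}.
Local Notation T2 := (measurableTypeR R * measurableTypeR R)%type.
Local Notation mu := (leb2 R).

Lemma exists_small (K b : R) : 0 <= K -> 0 < b -> exists e, [/\ 0 < e, e <= 1 & K * e <= b].
Proof.
move=> K0 b0; have K1 : 0 < K + 1 by rewrite ltr_wpDl.
exists (Num.min 1 (b / (K + 1))); split.
- by rewrite lt_min ltr01 divr_gt0.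
- by rewrite ge_min lexx.
apply: (@le_trans _ _ ((K + 1) * (b / (K + 1)))).
  by apply: ler_pM => //; [rewrite le_min ler01 divr_ge0// ltW|rewrite lerDl|rewrite ge_min lexx orbT].
by rewrite mulrC divfK// gt_eqF.
Qed.

Lemma mesh_small (K b : R) : 0 <= K -> 0 < b ->
  exists m0, forall m, (m0 <= m)%N -> K * mesh m < b.
Proof.
move=> K0 b0; have K1 : 0 < K + 1 by rewrite ltr_wpDl.
have [m0 _ h] : \forall m \near \oo, mesh m < b / (K + 1) :> R.
  by apply: (cvgr_lt 0 (@mesh_cvg0 R)); exact: divr_gt0.
exists m0 => m /h; rewrite /= ltr_pdivlMr// => hm.
apply: le_lt_trans hm; rewrite mulrC ler_wpM2l ?lerDl//.
by apply: ltW; exact: mesh_gt0.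
Qed.

Lemma leb2_collar (U : set (R * R)) : open U -> (mu U < +oo)%E -> forall t : R, 0 < t ->
  exists m0, forall m, (m0 <= m)%N -> (mu (U `\` inner m U) < t%:E)%E.
Proof.
move=> oU Ufin t t0; have mU := open_measurable2 oU.
apply: (nonincreasing_measure_lt (F := fun m => U `\` inner m U : set T2)) => //.
- apply: le_lt_trans Ufin; apply: le_measure; [rewrite inE|by rewrite inE|exact: subDsetl].
  by apply: measurableD => //; exact: measurable_inner.
- by move=> m; apply: measurableD => //; exact: measurable_inner.
- by move=> m x [Ux nx]; split => // /inner_incr.
rewrite (_ : \bigcap_m _ = set0) ?measure0//.
apply/seteqP; split => // x h.
have Ux : U x by have [] := h 0%N Logic.I.
by move: (Ux); rewrite -{1}(bigcup_inner oU) => -[m _ xm]; have [_] := h m Logic.I.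
Qed.

(* A cell of side r loses at most 4 * (r * mesh n) * r to its frame. *)
Lemma leb2_frame m n (U : set (R * R)) : open U -> (0 < n)%N ->
  (mu (inner m U `\` [set x | off_frame m n x]) <= (4 * mesh n)%:E * mu U)%E.
Proof.
move=> oU n0; have mI := @measurable_inner R m U.
have mN : measurable ([set x | off_frame m n x] : set T2) := dyadic_measurable (@dyadic_off_frame R m n).
have mA := measurableD mI mN.
have r0 := @mesh_gt0 R m; have k0 := @mesh_gt0 R n.
have k1 : mesh n <= 2^-1 :> R.
  by rewrite /mesh lef_pV2 ?posrE ?exprn_gt0// -[leLHS]expr1 ler_weXn2l// ler1n.
apply: (@le_trans _ _ ((4 * mesh n)%:E * mu (inner m U))%E); last first.
  apply: lee_wpmul2l; first by rewrite lee_fin mulr_ge0// ltW.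
  by apply: le_measure; [rewrite inE|rewrite inE; exact: open_measurable2|exact: innerS].
have c0 : 0 <= 4 * mesh n :> R by rewrite mulr_ge0// ltW.
have e1 : mu (inner m U `\` [set x | off_frame m n x]) =
    (\int[mu]_x (\1_(inner m U `\` [set x | off_frame m n x]) x : R)%:E)%E.
  by rewrite integral_indic// setIT.
have e2 : ((4 * mesh n)%:E * mu (inner m U) = \int[mu]_x ((4 * mesh n)%:E * (\1_(inner m U) x : R)%:E))%E.
  rewrite ge0_integralZl//; first by rewrite integral_indic// setIT.
  by apply/measurable_EFinP; exact: measurable_indic.
rewrite e1 e2.
apply: (@le_integral_cells R m) => [||x|x|c].
- by apply/measurable_EFinP; exact: measurable_indic.
- by apply: measurable_funeM; apply/measurable_EFinP; exact: measurable_indic.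
- by rewrite lee_fin.
- by rewrite mule_ge0// lee_fin.
have mc := @measurable_cell R m c.
rewrite integral_indic// ge0_integralZl//; last first.
  by apply/measurable_EFinP; apply: measurable_funTS; exact: measurable_indic.
rewrite integral_indic//.
have [[x [xc xi]]|none] := pselect (exists x, cell m c x /\ inner m U x); last first.
  rewrite (_ : _ `&` cell m c = set0) ?measure0 ?mule_ge0//.
  by apply/seteqP; split => // y [[yi _] yc]; apply: none; exists y.
have ci : cell m c `<=` inner m U.
  by move=> y yc; apply: (@dyadic_inner R m U x y) => //; rewrite (xc : cidx m x = _) (yc : cidx m y = _).
rewrite (setIidr ci) (@leb2_cell R) -EFinM.
pose B : set T2 :=
  (`[c.1%:~R * mesh m + mesh (m + n), (c.1 + 1)%:~R * mesh m - mesh (m + n)[%classic `*`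
   `[c.2%:~R * mesh m + mesh (m + n), (c.2 + 1)%:~R * mesh m - mesh (m + n)[%classic).
have side (i : int) : (i + 1)%:~R * mesh m = i%:~R * mesh m + mesh m :> R.
  by rewrite intrD mulrDl mul1r.
have rho : mesh (m + n) = mesh m * mesh n :> R := meshD m n.
have rk : mesh (m + n) <= mesh m / 2 :> R by rewrite rho ler_pM2l.
have rho0 := @mesh_gt0 R (m + n).
have BE : (inner m U `\` [set x | off_frame m n x]) `&` cell m c = cell m c `\` B.
  apply/seteqP; split => y.
    move=> [[_ yn] yc]; split => // -[/=]; rewrite !in_itv/= => b1 b2; apply: yn.
    by rewrite /off_frame -(yc : cidx m y = c) in b1 b2 *.
  move=> [yc yB]; split => //; split; first exact: ci.
  by move=> [b1 b2]; apply: yB; rewrite /B -(yc : cidx m y = c); split; rewrite /= in_itv.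
have Bc : B `<=` cell m c.
  rewrite cellE => y []; rewrite /= !in_itv/= => /andP[? ?] /andP[? ?].
  by split; apply/andP; split; lra.
have mB : measurable B := measurable_itv2 _ _.
rewrite BE; have cfin : (mu (cell m c) < +oo)%E by rewrite (@leb2_cell R) ltry.
have -> : mu (cell m c `\` B) = ((mesh m ^+ 2)%:E - mu B)%E.
  apply: etrans (measureD mc mB cfin) _; rewrite (setIidr Bc).
  by congr (_ - _)%E; exact: leb2_cell.
have -> : mu B = ((mesh m - 2 * mesh (m + n)) * (mesh m - 2 * mesh (m + n)))%:E.
  apply: etrans (@leb2_itv2 R _ _ _ _ _ _ _ _ _ _) _; rewrite ?side; [lra|lra|].
  by congr (_ * _)%:E; ring.
rewrite -EFinB lee_fin rho.
rewrite (_ : _ - _ = 4 * mesh n * mesh m ^+ 2 - 4 * (mesh m * mesh n) ^+ 2); last by ring.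
by rewrite lerBlDr lerDl mulr_ge0// sqr_ge0.
Qed.

End Smallness.

(** * Measure of the degenerate set and of the bad cells *)

Section Degenerate.
Context {R : realType}.
Local Notation T2 := (measurableTypeR R * measurableTypeR R)%type.
Local Notation mu := (leb2 R).
Variables (Omega : set (R * R)) (f : R * R -> R * R).
Hypothesis oO : open Omega.
Hypothesis sf : sobolev1_map 2 Omega f.
Hypothesis Ofin : (mu Omega < +oo)%E.
Hypothesis hJ : {ae mu, forall x, Omega x -> 0 < weak_jacobian Omega f x}.

(** The sets where the Jacobian is at most 1 / (n + 1) decrease to the set where it is at most 0,
    which is null, and they have finite measure. *)
Lemma leb2_degenerate_small (t : R) : 0 < t ->
  exists2 d : R, 0 < d & (mu (degenerate Omega f d) < t%:E)%E.
Proof.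
move=> t0.
have md d := measurable_degenerate oO sf d.
have [n0 h] : exists n0, forall n, (n0 <= n)%N -> (mu (degenerate Omega f n.+1%:R^-1) < t%:E)%E.
  apply: (nonincreasing_measure_lt (F := fun n => degenerate Omega f n.+1%:R^-1)) => //.
  - exact: degenerate_fin.
  - move=> n x [Ox hx]; split => //; apply: le_trans hx _.
    by rewrite lef_pV2 ?posrE ?ltr0n// ler_nat.
  apply: measure_negligible; first exact: bigcap_measurableType.
  apply: negligibleS hJ => x hx /=; apply/not_implyP.
  have [Ox _] := hx 0%N Logic.I; split => // Jx.
  have [n _ hn] : \forall n \near \oo, n.+1%:R^-1 < weak_jacobian Omega f x.
    by apply: (cvgr_lt 0 (@cvg_harmonic R)).
  have [_] := hx n Logic.I; rewrite leNgt => /negP; apply.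
  by apply: hn; exact: leqnn.
by exists n0.+1%:R^-1; [rewrite invr_gt0 ltr0n|exact: h].
Qed.

Lemma integral_defect (e C d : R) m :
  ((\int[mu]_x defect Omega f e C d m x)%:E = mu (degenerate Omega f d) +
   (e^-1 * (\sum_i \int[mu]_x osc m (wpart Omega f i) x) +
    C^-1 * (\sum_i \int[mu]_x `|wpart Omega f i x|))%:E)%E.
Proof.
have [i1 e1] := L1_sum (fun i => L1_osc m (L1_wpart oO sf i)).
have [i2 e2] := L1_sum (fun i => L1_norm (L1_wpart oO sf i)).
have md := measurable_degenerate oO sf d.
have i0 := L1_indic md (degenerate_fin oO sf Ofin d).
have -> : mu (degenerate Omega f d) = (\int[mu]_x (\1_(degenerate Omega f d) x : R))%:E.
  by rewrite -(ge0_Rintegral_EFin i0) integral_indic// setIT.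
rewrite -EFinD; congr EFin.
apply: etrans (RintegralD measurableT i0 (L1D (L1Z e^-1 i1) (L1Z C^-1 i2))) _.
congr (_ + _); apply: etrans (RintegralD measurableT (L1Z e^-1 i1) (L1Z C^-1 i2)) _.
rewrite -e1 -e2; congr (_ + _).
  exact: (RintegralZl _ measurableT i1).
exact: (RintegralZl _ measurableT i2).
Qed.

Lemma leb2_bad_cells (e C d : R) m : 0 < e -> 0 < C ->
  (mu (inner m Omega `&` [set x | (1 <= dmean m (defect Omega f e C d m) (cidx m x))%R]) <=
   (\int[mu]_x defect Omega f e C d m x)%:E)%E.
Proof.
move=> e0 C0; apply: (@leb2_dmean_ge1 R m).
- exact: L1_defect.
- by move=> x; apply: defect_ge0; exact: ltW.
- apply: measurableI; first exact: measurable_inner.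
  exact: (@measurable_dyadic R m (fun c => 1 <= dmean m (defect Omega f e C d m) c)).
by move=> x [].
Qed.

End Degenerate.

(** * Choice of the constants *)

Lemma within_continuous_open {R : realType} (U : set (R * R)) (f : R * R -> R * R) : open U ->
  {within U, continuous f} -> forall x, U x -> {for x, continuous f}.
Proof.
by move=> oU; rewrite (continuous_open_subspace f oU) => h x Ux; apply: h; rewrite inE.
Qed.

(** Since e <= 1 <= C, 4 C e + 2 e^2 <= 6 C e; this is the origin of the summand 6 C in the
    smallness condition on [e]. *)
Lemma determinant_margin {R : realFieldType} (C M e d k : R) : 1 <= C -> 0 <= M -> 0 < e -> e <= 1 ->
  0 < d -> k <= 1 -> (6 * C + 8 * C * M) * e <= d * k / 8 -> 4 * C * e + 2 * e * e <= d / 2.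
Proof.
move=> C1 M0 e0 e1 d0 k1 h.
have CMe : 0 <= C * M * e by rewrite !mulr_ge0//; [lra|exact: ltW].
have ee : e * e <= C * e by rewrite ler_pM2r//; lra.
have dk : d * k <= d by rewrite ler_piMr// ltW.
move: h; rewrite (_ : (6 * C + 8 * C * M) * e = 6 * (C * e) + 8 * (C * M * e)); last by ring.
move: (C * M * e) CMe => V V0; rewrite -(mulrA 4) -(mulrA 2).
by move: (C * e) (e * e) (d * k) ee dk => X Y Z; clear -V0 d0; lra.
Qed.

(** Here [k] is the frame width relative to the side r of the cell. The summand 8 C M is 2 C times
    the factor 4 M of e in the relative error; the part free of r and the part proportional to r
    each receive d k / 8 of the available d k / 2. [I] leaves room for a further condition on r. *)
Lemma image_margin {R : realFieldType} (C M e d k r I : R) : 1 <= C -> 0 <= M -> 0 < e ->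
  0 < d -> 0 < k -> k <= 1 -> 0 < r -> 0 <= I -> (6 * C + 8 * C * M) * e <= d * k / 8 ->
  (16 * C * C + 2 * C * (2 + 8 * M * C + 4 * C) + I) * r < d * k / 8 ->
  16 * C * C * r < d / 2 /\
  2 * C * ((4 * M * e + r * (2 + 8 * M * C)) + 4 * C * r) * r < d / 2 * (r * k).
Proof.
move=> C1 M0 e0 d0 k0 k1 r0 I0 h1 h2.
have dk : d * k <= d by rewrite ler_piMr// ltW.
have C0 : 0 <= C by lra.
have [r00 e00] := (ltW r0, ltW e0).
have Ce : 0 <= C * e by rewrite mulr_ge0.
have p1 : 0 <= 16 * C * C * r by rewrite !mulr_ge0.
have p2 : 0 <= 2 * C * (2 + 8 * M * C + 4 * C) * r by rewrite !(mulr_ge0, addr_ge0).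
have p3 : 0 <= I * r by rewrite mulr_ge0.
move: h1 h2; rewrite (_ : (6 * C + 8 * C * M) * e = 6 * (C * e) + 8 * C * M * e); last by ring.
rewrite (_ : (_ + _ + I) * r = 16 * C * C * r + 2 * C * (2 + 8 * M * C + 4 * C) * r + I * r); last by ring.
rewrite (_ : 2 * C * (4 * M * e + r * (2 + 8 * M * C) + 4 * C * r) * r = (8 * C * M * e + 2 * C * (2 + 8 * M * C + 4 * C) * r) * r); last by ring.
rewrite (_ : d / 2 * (r * k) = d * k / 2 * r); last by field.
rewrite ltr_pM2r//; move: (16 * C * C * r) (2 * C * _ * r) (I * r) p1 p2 p3 => X Y Z p1 p2 p3.
move: (C * e) (8 * C * M * e) (d * k) Ce dk => P Q V Ce dk h1 h2.
by clear -h1 h2 p1 p2 p3 Ce dk d0; split; lra.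
Qed.

Theorem theorem1p2 (R : realType) (Omega : set (R * R)) (f : R * R -> R * R)
  (hOmega : domain Omega)
  (hfin : (leb2 R Omega < +oo)%E)
  (hfW : sobolev1_map 2 Omega f)
  (hfhom : homeomorphism_onto_image Omega f)
  (hJ : {ae leb2 R, forall x, Omega x -> 0 < weak_jacobian Omega f x})
  (nu : R) (hnu : 0 < nu) :
  exists Q : nat -> set (R * R),
    [/\ forall i, is_square (Q i),
        locally_finite_in Omega Q,
        (leb2 R (\bigcup_i Q i) < nu%:E)%E &
        exists g : R * R -> R * R,
          [/\ diffeomorphism_onto_image (Omega `\` \bigcup_i Q i) g,
              sobolev1_map 2 (Omega `\` \bigcup_i Q i) (f \- g)%R &
              (sobolev1_norm 2 (Omega `\` \bigcup_i Q i)
                 (f \- g)%R < nu%:E)%E]].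
Proof.
have [oO _ _] := hOmega; have [fc [h [hf _]]] := hfhom.
have cf := within_continuous_open oO fc.
have injf x y : Omega x -> Omega y -> f x = f y -> x = y.
  by move=> Ox Oy fxy; rewrite -(hf x Ox) -(hf y Oy) fxy.
have [M M0 hM] := quad_error oO cf hfW.
(* The removed measure will be at most six shares [t]: one each for the collar, the frames and the
   filler squares, three for the bad cells. The Sobolev norm takes two. *)
pose t := nu / 20; have t0 : 0 < t by rewrite divr_gt0.
have [d d0 hd] := leb2_degenerate_small oO hfW hfin hJ t0.
pose IG := \sum_i \int[leb2 R]_x `|wpart Omega f i x|.
have IG0 : 0 <= IG by apply: sumr_ge0 => i _; apply: Rintegral_ge0.
(* Makes IG / C at most [t], so that cells with large mean derivatives occupy little area. *)
pose C := 1 + IG / t.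
have C1 : 1 <= C by rewrite lerDl divr_ge0// ltW.
have C0 : 0 < C := lt_le_trans ltr01 C1.
have hC : C^-1 * IG <= t.
  by rewrite mulrC ler_pdivrMr// /C mulrDr mulr1 mulrCA divff ?gt_eqF// mulr1 lerDr ltW.
pose L := fine (leb2 R Omega).
have LE : leb2 R Omega = L%:E by rewrite fineK// ge0_fin_numE.
have L0 : 0 <= L by rewrite -lee_fin -LE.
have [n0 hn] := mesh_small (mulr_ge0 (ler0n R 4) L0) t0.
(* The frames occupy at most a fraction 4 [mesh n] of the domain. The successor makes [n] positive,
   as [leb2_frame] demands for two opposite strips to fit into a cell. *)
pose n := n0.+1; have {hn} hn : 4 * L * mesh n < t := hn n (leqnSn n0).
have k0 := @mesh_gt0 R n; have k1 := @mesh_le1 R n.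
have b0 : 0 < d * mesh n / 8 by rewrite divr_gt0// mulr_gt0.
have K0 : 0 <= 6 * C + 8 * C * M by rewrite addr_ge0// !mulr_ge0// ltW.
(* [e] comes after [n], because the error it allows has to be small against the relative frame width
   [mesh n]. *)
have [e [e0 e1 he]] := exists_small K0 b0.
(* The first two summands are the coefficients of r in [image_margin]; the third is the coefficient
   of r in the bound for the Sobolev norm. One choice of level serves them all. *)
pose K := 16 * C * C + 2 * C * (2 + 8 * M * C + 4 * C) + 14 * (8 * M + 2) * IG.
have [CC CM] : 0 <= C * C /\ 0 <= C * M by split; apply: mulr_ge0; exact: ltW.
have A1 : 0 <= 16 * C * C by rewrite -mulrA mulr_ge0.
have A2 : 0 <= 2 * C * (2 + 8 * M * C + 4 * C) by rewrite mulr_ge0 ?addr_ge0 ?mulr_ge0// ltW.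
have A3 : 0 <= 14 * (8 * M + 2) * IG by rewrite !mulr_ge0// ?addr_ge0// mulr_ge0// ltW.
have KK : 0 <= K by rewrite /K !addr_ge0.
have [bt btd] : 0 < Num.min t (d * mesh n / 8) /\ True by rewrite lt_min t0 b0.
have [m1 hm1] := mesh_small KK bt.
have [m2 hm2] := leb2_collar oO hfin t0.
(* The first bound makes the oscillations contribute at most [t] to the Sobolev norm, the second at
   most [t] to the mean defect, where they are divided by [e]. *)
have tO : 0 < Num.min (t / (14 * (3 + 4 * M))) (e * t).
  rewrite lt_min divr_gt0 ?mulr_gt0//.
  by rewrite addr_gt0// mulr_gt0.
have [m3 hm3] := osc_sum_cvg (L1_wpart oO hfW) tO.
pose m := maxn m1 (maxn m2 m3).
have {}hm1 := hm1 m (leq_maxl _ _).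
have {}hm2 := hm2 m (leq_trans (leq_maxl _ _) (leq_maxr _ _)).
have {}hm3 := hm3 m (leq_trans (leq_maxr _ _) (leq_maxr _ _)).
have r0 := @mesh_gt0 R m.
pose OS := \sum_i \int[leb2 R]_x osc m (wpart Omega f i) x.
move: hm1 hm3; rewrite !lt_min -/OS => /andP[hm1 hm1'] /andP[hm3 hm3'].
have hd' := determinant_margin C1 (ltW M0) e0 e1 d0 k1 he.
have [hr hs] := image_margin C1 (ltW M0) e0 d0 k0 k1 r0 A3 he hm1'.
rewrite -meshD in hs.
pose bad : set (int * int) := [set c | 1 <= dmean m (defect Omega f e C d m) c].
have [Q [sqQ lfQ oU muQ hU]] := removal m n bad oO t0.
have dif := qinterp_diffeo oO cf injf hfW hfin M0 hM e0 e1 C1 d0 hd' hr hs oU hU.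
have [sob norm] := qinterp_sobolev oO cf injf hfW hfin M0 hM e0 e1 C1 d0 hd' hr hs oU hU.
exists Q; split => //.
  apply: le_lt_trans muQ _.
  (* One share each for the degenerate set, for the oscillations over [e] and for the derivatives
     over [C]. *)
  have q2 : (leb2 R (inner m Omega `&` [set x | bad (cidx m x)]) <= (3 * t)%:E)%E.
    apply: le_trans (leb2_bad_cells oO hfW hfin d m e0 C0) _.
    rewrite (integral_defect oO hfW hfin) (_ : 3 * t = t + 2 * t); last by ring.
    rewrite [leRHS]EFinD; apply: leeD; first exact: ltW.
    rewrite lee_fin (_ : 2 * t = t + t); last by ring.
    by apply: lerD => //; rewrite mulrC ler_pdivrMr// mulrC ltW.
  have q3 : (leb2 R (inner m Omega `\` [set x | off_frame m n x]) <= t%:E)%E.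
    apply: le_trans (leb2_frame m oO (ltn0Sn n0)) _.
    by rewrite -/n LE -EFinM lee_fin mulrAC ltW.
  apply: (@le_lt_trans _ _ (t + 3 * t + t + t)%:E).
    rewrite !EFinD; apply: leeD => //; apply: leeD => //; apply: leeD => //; exact: ltW.
  by rewrite lte_fin /t; lra.
exists (qinterp Omega f m); split => //.
apply: le_lt_trans norm _; rewrite lte_fin.
apply: (@le_lt_trans _ _ (14 * ((3 + 4 * M) * OS + (8 * M + 2) * mesh m * IG))).
  by rewrite ler_pM2l//; exact: integral_sobolev_error.
have o1 : 14 * (3 + 4 * M) * OS < t.
  by move: hm3; rewrite ltr_pdivlMr 1?mulrC// mulr_gt0// addr_gt0// mulr_gt0.
have o2 : 14 * (8 * M + 2) * IG * mesh m <= t.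
  apply: le_trans (ltW hm1); rewrite ler_pM2r// /K lerDr addr_ge0//.
rewrite (_ : 14 * _ = 14 * (3 + 4 * M) * OS + 14 * (8 * M + 2) * IG * mesh m); last by ring.
apply: (@lt_le_trans _ _ (t + t)); first exact: ltr_leD.
by rewrite /t; lra.
Qed.
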